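(* Let $v$ be a positive integer. If there exists a $3$-pyramidal KTS$(v)$, then $v=24n+9$ or $v=24n+15$ for some non-negative integer $n$, or $v=48n+3$ for some positive integer $n$ of the form $n=4^em$ with $e\geq 0$ and $m$ odd. Conversely, a $3$-pyramidal KTS$(v)$ exists in each of the following cases: (i) $v=24n+9$ with $n\ge 0$ and $4n+1$ is a sum of two squares; (ii) $v=24n+15$ with $n\ge 0$ and either $2n+1\equiv 0 \pmod 3$ or the square-free part of $2n+1$ has no prime divisor $p\equiv 11\pmod{12}$; (iii) $v=48n+3$ with $n=4^em$, $e\ge 0$, $m$ a positive odd integer.
   Context: A Steiner triple system STS$(v)$ is a pair $(V,\mathcal B)$ where $|V|=v$ and $\mathcal B$ is a set of $3$-subsets (blocks) of $V$ such that any two distinct points lie in exactly one block. A Kirkman triple system KTS$(v)$ is an STS$(v)$ together with a resolution of $\mathcal B$, i.e. a partition of $\mathcal B$ into parallel classes, each of which is a partition of $V$. An automorphism of a KTS is a permutation of the points mapping blocks to blocks and leaving the resolution invariant (mapping parallel classes to parallel classes). A KTS$(v)$ is $3$-pyramidal if it admits an automorphism group fixing exactly three points and acting sharply transitively on the remaining $v-3$ points. *)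

(* Defs.v *)
From mathcomp Require Import all_boot all_fingroup.
Set Implicit Arguments.
Unset Strict Implicit.
Unset Printing Implicit Defensive.

Section TripleSystems.
Variable T : finType.
Implicit Types (B : {set {set T}}) (R : {set {set {set T}}}).

Definition is_STS B : Prop :=
  (forall b, b \in B -> #|b| = 3) /\
  (forall x y : T, x != y -> exists! b : {set T}, [/\ b \in B, x \in b & y \in b]).

(* R is the resolution: the set of parallel classes, each a set of blocks. *)
Definition is_KTS B R : Prop :=
  [/\ is_STS B,
      partition R B
    & forall P : {set {set T}}, P \in R -> partition P [set: T]].

Definition is_KTS_aut B R (s : {perm T}) : Prop :=
  (forall b : {set T}, b \in B -> s @: b \in B) /\
  (forall P : {set {set T}}, P \in R -> [set s @: (b : {set T}) | b in P] \in R).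

(* MathComp's [transitive _, on S | _] is false when S is empty, so a sharply
   transitive action is always on a nonempty set; in particular the trivial
   group does not make the one-block system on 3 points 3-pyramidal. *)
Definition sharply_transitive (G : {group {perm T}}) (S : {set T}) : Prop :=
  [transitive G, on S | 'P] /\ (forall x, x \in S -> 'C_G[x | 'P]%g = 1%g).

Definition is_3pyramidal B R : Prop :=
  exists G : {group {perm T}},
    [/\ forall s, s \in G -> is_KTS_aut B R s,
        #|'Fix_('P)(G)%g| = 3
      & sharply_transitive G (~: 'Fix_('P)(G)%g)].

End TripleSystems.

Definition exists_3pyramidal_KTS (v : nat) : Prop :=
  exists (T : finType) (B : {set {set T}}) (R : {set {set {set T}}}),
    [/\ #|T| = v, is_KTS B R & is_3pyramidal B R].

(* The square-free k such that n = k * m ^ 2 for some m (for n > 0). *)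
Definition squarefree_part (n : nat) : nat :=
  \prod_(p <- primes n | odd (logn p n)) p.

(* Main.v *)
(* Necessity.  Off its three fixed points the group G acts regularly.  For a
   fixed point u and a base point x0, the third point of the block through u and
   x0 is j x0 for an involution j of G, and every involution arises from exactly
   one u; so G has three involutions.  The block through another fixed point v
   in the parallel class of {u, x0, j x0} is stable under j, which makes the
   involutions attached to u and v conjugate.  If the involutions commute, two
   Frattini arguments (for a Sylow 3-subgroup, then for a Sylow 2-subgroup) give
   |G| = 3 * 4^a * m with a > 0 and m odd.  Otherwise each involution transposes
   the other two, and half of G acts oddly on the involutions; pairing an odd g
   with the element that reaches the third point of the block through x0 and
   g x0, and then g with its inverse, shows that the number of odd
   non-involutions is a multiple of 4, whence |G| + 3 = 24n + 9.

   Sufficiency.  A suitable family of base triples in a group G, whose quotients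
   avoid an order 3 subgroup <h> and the three involutions and whose translates
   by an involution j are disjoint, develops under right translation to a
   3-pyramidal system on G and three symbols.  Such families are built on
   D_3 x D and on (R : Z_3) x Z_3^i x D with i <= 2, where
   R = (Z/2^k)[omega] and Z_3 acts on R as omega, by adjoining to D one abelian
   factor C at a time, and by doubling the modulus 2^k.  The new triples are
   obtained from finite patterns over the non-abelian factor: the entries scale a
   transversal of C (or of R modulo doubles) under a group of units containing a
   primitive fourth or third root of unity, or, when C = Z_p with
   p = 11 (mod 12), under the squares. *)
Require Import Defs.
From HB Require Import structures.
From mathcomp Require Import all_boot all_fingroup.
From mathcomp Require Import all_algebra all_solvable all_field.
From mathcomp Require Import zify ring.
Set Implicit Arguments.
Unset Strict Implicit.
Unset Printing Implicit Defensive.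

(** * Groups with three conjugate involutions *)

(** Each family is described by coverings plus an equation for its size; uniqueness of blocks and
    disjointness inside a class then follow by counting. The choice of groups is governed by which
    abelian factors can be adjoined. To spread existing triples over a factor one needs an additive
    [T] with [T], [T + 1], [T - 1] and doubling bijective. On ['Z_3] every additive map is
    multiplication by some c, and one of c - 1, c, c + 1 vanishes; so 3 is adjoined only in squares,
    and one or two left-over factors 3 are placed beside [R : Z_3], with patterns of their own. For
    a prime p > 3 the map [T] may be doubling, and new triples need a symmetry of ['F_p]: a fourth
    root of unity if p = 1 (mod 4), a cube root if p = 1 (mod 3), otherwise only the quadratic
    character. Over [dih3] only the first kind is available, whence sums of two squares in (i). The
    third kind is available over [eis 2 * 'Z_3], [eis 2 * zprod 'Z_3 'Z_3] and [eis 4], but not over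
    [eis 2]; this is the origin of the two alternatives in (ii) and of their absence in (iii). *)

Section Involutions.
Local Open Scope group_scope.
Variables (gT : finGroupType) (G : {group gT}).

Definition involutions : {set gT} := [set z in G | #[z] == 2].
Notation I := involutions.

Lemma involutionsJ g : g \in G -> {in I, forall z, z ^ g \in I}.
Proof. by move=> Gg z; rewrite !inE orderJ => /andP[Gz ->]; rewrite groupJ. Qed.

Lemma involution_mulK z : z \in I -> z * z = 1.
Proof. by rewrite inE => /andP[_ /eqP oz]; rewrite -(expg_order z) oz. Qed.

Lemma acts_involutions : [acts G, on I | 'J].
Proof.
by apply/actsP => g Gg z /=; apply/idP/idP => /involutionsJ zJ;
  [rewrite -(conjgK g z) /= zJ ?groupV | apply: zJ].
Qed.

(** The coercion of a permutation to [bool] is its sign, so this is the sign of conjugation by [g]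
    on the involutions, a homomorphism from [G] to a group of order 2. *)
Definition odd_on_involutions g : bool := restr_perm I (actperm 'J g).
Notation oddI := odd_on_involutions.

Lemma actperm_involutions g : g \in G -> actperm 'J g \in 'N(I | 'P).
Proof.
move=> Gg; apply/astabsP => z; rewrite /= /aperm actpermE /=.
exact: (actsP acts_involutions).
Qed.

Lemma odd_on_involutionsM : {in G &, forall g h, oddI (g * h) = oddI g (+) oddI h}.
Proof.
move=> g h Gg Gh; rewrite /oddI actpermM ?inE //.
by rewrite morphM ?actperm_involutions ?odd_permM.
Qed.

Lemma odd_on_involutions1 : oddI 1 = false.
Proof. by move: (odd_on_involutionsM (group1 G) (group1 G)); rewrite mulg1; case: oddI. Qed.

Lemma odd_on_involutionsX g n : g \in G -> oddI (g ^+ n) = odd n && oddI g.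
Proof.
move=> Gg; elim: n => [|n IHn]; first by rewrite odd_on_involutions1.
by rewrite expgS odd_on_involutionsM ?groupX // IHn /=; case: (odd n); case: (oddI g).
Qed.

Lemma even_of_odd_order g : g \in G -> odd #[g] -> oddI g = false.
Proof.
move=> Gg og; have := odd_on_involutionsX #[g] Gg.
by rewrite expg_order odd_on_involutions1 og.
Qed.

Lemma odd_on_involutionsV g : g \in G -> oddI g^-1 = oddI g.
Proof.
move=> Gg; have := odd_on_involutionsM Gg (groupVr Gg).
by rewrite mulgV odd_on_involutions1; case: (oddI g); case: (oddI g^-1).
Qed.

Hypothesis cardI : #|I| = 3.
Hypothesis transI : [transitive G, on I | 'J].

(** A permutation of three points with a fixed point is the identity or a transposition, and a
    transposition is odd. *)
Lemma even_fixes_involutions g z0 : g \in G -> ~~ oddI g -> z0 \in I ->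
  z0 ^ g = z0 -> {in I, forall z, z ^ g = z}.
Proof.
move=> Gg even_g Iz0 fix0 z1 Iz1; apply/eqP/negPn/negP => neq.
set z2 := z1 ^ g in neq; have Iz2 : z2 \in I by apply: involutionsJ.
have n10 : z1 != z0 by apply: contraNneq neq => e; rewrite /z2 e fix0.
have n20 : z2 != z0.
  by apply: contraNneq n10 => e; rewrite -(inj_eq (conjg_inj g)) fix0 -/z2 e.
have defI : I = [set z0; z1; z2].
  apply/esym/eqP; rewrite eqEcard; apply/andP; split.
    by apply/subsetP => z; rewrite !(in_setU, in_set1) => /orP[/orP[]|] /eqP->.
  by rewrite cardI setUC cardsU1 cards2 !(in_setU, in_set1) (eq_sym z0) n10 negb_or n20 neq.
have g2 : z2 ^ g = z1.
  have : z2 ^ g \in I by apply: involutionsJ.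
  rewrite defI !(in_setU, in_set1) => /orP[/orP[]|] /eqP // e.
    by move: n20; rewrite -(inj_eq (conjg_inj g)) fix0 e eqxx.
  by move: neq; rewrite -(inj_eq (conjg_inj g)) e eqxx.
move: even_g; suff -> : oddI g = tperm z1 z2 by rewrite odd_tperm eq_sym neq.
congr odd_perm; apply/permP => z; have [Iz | notIz] := boolP (z \in I); last first.
  rewrite (out_perm (restr_perm_on _ _)) // tpermD //.
    by apply: contraNneq notIz => <-.
  by apply: contraNneq notIz => <-.
rewrite restr_permE ?actperm_involutions // actpermE /=.
move: Iz; rewrite defI !(in_setU, in_set1) => /orP[/orP[]|] /eqP->.
- by rewrite fix0 tpermD.
- by rewrite tpermL.
by rewrite tpermR.
Qed.

(** By transitivity ['C_H[z]] has index 3 in [H], so it contains no full Sylow 3-subgroup. *)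
Lemma Sylow3_moves_involutions (H S : {group gT}) z :
  H \subset G -> [transitive H, on I | 'J] -> 3.-Sylow(H) S -> z \in I ->
  ~~ (S \subset 'C[z]).
Proof.
move=> sHG trH sylS Iz; apply/negP => sSC.
have sS : S \subset 'C_H[z] by rewrite subsetI (pHall_sub sylS).
have : 3^'.-nat #|H : 'C_H[z]|.
  by case/and3P: sylS => sSH _; apply: pnat_dvd; apply: indexgS.
by rewrite index_cent1 -orbitJ (atransP trH _ Iz) cardI.
Qed.

Lemma dvd3_card : 3 %| #|G|.
Proof.
have [z Iz] : exists z, z \in I by apply/card_gt0P; rewrite cardI.
have <- : #|G : 'C_G[z]| = 3 by rewrite index_cent1 -orbitJ (atransP transI _ Iz).
exact: dvdn_indexg.
Qed.

(** The commutator [z * z ^ s] lies in [S], which has odd order, and squares to 1 because it is a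
    product of two commuting involutions; hence it is trivial. *)
Lemma normalizing_involution_centralizes (H S : {group gT}) z :
  H \subset G -> S \subset H -> odd #|S| -> z \in I -> z \in 'N(S) ->
  {in I &, commutative mulg} -> S \subset 'C[z].
Proof.
move=> sHG sSH oddS Iz nSz comI; apply/subsetP => s Ss.
have Gs : s \in G by rewrite (subsetP sHG) // (subsetP sSH).
have zzE := involution_mulK Iz; have zV : z^-1 = z by apply: (mulgI z); rewrite mulgV.
have Izs : z ^ s \in I by apply: involutionsJ.
have Sc : z * z ^ s \in S.
  have -> : z * z ^ s = (s^-1) ^ z * s by rewrite !conjgE zV !mulgA.
  by rewrite groupM // memJ_norm // groupV.
have c2 : (z * z ^ s) ^+ 2 = 1.
  rewrite expgS expg1 {2}(comI _ _ Iz Izs) mulgA -(mulgA z) (involution_mulK Izs).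
  by rewrite mulg1.
have ord1 : #[z * z ^ s] = 1%N.
  apply/eqP; rewrite -dvdn1; have /eqP <- : coprime #|S| 2 by rewrite coprimen2.
  by rewrite dvdn_gcd order_dvdG // order_dvdn c2 eqxx.
have : z * z ^ s = 1 by apply/eqP; rewrite -order_eq1 ord1.
move=> zs1; apply/cent1P; rewrite /commute.
have zsz : z ^ s = z by apply: (mulgI z); rewrite zs1 zzE.
by rewrite (conjgC z s) zsz.
Qed.

Lemma involution_of_even_order (H : {group gT}) :
  H \subset G -> ~~ odd #|H| -> exists2 z, z \in H & z \in I.
Proof.
move=> sHG; rewrite -dvdn2 => /(Cauchy (isT : prime 2))[z Hz oz].
by exists z => //; rewrite inE oz (subsetP sHG).
Qed.

Definition even_part : {set gT} := [set g in G | ~~ oddI g].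

Lemma even_part_group_set : group_set even_part.
Proof.
apply/group_setP; split=> [|g h]; first by rewrite inE group1 odd_on_involutions1.
rewrite !inE => /andP[Gg eg] /andP[Gh eh].
by rewrite groupM // odd_on_involutionsM // (negPf eg) (negPf eh).
Qed.
Canonical even_part_group := Group even_part_group_set.

Lemma even_part_normal : even_part <| G.
Proof.
apply/fingroup.normalP; split=> [|g Gg]; first by apply/subsetP => g; rewrite inE => /andP[].
apply/setP => h; rewrite mem_conjg !inE groupJr ?groupV //.
have [Gh /=|//] := boolP (h \in G).
rewrite conjgE invgK !odd_on_involutionsM ?groupM ?groupV //.
by rewrite odd_on_involutionsV //; case: (oddI g); case: (oddI h).
Qed.

Section Commuting.
Hypothesis comI : {in I &, commutative mulg}.

(* Frattini: G is generated by the even elements and the normalizer of a Sylow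
   3-subgroup, which has odd order. *)
Lemma commuting_even g : g \in G -> oddI g = false.
Proof.
move=> Gg; have [S sylS] := Sylow_exists 3 G.
have sSG := pHall_sub sylS.
have oddS : odd #|S| by rewrite (card_Hall sylS) odd_2'nat (pi_pnat (part_pnat _ _)).
have oddN : odd #|'N_G(S)|.
  apply/negPn/negP => /(involution_of_even_order (subsetIl _ _))[z /setIP[Gz nSz] Iz].
  have := Sylow3_moves_involutions (subxx G) transI sylS Iz.
  by rewrite (normalizing_involution_centralizes (subxx G) sSG).
have evenS : S \subset even_part.
  apply/subsetP => s Ss; rewrite inE (subsetP sSG) // even_of_odd_order ?(subsetP sSG) //.
  by rewrite (dvdn_odd (order_dvdG Ss)).
have sylM := pHall_subl evenS (normal_sub even_part_normal) sylS.
move: Gg; rewrite -(Frattini_arg even_part_normal sylM) => /mulsgP[m n].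
rewrite inE => /andP[Gm em] Nn ->; have Gn : n \in G by case/setIP: Nn.
rewrite odd_on_involutionsM // (negPf em) even_of_odd_order //.
by rewrite (dvdn_odd (order_dvdG Nn)).
Qed.

(** A Sylow 2-subgroup [P] fixes one of the three involutions and consists of even elements, so it
    centralizes them all. By Frattini in ['C_G(I)], the group ['N_G(P)] is still transitive on the
    involutions, so no involution is centralized by a Sylow 3-subgroup [S] of it. Thus ['C_P(S)] is
    trivial, [#|P|] is 1 modulo 3, and [#|P|] is a power of 4. *)
Lemma commuting_card : exists a m, [/\ 0 < a, odd m & #|G| = 3 * (4 ^ a * m)]%N.
Proof.
have [P sylP] := Sylow_exists 2 G; have sPG := pHall_sub sylP.
have [z0 Iz0 fix0] : exists2 z0, z0 \in I & {in P, forall g, z0 ^ g = z0}.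
  have := pgroup_fix_mod (pHall_pgroup sylP) (subset_trans sPG acts_involutions).
  rewrite cardI => fixP.
  have /card_gt0P[z0] : 0 < #|'Fix_(I | 'J)(P)| by case: #|_| fixP.
  by case/setIP => Iz0 /afixP fixz0; exists z0.
have PcentI : P \subset 'C_G(I).
  apply/subsetP => g Pg; have Gg := subsetP sPG g Pg.
  rewrite inE Gg; apply/centP => z Iz; rewrite /commute (conjgC z g).
  congr (_ * _); apply/esym.
  by apply: (even_fixes_involutions Gg _ Iz0 (fix0 g Pg) Iz); rewrite commuting_even.
have nCG : 'C_G(I) <| G.
  have := subcent_normal G I; suff -> : 'N_G(I) = G by [].
  apply/setIidPl; rewrite -astabsJ; exact: acts_involutions.
have sylC := pHall_subl PcentI (normal_sub nCG) sylP.
have trN : [transitive 'N_G(P), on I | 'J].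
  apply/imsetP; exists z0 => //; apply/eqP; rewrite eqEsubset; apply/andP; split.
    apply/subsetP => z; rewrite -{1}(atransP transI _ Iz0) => /imsetP[g Gg ->].
    move: Gg; rewrite -{1}(Frattini_arg nCG sylC) => /mulsgP[c n /setIP[_ /centP cI] Nn ->].
    apply/imsetP; exists n => //=; rewrite conjgM; congr (_ ^ _).
    by rewrite conjgE -(cI _ Iz0) mulKg.
  apply/subsetP => z /imsetP[n /setIP[Gn _] ->] /=; exact: involutionsJ.
have [S sylS] := Sylow_exists 3 'N_G(P).
have fixS : 'C_P(S) = 1.
  apply/eqP/negPn/negP => nt.
  have sCG : 'C_P(S) \subset G by rewrite subIset ?sPG.
  have pC : 2.-group 'C_P(S) by apply: pgroupS (pHall_pgroup sylP); apply: subsetIl.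
  have evenC : ~~ odd #|'C_P(S)|.
    by case: (pgroup_pdiv pC nt) => _ d2 _; rewrite -dvdn2.
  have [z /setIP[_ cSz] Iz] := involution_of_even_order sCG evenC.
  have /negP := Sylow3_moves_involutions (subsetIl _ _) trN sylS Iz; apply.
  by rewrite sub_cent1.
have mod3 : #|P| = 1 %[mod 3].
  have actP : [acts S, on P | 'J].
    by rewrite astabsJ (subset_trans (pHall_sub sylS)) ?subsetIr.
  by rewrite (pgroup_fix_mod (pHall_pgroup sylS) actP) afixJ fixS cards1.
have cardP := card_Hall sylP; rewrite p_part in cardP.
have [z Iz] : exists z, z \in I by exists z0.
have e2 : 0 < logn 2 #|G|.
  rewrite logn_gt0 mem_primes cardG_gt0 /=; move: Iz; rewrite inE => /andP[Gz /eqP<-].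
  exact: order_dvdG.
set k := logn 2 #|G| in cardP e2.
have even_k : odd k = false.
  move: mod3; rewrite cardP -{1}(odd_double_half k) expnD -mul2n expnM.
  by rewrite -modnMmr -modnXm exp1n; case: (odd k).
exists k./2, ((#|G|`_2^')%N %/ 3); set r := (#|G|`_2^')%N.
have cardG2 : #|G| = (4 ^ k./2 * r)%N.
  rewrite -(partnC 2 (cardG_gt0 G)) p_part -/k -{1}(odd_double_half k) even_k.
  by rewrite add0n -mul2n expnM.
have oddr : odd r by rewrite odd_2'nat part_pnat.
have dvd3 : 3 %| r.
  have := dvd3_card; rewrite cardG2 Gauss_dvdr //.
  by rewrite coprimeXr.
have oddm : odd (r %/ 3) by apply: dvdn_odd oddr; apply: dvdn_div.
split=> //; last by rewrite cardG2 mulnCA -{1}(divnK dvd3) (mulnC _ 3).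
by rewrite half_gt0 ltn_neqAle e2 andbT; apply: contraFneq even_k => <-.
Qed.

End Commuting.

(** An even involution fixes itself under conjugation, hence centralizes all three; by transitivity
    each of them would then do so. *)
Lemma noncommuting_odd : ~ {in I &, commutative mulg} -> {in I, forall z, oddI z}.
Proof.
move=> nc z Iz; apply/negPn/negP => ez; apply: nc.
have Gz : z \in G by move: Iz; rewrite inE => /andP[].
have cz y : y \in I -> y ^ z = y.
  by move: y; apply: (even_fixes_involutions Gz ez Iz); rewrite conjgE mulKg.
move=> x y Ix Iy.
have [g Gg ->] : exists2 g, g \in G & x = z ^ g.
  by move: Ix; rewrite -(atransP transI _ Iz) => /imsetP.
have <- : (y ^ g^-1) ^ g = y by rewrite conjgKV.
rewrite -!conjMg; congr (_ ^ _).
have /cz : y ^ g^-1 \in I by apply: involutionsJ; rewrite ?groupV.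
by rewrite (conjgC (y ^ g^-1) z) => ->.
Qed.

End Involutions.

(** * Three-pyramidal systems and regular groups *)

Lemma fixpoint_free_involution_even (T : finType) (A : {set T}) (f : T -> T) :
  {in A, forall x, [/\ f x \in A, f (f x) = x & f x != x]} -> ~~ odd #|A|.
Proof.
have [n] := ubnP #|A|; elim: n => // n IHn in A *; rewrite ltnS => leAn fA.
have [->|[x Ax]] := set_0Vmem A; first by rewrite cards0.
have [Afx ffx neq] := fA x Ax; pose A' := A :\ x :\ f x.
have cA : #|A| = #|A'|.+2.
  by rewrite (cardsD1 x) Ax (cardsD1 (f x)) in_setD1 neq Afx.
rewrite cA /= negbK; apply: IHn => [|y].
  by move: leAn; rewrite cA => /ltnW.
rewrite /A' !in_setD1 => /and3P[yfx yx Ay]; have [Afy ffy nfy] := fA y Ay.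
split=> //; rewrite Afy andbT; apply/andP; split.
  by apply: contraNneq yx => e; rewrite -ffy e ffx.
by apply: contraNneq yfx => e; rewrite -ffy e.
Qed.

Section Necessity.
Variables (T : finType) (B : {set {set T}}) (R : {set {set {set T}}}).
Variable G : {group {perm T}}.
Hypothesis KTS_BR : is_KTS B R.
Hypothesis autG : forall s, s \in G -> is_KTS_aut B R s.
Local Open Scope group_scope.
Notation F := 'Fix_('P)(G).
Hypothesis cardF : #|F| = 3.
Hypothesis shtrans : sharply_transitive G (~: F).

Let block3 b : b \in B -> #|b| = 3. Proof. by case: KTS_BR => [[h _] _ _]; apply: h. Qed.

Let block_ex x y : x != y -> exists2 b, b \in B & (x \in b) && (y \in b).
Proof.
case: KTS_BR => [[_ h] _ _] /h[b [[Bb xb yb] _]].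
by exists b => //; rewrite xb.
Qed.

Let block_uniq x y b c : x != y -> b \in B -> c \in B ->
  x \in b -> y \in b -> x \in c -> y \in c -> b = c.
Proof.
case: KTS_BR => [[_ h] _ _] /h[d [_ dP]] Bb Bc xb yb xc yc.
by rewrite -(dP b) ?(dP c).
Qed.

Definition third x y : T :=
  odflt x [pick z | (z != x) && (z != y) && ([set x; y; z] \in B)].

Lemma third_eq x y z b : b \in B -> x \in b -> y \in b -> z \in b ->
  x != y -> z != x -> z != y -> third x y = z.
Proof.
move=> Bb xb yb zb xy zx zy.
have blockE c t : c \in B -> x \in c -> y \in c -> t \in c -> t != x -> t != y ->
    c = [set x; y; t].
  move=> Bc xc yc tc tx ty; apply/esym/eqP; rewrite eqEcard; apply/andP; split.
    by apply/subsetP => s; rewrite !inE => /orP[/orP[]|] /eqP->.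
  by rewrite (block3 Bc) setUC cardsU1 cards2 xy !inE negb_or tx ty.
have bE := blockE b z Bb xb yb zb zx zy; rewrite /third.
case: pickP => [t /andP[/andP[tx ty] Bt] /= | /(_ z)]; last by rewrite zx zy -bE Bb.
have : t \in b.
  by rewrite (block_uniq xy Bb Bt) // !inE eqxx ?orbT.
by rewrite bE !inE (negPf tx) (negPf ty) /= => /eqP.
Qed.

Lemma thirdP x y : x != y ->
  exists2 b, b \in B & [/\ x \in b, y \in b, third x y \in b, third x y != x & third x y != y].
Proof.
move=> xy; have [b Bb /andP[xb yb]] := block_ex xy; exists b => //.
have [z] : exists z, z \in b :\ x :\ y.
  apply/card_gt0P; have := block3 Bb; rewrite (cardsD1 x) xb (cardsD1 y) in_setD1.
  by rewrite eq_sym xy yb => -[]; rewrite add0n => ->.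
rewrite !in_setD1 => /and3P[zy zx zb].
by rewrite (third_eq Bb xb yb zb xy zx zy).
Qed.

Lemma thirdC x y : x != y -> third x y = third y x.
Proof.
move=> xy; have [b Bb [xb yb tb tx ty]] := thirdP xy.
by apply/esym/(third_eq Bb) => //; rewrite eq_sym.
Qed.

Lemma thirdK x y : x != y -> third x (third x y) = y.
Proof.
move=> xy; have [b Bb [xb yb tb tx ty]] := thirdP xy.
by apply: (third_eq Bb) => //; rewrite eq_sym.
Qed.

Lemma third_aut s x y : s \in G -> x != y -> s (third x y) = third (s x) (s y).
Proof.
move=> Gs xy; have [b Bb [xb yb tb tx ty]] := thirdP xy.
have Bsb : s @: b \in B by case: (autG Gs) => h _; apply: h.
by apply/esym/(third_eq Bsb); rewrite ?imset_f ?(inj_eq perm_inj).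
Qed.

Lemma fixedP x : reflect (forall s, s \in G -> s x = x) (x \in F).
Proof. by apply: (iffP afixP). Qed.

Lemma semiregular s x : s \in G -> x \notin F -> s x = x -> s = 1.
Proof.
case: shtrans => _ h Gs Fx sx; have stab : 'C_G[x | 'P] = 1 by apply: h; rewrite in_setC.
have : s \in 'C_G[x | 'P] by rewrite in_setI Gs; apply/astab1P.
by rewrite stab inE => /eqP.
Qed.

Lemma notin_fixed s x : s \in G -> (s x \notin F) = (x \notin F).
Proof.
move=> Gs; congr (~~ _); apply/fixedP/fixedP => fx t Gt.
  apply: (@perm_inj _ s); rewrite -permM.
  by rewrite -(fx (s^-1 * (t * s))) ?groupM ?groupV // -permM mulKVg.
by rewrite (fx s Gs) fx.
Qed.

Lemma base_point : exists x, x \notin F.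
Proof.
by case: shtrans => /imsetP[x]; rewrite inE => Fx _ _; exists x.
Qed.

(** If the third point were fixed, [x] would be the third point of a block through two fixed points,
    hence fixed itself. *)
Lemma third_fixed u x : u \in F -> x \notin F -> u != x /\ third u x \notin F.
Proof.
move=> Fu Fx; have ux : u != x by apply: contraNneq Fx => <-.
split=> //; apply: contra Fx => Ft; apply/fixedP => s Gs.
have [b Bb [_ _ _ tu tx]] := thirdP ux.
rewrite -[x in s x](thirdK ux) third_aut 1?eq_sym //.
by rewrite (fixedP _ Fu) ?(fixedP _ Ft) ?thirdK.
Qed.

Variable x0 : T.
Hypothesis Fx0 : x0 \notin F.

(** Regularity identifies the points off [F] with the elements of [G] once [x0] is chosen. The
    default 1 is met only at fixed points. *)
Definition trans_elt y : {perm T} := odflt 1 [pick s in G | s x0 == y].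
Notation tau := trans_elt.

Lemma trans_eltP y : y \notin F -> tau y \in G /\ tau y x0 = y.
Proof.
move=> Fy; rewrite /tau; case: pickP => [s /andP[Gs /eqP]//|h].
case: shtrans => tr _; have : y \in orbit 'P G x0.
  by rewrite (atransP tr)  in_setC.
by case/imsetP => s Gs yE; have := h s; rewrite /= Gs [y]yE eqxx.
Qed.

Lemma trans_elt_eq s y : s \in G -> s x0 = y -> tau y = s.
Proof.
move=> Gs <-; have [|Gt tE] := @trans_eltP (s x0); first by rewrite notin_fixed.
apply: (mulIg s^-1); rewrite mulgV; apply: (semiregular _ Fx0).
  by rewrite groupM ?groupV.
by rewrite permM tE permK.
Qed.

Lemma eq_at_base s t : s \in G -> t \in G -> s x0 = t x0 -> s = t.
Proof. by move=> Gs Gt st; rewrite -(trans_elt_eq Gs erefl) st (trans_elt_eq Gt erefl). Qed.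

Notation I := (involutions G).

Definition fixed_involution u := tau (third u x0).
Notation J := fixed_involution.

Lemma fixed_involutionP u : u \in F -> J u \in I /\ J u x0 = third u x0.
Proof.
move=> Fu; have [ux Ft] := third_fixed Fu Fx0.
have [Gj jE] := trans_eltP Ft; rewrite -/(J u) in Gj jE; split=> //.
have [b Bb [_ _ _ tu tx]] := thirdP ux.
have j1 : J u != 1 by apply: contraNneq tx => e; rewrite -jE e perm1.
(* [J u] sends the block of [u] and [x0] to the block of [u] and [J u x0], which is the same block;
   so [J u] sends [J u x0] back to [x0]. *)
have j2 : J u ^+ 2 = 1.
  rewrite expgS expg1; apply: eq_at_base; rewrite ?groupM ?group1 //.
  by rewrite permM perm1 {1}jE third_aut // jE (fixedP _ Fu) // thirdK.
rewrite inE Gj; apply/eqP; apply: nt_prime_order => //.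
Qed.

Lemma fixed_involution_inj : {in F &, injective J}.
Proof.
move=> u v Fu Fv uv.
have [_ uE] := fixed_involutionP Fu; have [_ vE] := fixed_involutionP Fv.
have [ux _] := third_fixed Fu Fx0; have [vx _] := third_fixed Fv Fx0.
have e : third x0 u = third x0 v by rewrite -(thirdC ux) -(thirdC vx) -uE -vE uv.
by rewrite -(thirdK (y := u) (x := x0)) 1?eq_sym // e thirdK // eq_sym.
Qed.

Lemma involution_moves j x : j \in I -> x \notin F -> j x != x.
Proof.
rewrite inE => /andP[Gj /eqP oj] Fx; apply/eqP => /(semiregular Gj Fx) e.
by move: oj; rewrite e order1.
Qed.

Lemma involutionK j x : j \in I -> j (j x) = x.
Proof. by move=> Ij; rewrite -permM (involution_mulK Ij) perm1. Qed.

(** An involution [j] swaps [x0] and [j x0], so it preserves their block and fixes its third point.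
    By semiregularity this point lies in [F]. *)
Lemma involutions_fixed : I = J @: F.
Proof.
apply/setP => j; apply/idP/imsetP => [Ij | [u Fu ->]]; last by case: (fixed_involutionP Fu).
have Gj : j \in G by move: Ij; rewrite inE => /andP[].
have xj : x0 != j x0 by rewrite eq_sym involution_moves.
have [b Bb [_ _ _ tx tj]] := thirdP xj.
exists (third x0 (j x0)).
  apply/negPn/negP => /(involution_moves Ij)/negP[].
  by rewrite third_aut // involutionK // thirdC // eq_sym.
apply/esym/trans_elt_eq => //.
by rewrite -(thirdC (x := x0)) ?thirdK // eq_sym.
Qed.

Lemma card_involutions : #|I| = 3.
Proof. by rewrite involutions_fixed card_in_imset //; apply: fixed_involution_inj. Qed.

Lemma involutions_conjugate u v : u \in F -> v \in F -> u != v ->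
  exists2 g, g \in G & J u = J v ^ g.
Proof.
move=> Fu Fv uv; have [Ij jE] := fixed_involutionP Fu; set j := J u in Ij jE *.
have Gj : j \in G by move: Ij; rewrite inE => /andP[].
have [ux Ft] := third_fixed Fu Fx0; have [b Bb [ub xb tb tu tx]] := thirdP ux.
have [_ partR partP] := KTS_BR.
have jb : j @: b = b.
  apply: (block_uniq ux) => //.
  - by case: (autG Gj) => h _; apply: h.
  - by rewrite -(fixedP _ Fu j) // imset_f.
  by rewrite -(involutionK x0 Ij) jE imset_f.
have [P RP Pb] : exists2 P, P \in R & b \in P.
  by apply/bigcupP; rewrite -/(cover R) (cover_partition partR).
(* Distinct parallel classes share no block, and [b] lies both in [P] and in its image. *)
have jP : [set j @: (c : {set T}) | c in P] = P.
  have RjP : [set j @: (c : {set T}) | c in P] \in R by case: (autG Gj) => _; apply.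
  have jPb : b \in [set j @: (c : {set T}) | c in P] by rewrite -{1}jb imset_f.
  have tR := partition_trivIset partR.
  by rewrite -(def_pblock tR RjP jPb) -(def_pblock tR RP Pb).
have [tP covP] := (partition_trivIset (partP P RP), cover_partition (partP P RP)).
have [c Pc vc] : exists2 c, c \in P & v \in c.
  by apply/bigcupP; rewrite -/(cover P) covP inE.
have jc : j @: c = c.
  have jPc : j @: c \in P by rewrite -jP imset_f.
  have vjc : v \in j @: c by rewrite -(fixedP _ Fv j) // imset_f.
  by rewrite -(def_pblock tP jPc vjc) -(def_pblock tP Pc vc).
have Bc : c \in B by rewrite -(cover_partition partR); apply/bigcupP; exists P.
(* A block inside [F] would be all of [F], so it would contain [u] and coincide with [b]; but [b]
   contains [x0]. *)
have [y yc Fy] : exists2 y, y \in c & y \notin F.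
  apply/subsetPn; apply/negP => sub; have /eqP cF : c == F by rewrite eqEcard sub cardF block3.
  have uc : u \in c by rewrite cF.
  by case/negP: Fx0; rewrite -cF -(def_pblock tP Pc uc) (def_pblock tP Pb ub).
have vy : v != y by apply: contraNneq Fy => <-.
have tjy : third v y = j y.
  apply: (third_eq Bc) => //; first by rewrite -jc imset_f.
    by rewrite -(fixedP _ Fv j) // (inj_eq perm_inj) eq_sym.
  exact: involution_moves.
have [Ij' j'E] := fixed_involutionP Fv; set j' := J v in Ij' j'E *.
have Gj' : j' \in G by move: Ij'; rewrite inE => /andP[].
have [Gg gE] := trans_eltP Fy; exists (tau y) => //.
have [vx _] := third_fixed Fv Fx0.
(* Permutation products apply the left factor first. With [tau y] moved across, both sides send [x0]
   to [j y], the third point of the block through [v] and [y]. *)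
apply: (mulgI (tau y)); rewrite conjgE mulKVg; apply: eq_at_base; rewrite ?groupM //.
by rewrite !permM gE j'E third_aut // (fixedP _ Fv) // gE tjy.
Qed.

Lemma involutions_trans : [transitive G, on I | 'J].
Proof.
have [u Fu] : exists u, u \in F by apply/card_gt0P; rewrite cardF.
have IJ : J u \in I by case: (fixed_involutionP Fu).
apply/imsetP; exists (J u) => //; apply/setP => j; apply/idP/imsetP => [|[g Gg ->]].
  rewrite {1}involutions_fixed => /imsetP[v Fv ->].
  have [->|uv] := eqVneq v u; first by exists 1; rewrite ?group1 //= conjg1.
  by have [g Gg ->] := involutions_conjugate Fv Fu uv; exists g.
exact: involutionsJ.
Qed.

Lemma card_regular : #|G| = #|~: F|.
Proof.
case: shtrans => tr st; have Ox : x0 \in ~: F by rewrite inE.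
by rewrite -(card_orbit_stab 'P G x0) (atransP tr _ Ox) st // cards1 muln1.
Qed.

(** * Counting the elements that act oddly on the involutions *)

Notation oddI := (odd_on_involutions G).

Definition swap_third g : {perm T} := tau (third x0 (g x0)).
Notation kappa := swap_third.

Lemma swap_thirdP g : g \in G -> g != 1 -> g \notin I ->
  [/\ kappa g \in G, kappa g x0 = third x0 (g x0), kappa g != 1, kappa g \notin I & kappa g != g].
Proof.
move=> Gg g1 nIg.
have gx : x0 != g x0.
  by apply: contraNneq g1 => e; apply/eqP; apply: (semiregular Gg Fx0).
have [b Bb [xb gb tb tx tg]] := thirdP gx.
have Fgx : g x0 \notin F by rewrite notin_fixed.
have Ft : third x0 (g x0) \notin F.
  apply: contra nIg => Ft; rewrite involutions_fixed; apply/imsetP.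
  exists (third x0 (g x0)) => //; apply/esym/trans_elt_eq => //.
  by rewrite thirdC // thirdK.
have [Gk kE] := trans_eltP Ft; rewrite -/(kappa g) in Gk kE; split=> //.
- by apply: contraNneq tx => e; rewrite -kE e perm1.
- apply: contra Fgx; rewrite involutions_fixed => /imsetP[u Fu ku].
  have [ux _] := third_fixed Fu Fx0; have [_ uE] := fixed_involutionP Fu.
  suff -> : g x0 = u by [].
  by rewrite -(thirdK gx) -kE ku uE -(thirdC (x := x0)) ?thirdK // eq_sym.
by apply: contraNneq tg => e; rewrite -kE e.
Qed.

Lemma swap_thirdK g : g \in G -> g != 1 -> g \notin I -> kappa (kappa g) = g.
Proof.
move=> Gg g1 nIg; have [Gk kE k1 _ _] := swap_thirdP Gg g1 nIg.
have gx : x0 != g x0.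
  by apply: contraNneq g1 => e; apply/eqP; apply: (semiregular Gg Fx0).
by apply: trans_elt_eq => //; rewrite kE thirdK.
Qed.

(** Translation by [g^-1] carries the block of [x0], [g x0], [kappa g x0] to the block of [g^-1 x0],
    [x0] and the image of [kappa g x0]. So for odd [g] exactly one of [kappa g] and [kappa g^-1] is
    odd. *)
Lemma swap_thirdV g : g \in G -> g != 1 -> g \notin I -> kappa g^-1 = kappa g * g^-1.
Proof.
move=> Gg g1 nIg; have [Gk kE k1 _ _] := swap_thirdP Gg g1 nIg.
have gx : x0 != g x0.
  by apply: contraNneq g1 => e; apply/eqP; apply: (semiregular Gg Fx0).
apply: trans_elt_eq; first by rewrite groupM ?groupV.
rewrite permM kE third_aut ?groupV // permK thirdC //.
by rewrite -(inj_eq (@perm_inj _ g)) permKV.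
Qed.

Lemma noncommuting_order : ~ {in I &, commutative mulg} -> exists n, (#|G| + 3 = 24 * n + 9)%N.
Proof.
move=> nc; have oddz := noncommuting_odd card_involutions involutions_trans nc.
have [z Iz] : exists z, z \in I by apply/card_gt0P; rewrite card_involutions.
have Gz : z \in G by move: Iz; rewrite inE => /andP[].
pose O := [set g in G | oddI g].
have OP g : (g \in O) = (g \in G) && oddI g by rewrite inE.
have cardO : #|G| = (#|O| * 2)%N.
  have -> : #|G| = (#|O| + #|[set (z * g)%g | g in O]|)%N.
    rewrite -(cardsID O G); congr addn; apply: eq_card => g.
      by rewrite in_setI OP andbA andbb.
    rewrite in_setD OP; apply/andP/imsetP => [[ng Gg] | [h]].
      exists (z * g); last by rewrite mulgA (involution_mulK Iz) mul1g.
      by rewrite OP groupM // odd_on_involutionsM // oddz //; rewrite Gg in ng.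
    rewrite OP => /andP[Gh oh] ->.
    by rewrite groupM // odd_on_involutionsM // oddz // oh.
  by rewrite card_imset ?addnn ?muln2 //; apply: mulgI.
pose D := O :\: I; pose D' := [set g in D | oddI (kappa g)].
have DP g : g \in D -> [/\ g \in G, oddI g, g \notin I & g != 1].
  rewrite in_setD OP => /and3P[nIg Gg og]; split=> //.
  by apply: contraTneq og => ->; rewrite odd_on_involutions1.
have D'P g : (g \in D') = (g \in D) && oddI (kappa g) by rewrite inE.
have cardOI : #|O| = (3 + #|D|)%N.
  rewrite -(cardsID I O); congr addn; rewrite -card_involutions.
  apply: eq_card => g; rewrite in_setI OP andbC; case Ig: (g \in I) => //=.
  by rewrite oddz // andbT; move: Ig; rewrite inE => /andP[].
have DV g : g \in D -> g^-1 \in D.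
  move=> Dg; have [Gg og nIg g1] := DP g Dg.
  rewrite in_setD OP groupV Gg odd_on_involutionsV // og !andbT.
  by apply: contra nIg; rewrite !inE groupV orderV.
have kV g : g \in D -> oddI (kappa g^-1) = ~~ oddI (kappa g).
  move=> Dg; have [Gg og nIg g1] := DP g Dg; have [Gk _ _ _ _] := swap_thirdP Gg g1 nIg.
  by rewrite swap_thirdV // odd_on_involutionsM ?groupV // odd_on_involutionsV // og addbT.
have cardD : #|D| = (#|D'| * 2)%N.
  have -> : #|D| = (#|D'| + #|[set g^-1%g | g in D']|)%N.
    rewrite -(cardsID D' D); congr addn; apply: eq_card => g.
      by rewrite in_setI D'P andbA andbb.
    rewrite in_setD D'P; apply/andP/imsetP => [[ng Dg] | [h]].
      exists g^-1; last by rewrite invgK.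
      by rewrite D'P DV // kV //; rewrite Dg in ng.
    by rewrite D'P => /andP[Dh oh] ->; rewrite DV // kV // oh.
  by rewrite card_imset ?addnn ?muln2 //; apply: invg_inj.
have evenD' : ~~ odd #|D'|.
  apply: (@fixpoint_free_involution_even _ D' kappa) => g; rewrite D'P => /andP[Dg ok].
  have [Gg og nIg g1] := DP g Dg; have [Gk _ k1 nIk kg] := swap_thirdP Gg g1 nIg.
  split=> //; last exact: swap_thirdK.
  by rewrite D'P in_setD OP Gk ok nIk swap_thirdK.
have d3 := dvd3_card card_involutions involutions_trans.
(* With [#|D'|] equal to 2k the equations give [#|G|] = 6 + 8k, and divisibility by 3 forces 3 to
   divide k. *)
exists (#|G| %/ 24)%N; lia.
Qed.

Lemma regular_order :
  (exists a m, [/\ 0 < a, odd m & #|G| = 3 * (4 ^ a * m)]%N) \/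
  exists n, (#|G| + 3 = 24 * n + 9)%N.
Proof.
have [com|nc] := boolP [forall x in I, forall y in I, x * y == y * x].
  left; apply: (commuting_card card_involutions involutions_trans) => x y Ix Iy.
  by apply/eqP; move/forall_inP: com => /(_ x Ix)/forall_inP/(_ y Iy).
right; apply: noncommuting_order => com; case/negP: nc.
by apply/forall_inP => x Ix; apply/forall_inP => y Iy; rewrite com.
Qed.

End Necessity.

Lemma necessary_orders (v : nat) : exists_3pyramidal_KTS v ->
  [\/ exists n : nat, v = 24 * n + 9,
      exists n : nat, v = 24 * n + 15
    | exists n e m : nat,
        [/\ 0 < n, n = 4 ^ e * m, odd m & v = 48 * n + 3]].
Proof.
case=> T [B [R [cardT KTS [G [autG cardF shtr]]]]].
have [x0 Fx0] := base_point shtr.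
have cardG : #|G| + 3 = v.
  by rewrite (card_regular shtr Fx0) -cardF -cardT addnC cardsC.
case: (regular_order KTS autG cardF shtr Fx0) => [[a [m [a0 om cG]]]|[n vE]]; last first.
  by apply: Or31; exists n; rewrite -cardG.
(* Exponent 1 gives [#|G|] = 12m with m odd, that is v = 24n + 15; exponent e + 2 gives 48 times
   [4 ^ e * m]. *)
case: a a0 cG => // -[|e] _ cG.
  by apply: Or32; exists m./2; have := odd_double_half m; rewrite om -cardG cG; lia.
apply: Or33; exists (4 ^ e * m), e, m; split=> //.
  by rewrite muln_gt0 expn_gt0 /=; case: m om {cG}.
by rewrite -cardG cG !expnS; lia.
Qed.

Local Open Scope group_scope.

(** * Difference families *)

Lemma partition_of_points (T : finType) (P : {set {set T}}) (D : {set T}) :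
    (forall x, x \in D -> exists2 A, A \in P & x \in A) ->
    (forall A, A \in P -> A \subset D /\ exists x, x \in A) ->
    (forall A B x, A \in P -> B \in P -> x \in A -> x \in B -> A = B) ->
  partition P D.
Proof.
move=> covD inP uniqP; apply/and3P; split.
- rewrite eqEsubset; apply/andP; split.
    by apply/bigcupsP => A /inP[].
  by apply/subsetP => x /covD[A AP xA]; apply/bigcupP; exists A.
- apply/trivIsetP => A B AP BP neqAB; rewrite -setI_eq0.
  apply: contraNT neqAB => /set0Pn[x /setIP[xA xB]].
  by apply/eqP; exact: uniqP AP BP xA xB.
- by apply/negP => /inP[_ [x]]; rewrite inE.
Qed.

(** A map that covers a set at least as large as its source is a bijection onto it. This turns every
    covering with the right count into an exact one. *)
Lemma imset_saturated (I U : finType) (f : I -> U) (D : {set I}) (S : {set U}) :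
  #|D| <= #|S| -> (forall x, x \in S -> exists2 i, i \in D & f i = x) ->
  {in D &, injective f} /\ f @: D = S.
Proof.
move=> leDS surj.
have subS : S \subset f @: D.
  by apply/subsetP => x /surj[i iD <-]; apply: imset_f.
have leS := subset_leq_card subS; have leD := leq_imset_card f D.
have eD : #|f @: D| = #|D|.
  by apply/eqP; rewrite eqn_leq leD (leq_trans leDS leS).
split; first by apply/imset_injP; rewrite eD.
by apply/esym/eqP; rewrite eqEcard subS (leq_trans leD).
Qed.

(** * The Kirkman system developed from base triples *)

Section Develop.
Variables (G : finGroupType) (I : finType) (j h : G) (y : 'I_3 -> G).
Variable p : I -> 'I_3 -> G.
Hypotheses (j_neq1 : j != 1) (j2 : j * j = 1) (h_neq1 : h != 1)
  (h3 : h * h * h = 1).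
Let jj i := y i * j * (y i)^-1.
Hypothesis jj_inj : injective jj.
Hypothesis card_I : (#|I| * 6 + 6 = #|G|)%N.
Hypothesis diff_cov : forall d, d \notin [:: 1; h; h * h] ->
  (forall i, d != jj i) -> exists i l k, l != k /\ p i l * (p i k)^-1 = d.
Hypothesis pt_cov : forall x, (forall i (b : bool), x != y i * j ^+ b) ->
  exists i l (b : bool), p i l * j ^+ b = x.

Let HJ : {set G} := [set x in [:: 1; h; h * h] ++ codom jj].
Let YJ : {set G} := [set y x.1 * j ^+ x.2 | x : 'I_3 * bool].
Let delta (x : I * ('I_3 * 'I_3)) := p x.1 x.2.1 * (p x.1 x.2.2)^-1.
Let pt (x : I * ('I_3 * bool)) := p x.1 x.2.1 * j ^+ x.2.2.
Let offdiag : {set I * ('I_3 * 'I_3)} := [set x | x.2.1 != x.2.2].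

Let card_offdiag : #|offdiag| = (#|I| * 6)%N.
Proof.
have -> : offdiag = setX [set: I] [set x : 'I_3 * 'I_3 | x.1 != x.2].
  by apply/setP => -[i [l k]]; rewrite !inE.
rewrite cardsX cardsT; congr (_ * _)%N.
have <- : (\sum_(i < 3) \sum_(k < 3 | i != k) 1 = 6)%N.
  by under eq_bigr do rewrite big_mkcond; rewrite !(big_ord_recl, big_ord0).
rewrite (pair_big_dep xpredT (fun i k : 'I_3 => i != k) (fun _ _ => 1%N)) /=.
by rewrite sum1_card; apply: eq_card => x; rewrite !inE.
Qed.

(** [HJ] has at most six elements, so its complement is at least as large as the set of ordered
    pairs taken from base triples, and the covering is saturated. The same count with [YJ] gives
    [pt_sat]. *)
Let delta_sat : {in offdiag &, injective delta} /\ delta @: offdiag = ~: HJ.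
Proof.
have le6 : #|HJ| <= 6.
  by rewrite cardsE (leq_trans (card_size _)) // size_cat size_map -cardE card_ord.
apply: imset_saturated.
  rewrite card_offdiag cardsCs setCK -card_I leq_subRL ?[(#|HJ| + _)%N]addnC ?leq_add2l //.
  by apply: leq_trans le6 _; apply: leq_addl.
move=> d; rewrite !inE !negb_or => /and4P[d1 dh dhh dJ].
have [|i|i [l [k [neq <-]]]] := diff_cov (d := d).
- by rewrite !inE !negb_or d1 dh.
- by apply: contraNneq dJ => ->; apply: codom_f.
by exists (i, (l, k)); rewrite ?inE.
Qed.

Let pt_sat : injective pt /\ pt @: setT = ~: YJ.
Proof.
have [] := @imset_saturated _ _ pt setT (~: YJ).
- have le6 : #|YJ| <= 6.
    by apply: leq_trans (leq_imset_card _ _) _; rewrite card_prod card_ord card_bool.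
  rewrite cardsT !card_prod card_ord card_bool cardsCs setCK -card_I leq_subRL ?[(#|YJ| + _)%N]addnC ?leq_add2l //.
  by apply: leq_trans le6 _; apply: leq_addl.
- move=> x; rewrite inE => xY.
  have [|i [l [b <-]]] := pt_cov (x := x); last by exists (i, (l, b)).
  by move=> i b; apply: contraNneq xY => ->; apply/imsetP; exists (i, b).
by move=> inj ->; split=> // u v; apply: inj; rewrite inE.
Qed.

Let jj2 i : jj i * jj i = 1.
Proof. by rewrite /jj -!mulgA mulKg (mulgA j) j2 mul1g mulgV. Qed.

Let jj_neq1 i : jj i != 1.
Proof.
apply: contraNneq j_neq1 => e.
by rewrite -(conjg_eq1 _ (y i)^-1) conjgE invgK mulgA; apply/eqP.
Qed.

Let jV : j^-1 = j. Proof. by rewrite -[RHS]mul1g -(mulVg j) -mulgA j2 mulg1. Qed.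

Let hh_neq1 : h * h != 1.
Proof. by apply: contraNneq h_neq1 => e; rewrite -h3 e mul1g. Qed.

Let jj_notH i : jj i \notin [:: 1; h; h * h].
Proof.
rewrite !inE (negPf (jj_neq1 i)) /=; apply/norP; split; apply/eqP => e.
  by have := jj2 i; rewrite e => /eqP; rewrite (negPf hh_neq1).
have := jj2 i; rewrite e mulgA h3 mul1g => /eqP; rewrite (negPf h_neq1) //.
Qed.

Let deltaP i l k : l != k -> delta (i, (l, k)) \notin HJ.
Proof.
move=> neq; have [_ /setP/(_ (delta (i, (l, k))))] := delta_sat.
by rewrite in_setC => <-; apply: imset_f; rewrite inE.
Qed.

Let p_neq i l k : l != k -> p i l != p i k.
Proof.
move=> neq; apply: contraNneq (deltaP i neq) => e.
by rewrite /delta /= e mulgV inE mem_head.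
Qed.

Let ptP i l b : pt (i, (l, b)) \notin YJ.
Proof.
have [_ /setP/(_ (pt (i, (l, b))))] := pt_sat.
by rewrite in_setC => <-; apply: imset_f; rewrite inE.
Qed.

Local Notation T := (G + 'I_3)%type.
Implicit Types (g a c : G).
Let blk i g : {set T} := [set inl (p i l * g) | l : 'I_3].
Let infb i g : {set T} := [set inr i; inl (y i * g); inl (y i * j * g)].
Let hb g : {set T} := [set inl g; inl (h * g); inl (h * h * g)].
Let infty : {set T} := [set inr i | i : 'I_3].

Let blocks : {set {set T}} :=
  [set infty] :|: [set hb g | g : G] :|: [set infb x.1 x.2 | x : 'I_3 * G]
  :|: [set blk x.1 x.2 | x : I * G].

Let class0 : {set {set T}} := [set infty] :|: [set hb g | g : G].
(** The base triples cover only half of the points, and their translates by [j] the other half.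
    Since [infb i] is also unchanged by [j], the elements [g] and [j * g] give the same class.
    [class0] is invariant under all translations. *)
Let class g : {set {set T}} :=
  [set infb i g | i : 'I_3] :|: [set blk x.1 (j ^+ x.2 * g) | x : I * bool].
Let classes : {set {set {set T}}} := [set class0] :|: [set class g | g : G].

Let blocksP b : reflect
  [\/ b = infty, exists g, b = hb g, exists i g, b = infb i g
    | exists i g, b = blk i g] (b \in blocks).
Proof.
rewrite !inE -!orbA; apply: (iffP or4P).
  case=> [/eqP|/imsetP[g _]|/imsetP[[i g] _]|/imsetP[[i g] _]] e.
  - by constructor 1.
  - by constructor 2; exists g.
  - by constructor 3; exists i, g.
  - by constructor 4; exists i, g.
case=> [e|[g e]|[i [g e]]|[i [g e]]].
- by constructor 1; apply/eqP.
- by constructor 2; apply/imsetP; exists g.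
- by constructor 3; apply/imsetP; exists (i, g).
- by constructor 4; apply/imsetP; exists (i, g).
Qed.

Let inl_blk i g a : reflect (exists l, a = p i l * g) (inl a \in blk i g).
Proof.
apply: (iffP imsetP) => [[l _ [->]]|[l ->]]; first by exists l.
by exists l.
Qed.

Let inr_blk i g k : (inr k \in blk i g) = false.
Proof. by apply/imsetP => -[]. Qed.

Let inl_infb i g a : reflect (exists b : bool, a = y i * j ^+ b * g)
  (inl a \in infb i g).
Proof.
rewrite !inE /= -!/(inl _ == inl _) ; apply: (iffP orP).
  by case=> /eqP[->]; [exists false; rewrite mulg1 | exists true; rewrite expg1].
by case=> -[] ->; [right | left; rewrite mulg1]; rewrite // expg1.
Qed.

Let inr_infb i g k : (inr k \in infb i g) = (k == i).
Proof. by rewrite !inE /= !orbF. Qed.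

Let inl_hb g a : (inl a \in hb g) = [|| a == g, a == h * g | a == h * h * g].
Proof. by rewrite !inE -!orbA. Qed.

Let inr_hb g k : (inr k \in hb g) = false. Proof. by rewrite !inE. Qed.

Let inr_infty k : inr k \in infty. Proof. exact: imset_f. Qed.

Let inl_infty a : (inl a \in infty) = false.
Proof. by apply/imsetP => -[]. Qed.

Let infbJ i g (b : bool) : infb i (j ^+ b * g) = infb i g.
Proof.
case: b; rewrite ?mul1g // expg1; apply/setP => -[a|k]; last by rewrite !inr_infb.
apply/inl_infb/inl_infb => -[] [] ->.
- by exists false; rewrite !expg1 !mulgA -(mulgA _ j j) j2 mulg1.
- by exists true; rewrite !mulg1 !mulgA.
- by exists false; rewrite !mulg1 !mulgA.
- by exists true; rewrite !expg1 !mulgA -(mulgA _ j j) j2.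
Qed.

Let mem_H d : (d \in [:: 1; h; h * h]) = [|| d == 1, d == h | d == h * h].
Proof. by rewrite !inE. Qed.

Let hbE a g : inl a \in hb g -> hb g = hb a.
Proof.
have sub b c : inl b \in hb c -> hb b \subset hb c.
  rewrite inl_hb => /or3P[] /eqP->; apply/subsetP => -[u|k]; rewrite ?inr_hb // !inl_hb //.
    by rewrite !mulgA h3 mul1g => /or3P[] ->; rewrite ?orbT.
  by rewrite !mulgA h3 !mul1g => /or3P[] ->; rewrite ?orbT.
move=> ag; apply/eqP; rewrite eqEsubset [in X in _ && X]sub // andbT.
apply: sub; move: ag; rewrite !inl_hb => /or3P[] /eqP->.
- by rewrite eqxx.
- by rewrite !mulgA h3 mul1g eqxx !orbT.
- by rewrite !mulgA h3 mul1g eqxx orbT.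
Qed.

Let hb_diff a c g : a != c -> inl a \in hb g -> inl c \in hb g ->
  a * c^-1 \in [:: h; h * h].
Proof.
move=> neq ag cg; move: ag; rewrite (hbE cg) inl_hb (negPf neq) /=.
by case/orP=> /eqP->; rewrite mulgK !inE eqxx ?orbT.
Qed.

Let blk_diff a c i g : a != c -> inl a \in blk i g -> inl c \in blk i g ->
  exists l k, [/\ l != k, a * c^-1 = delta (i, (l, k)) & g = (p i l)^-1 * a].
Proof.
move=> neq /inl_blk[l ea] /inl_blk[k ec]; exists l, k; split.
- by apply: contraNneq neq => e; rewrite ea ec e.
- by rewrite ea ec /delta /= invMg mulgA mulgK.
- by rewrite ea mulKg.
Qed.

Let infb_diff a c i g : a != c -> inl a \in infb i g -> inl c \in infb i g ->
  a * c^-1 = jj i /\ infb i g = infb i ((y i)^-1 * a).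
Proof.
move=> neq /inl_infb[b ea] /inl_infb[b' ec].
have ebb : b' = ~~ b.
  by case: b b' ea ec neq => -[] -> ->; rewrite ?eqxx.
split; last by rewrite ea -!mulgA mulKg infbJ.
rewrite ea ec ebb !invMg !mulgA mulgK /jj.
by case: b {ea ec ebb} => /=; rewrite ?expg1 ?mulg1 ?invg1 ?mulg1 // jV.
Qed.

(** Right translation preserves the quotient [a * c^-1]. The quotient thus selects the type of block
    and the base block, and [a] then selects the translate; this is what makes the line through two
    points unique. *)
Variant line_spec a c (b : {set T}) : Prop :=
| LineBlk i l k of l != k & a * c^-1 = delta (i, (l, k)) & b = blk i ((p i l)^-1 * a)
| LineInf i of a * c^-1 = jj i & b = infb i ((y i)^-1 * a)
| LineH of a * c^-1 \in [:: h; h * h] & b = hb a.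

Let lineP a c b : b \in blocks -> a != c -> inl a \in b -> inl c \in b ->
  line_spec a c b.
Proof.
move=> /blocksP[->|[g ->]|[i [g ->]]|[i [g ->]]] neq ab cb.
- by rewrite inl_infty in ab.
- by apply: LineH; [apply: hb_diff neq ab cb | apply: hbE].
- by have [e1 e2] := infb_diff neq ab cb; apply: LineInf e1 e2.
- have [l [k [lk e1 e2]]] := blk_diff neq ab cb.
  by apply: LineBlk lk e1 _; rewrite e2.
Qed.

Let delta_inj i l k i' l' k' : l != k -> l' != k' ->
  delta (i, (l, k)) = delta (i', (l', k')) -> [/\ i = i', l = l' & k = k'].
Proof.
by move=> lk lk' /(proj1 delta_sat); rewrite !inE => /(_ lk lk')[-> -> ->].
Qed.

Let delta_jj i l k i' : l != k -> delta (i, (l, k)) <> jj i'.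
Proof.
move=> lk e; have := deltaP i lk; rewrite e inE mem_cat codom_f orbT //.
Qed.

Let delta_H i l k : l != k -> delta (i, (l, k)) \notin [:: h; h * h].
Proof.
move=> lk; apply: contra (deltaP i lk) => e; rewrite inE mem_cat; apply/orP; left.
by rewrite inE e orbT.
Qed.

Let jj_H i : jj i \notin [:: h; h * h].
Proof. by apply: contra (jj_notH i) => e; rewrite inE e orbT. Qed.

Let line_uniq a c b b' : a != c -> b \in blocks -> b' \in blocks ->
  inl a \in b -> inl c \in b -> inl a \in b' -> inl c \in b' -> b = b'.
Proof.
move=> neq bB b'B ab cb ab' cb'.
case: (lineP bB neq ab cb) => [i l k lk|i|] e ->;
case: (lineP b'B neq ab' cb') => [i' l' k' lk'|i'|] e' ->.
- by move: e'; rewrite e => /(delta_inj lk lk')[-> -> _].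
- by case: (delta_jj lk (etrans (esym e) e')).
- by have := delta_H i lk; rewrite -e e'.
- by case: (delta_jj lk' (etrans (esym e') e)).
- by move: e'; rewrite e => /jj_inj->.
- by have := jj_H i; rewrite -e e'.
- by have := delta_H i' lk'; rewrite -e' e.
- by have := jj_H i'; rewrite -e' e.
- by [].
Qed.

Let inf_line i a b : b \in blocks -> inr i \in b -> inl a \in b ->
  b = infb i ((y i)^-1 * a).
Proof.
move=> /blocksP[->|[g ->]|[k [g ->]]|[k [g ->]]].
- by rewrite inl_infty.
- by rewrite inr_hb.
- by rewrite inr_infb => /eqP-> /inl_infb[e ->]; rewrite -!mulgA mulKg infbJ.
- by rewrite inr_blk.
Qed.

Let infty_line i k b : i != k -> b \in blocks -> inr i \in b -> inr k \in b -> b = infty.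
Proof.
move=> neq /blocksP[->|[g ->]|[l [g ->]]|[l [g ->]]] //.
- by rewrite inr_hb.
- by rewrite !inr_infb => /eqP e /eqP e'; rewrite e e' eqxx in neq.
- by rewrite inr_blk.
Qed.

Let blocks_card b : b \in blocks -> #|b| = 3.
Proof.
have h_mul g : h * g != g.
  by apply: contraNneq h_neq1 => e; rewrite -(mulgK g h) e mulgV.
move=> /blocksP[->|[g ->]|[k [g ->]]|[k [g ->]]].
- by rewrite card_imset ?card_ord // => u v [].
- rewrite /hb -setUA cardsU1 cards2 !inE /=.
  rewrite -!/(@eq_op _ (inl _) (inl _)).
  have -> : (inl g == inl (h * g) :> T) = false.
    by apply/negP => /eqP[] /eqP; rewrite eq_sym (negPf (h_mul g)).
  have -> : (inl g == inl (h * h * g) :> T) = false.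
    apply/negP => /eqP[] /esym/eqP; rewrite -[X in _ == X]mul1g (inj_eq (mulIg g)).
    by rewrite (negPf hh_neq1).
  have -> : (inl (h * g) == inl (h * h * g) :> T) = false.
    by apply/negP => /eqP[] /esym/eqP; rewrite -mulgA (negPf (h_mul _)).
  by [].
- rewrite /infb -setUA cardsU1 cards2 !inE /=.
  have -> : (inl (y k * g) == inl (y k * j * g) :> T) = false.
    apply/negP => /eqP[] /mulIg/esym/eqP; rewrite -[X in _ == X]mulg1.
    by rewrite (inj_eq (mulgI _)) (negPf j_neq1).
  by [].
- rewrite card_imset ?card_ord // => u v [] /mulIg e; apply/eqP.
  by apply: contraT => /(p_neq k); rewrite e eqxx.
Qed.

Let line_ex (x z : T) : x != z -> exists2 b, b \in blocks & x \in b /\ z \in b.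
Proof.
have inf_ex i a : exists2 b, b \in blocks & inr i \in b /\ inl a \in b.
  exists (infb i ((y i)^-1 * a)); first by apply/blocksP; constructor 3; eexists; eexists.
  by split; [rewrite inr_infb | apply/inl_infb; exists false; rewrite mulg1 mulKVg].
case: x z => [a|i] [c|k] neq.
- have {}neq : a != c by apply: contraNneq neq => ->.
  have [dH|dnH] := boolP (a * c^-1 \in [:: 1; h; h * h]).
    exists (hb c); first by apply/blocksP; constructor 2; exists c.
    rewrite !inl_hb eqxx; split=> //; move: dH; rewrite mem_H.
    rewrite -eq_mulgV1 (negPf neq) /= => /orP[] /eqP <-; rewrite mulgKV eqxx ?orbT //.
  case: (boolP [exists i, a * c^-1 == jj i]) => [/existsP[i /eqP e]|].
    exists (infb i ((y i)^-1 * c)); first by apply/blocksP; constructor 3; eexists; eexists.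
    split; apply/inl_infb; [exists true|exists false].
      by rewrite expg1 !mulgA -/(jj i) -e mulgKV.
    by rewrite mulg1 mulKVg.
  rewrite negb_exists => /forallP dJ; have [i [l [k [lk e]]]] := diff_cov dnH dJ.
  exists (blk i ((p i k)^-1 * c)); first by apply/blocksP; constructor 4; eexists; eexists.
  split; apply/inl_blk; [exists l|exists k].
    by rewrite mulgA e mulgKV.
  by rewrite mulKVg.
- by have [b bB []] := inf_ex k a; exists b.
- by have [b bB []] := inf_ex i c; exists b.
- exists infty; first by apply/blocksP; constructor 1.
  by rewrite !inr_infty.
Qed.

Let blocks_STS : is_STS blocks.
Proof.
split=> [b /blocks_card //|x z neq].
have [b bB [xb zb]] := line_ex neq; exists b; split=> // b' [b'B xb' zb'].
case: x z neq xb zb xb' zb' => [a|i] [c|k] neq xb zb xb' zb'.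
- by apply: line_uniq bB b'B xb zb xb' zb'; apply: contraNneq neq => ->.
- by rewrite (inf_line bB zb xb) (inf_line b'B zb' xb').
- by rewrite (inf_line bB xb zb) (inf_line b'B xb' zb').
- have {}neq : i != k by apply: contraNneq neq => ->.
  by rewrite (infty_line neq bB xb zb) (infty_line neq b'B xb' zb').
Qed.

Let class0P b : reflect (b = infty \/ exists g, b = hb g) (b \in class0).
Proof.
rewrite !inE; apply: (iffP orP) => [[/eqP->|/imsetP[g _ ->]]|[->|[g ->]]].
- by left.
- by right; exists g.
- by left; apply/eqP.
- by right; apply/imsetP; exists g.
Qed.

Let classP g b : reflect
  ((exists i, b = infb i g) \/ exists i (e : bool), b = blk i (j ^+ e * g))
  (b \in class g).
Proof.
rewrite !inE; apply: (iffP orP) => [[/imsetP[i _ ->]|/imsetP[[i e] _ ->]]|[[i ->]|[i [e ->]]]].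
- by left; exists i.
- by right; exists i, e.
- by left; apply/imsetP; exists i.
- by right; apply/imsetP; exists (i, e).
Qed.

Let classesP P : reflect (P = class0 \/ exists g, P = class g) (P \in classes).
Proof.
rewrite !inE; apply: (iffP orP) => [[/eqP->|/imsetP[g _ ->]]|[->|[g ->]]].
- by left.
- by right; exists g.
- by left; apply/eqP.
- by right; apply/imsetP; exists g.
Qed.

Let jbb (b : bool) : j ^+ b * j ^+ b = 1. Proof. by case: b; rewrite ?expg1 ?mulg1. Qed.

Let jbD (b c : bool) : j ^+ b * j ^+ c = j ^+ (b (+) c).
Proof. by case: b c => -[]; rewrite ?expg1 ?expg0 ?mulg1 ?mul1g. Qed.

Let classJ (b : bool) g : class (j ^+ b * g) = class g.
Proof.
apply/setP => B; apply/classP/classP => [[[i ->]|[i [e ->]]]|[[i ->]|[i [e ->]]]].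
- by left; exists i; rewrite infbJ.
- by right; exists i, (e (+) b); rewrite mulgA jbD.
- by left; exists i; rewrite infbJ.
- by right; exists i, (e (+) b); rewrite mulgA jbD addbK.
Qed.

Let blk_inj i i' g g' : blk i g = blk i' g' -> i = i' /\ g = g'.
Proof.
move=> e; pose a := p i ord0 * g; pose c := p i ord_max * g.
have neq : a != c by rewrite (inj_eq (mulIg g)) p_neq.
have ab : inl a \in blk i g by apply/inl_blk; exists ord0.
have cb : inl c \in blk i g by apply/inl_blk; exists ord_max.
have [l [k [lk e1 e2]]] := blk_diff neq ab cb.
rewrite e in ab cb; have [l' [k' [lk' e1' e2']]] := blk_diff neq ab cb.
by move: e1'; rewrite e1 => /(delta_inj lk lk')[ii ll _]; split=> //; rewrite e2 e2' ii ll.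
Qed.

Let hb_blk g i g' : hb g <> blk i g'.
Proof.
move=> e; have neq : g != h * g.
  by apply: contraNneq h_neq1 => e'; rewrite -(mulgK g h) -e' mulgV.
have ab : inl g \in hb g by rewrite inl_hb eqxx.
have cb : inl (h * g) \in hb g by rewrite inl_hb eqxx orbT.
have dH := hb_diff neq ab cb; rewrite e in ab cb.
have [l [k [lk e1 e2]]] := blk_diff neq ab cb.
by have := delta_H i lk; rewrite -e1 dH.
Qed.

Let classes_partition : partition classes blocks.
Proof.
apply: partition_of_points => [b|P|P Q b].
- case/blocksP => [->|[g ->]|[i [g ->]]|[i [g ->]]].
  + by exists class0; [apply/classesP; left | apply/class0P; left].
  + by exists class0; [apply/classesP; left | apply/class0P; right; exists g].
  + exists (class g); first by apply/classesP; right; exists g.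
    by apply/classP; left; exists i.
  + exists (class g); first by apply/classesP; right; exists g.
    by apply/classP; right; exists i, false; rewrite mul1g.
- case/classesP => [->|[g ->]]; split.
  + apply/subsetP => b /class0P[->|[g ->]]; apply/blocksP; first by constructor 1.
    by constructor 2; exists g.
  + by exists infty; apply/class0P; left.
  + apply/subsetP => b /classP[[i ->]|[i [e ->]]]; apply/blocksP.
      by constructor 3; exists i, g.
    by constructor 4; eexists; eexists.
  + by exists (infb ord0 g); apply/classP; left; exists ord0.
- have disj g b' : b' \in class0 -> b' \in class g -> False.
    case/class0P => [->|[g' ->]] /classP[[i]|[i [e]]].
    + move=> /setP e; have := inr_infty ord0; have := inr_infty ord_max.
      by rewrite !e !inr_infb => /eqP<-.
    + by move=> /setP e'; have := inr_infty ord0; rewrite e' inr_blk.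
    + by move=> /setP/(_ (inr i)); rewrite inr_hb inr_infb eqxx.
    + exact: hb_blk.
  case/classesP => [->|[g ->]] /classesP[->|[g' ->]] // bP bQ.
  + by case: (disj g' b).
  + by case: (disj g b).
  + case/classP: bP bQ => [[i ->]|[i [e ->]]] /classP[[i' E]|[i' [e' E]]].
    * move: (E) => /setP/(_ (inr i)); rewrite !inr_infb eqxx => /esym/eqP ii.
      rewrite -ii in E; have : inl (y i * g) \in infb i g'.
        by rewrite -E; apply/inl_infb; exists false; rewrite mulg1.
      by move/inl_infb => [c]; rewrite -mulgA => /mulgI ->; rewrite classJ.
    * by move: E => /setP/(_ (inr i)); rewrite inr_infb inr_blk eqxx.
    * by move: E => /setP/(_ (inr i')); rewrite inr_infb inr_blk eqxx.
    * have [_ E2] := blk_inj E.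
      by rewrite -(classJ e g) E2 classJ.
Qed.

Let pt_inj i l (b : bool) i' l' (b' : bool) :
  p i l * j ^+ b = p i' l' * j ^+ b' -> [/\ i = i', l = l' & b = b'].
Proof. by move=> /(proj1 pt_sat (i, (l, b)) (i', (l', b')))[-> -> ->]. Qed.

Let pt_y i l (b : bool) i' (b' : bool) : p i l * j ^+ b <> y i' * j ^+ b'.
Proof.
by move=> e; have /negP[] := ptP i l b; apply/imsetP; exists (i', b').
Qed.

(** The conjugate [jj i] depends only on the left coset of [y i] modulo the powers of [j]. *)
Let y_inj i (b : bool) i' (b' : bool) : y i * j ^+ b = y i' * j ^+ b' -> i = i'.
Proof.
move=> e; apply: jj_inj; rewrite /jj.
have {e}-> : y i = y i' * j ^+ (b' (+) b) by rewrite -jbD mulgA -e -mulgA jbb mulg1.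
by case: (_ (+) _); rewrite ?expg1 ?expg0 ?mulg1 // invMg !mulgA mulgK.
Qed.

Let class_partition P : P \in classes -> partition P [set: T].
Proof.
case/classesP => [->|[g ->]]; apply: partition_of_points => [x _|b|b b' x].
- case: x => [a|i]; last by exists infty => //; apply/class0P; left.
  by exists (hb a); [apply/class0P; right; exists a | rewrite inl_hb eqxx].
- case/class0P => [->|[a ->]]; split; rewrite ?subsetT //.
    by exists (inr ord0); apply: inr_infty.
  by exists (inl a); rewrite inl_hb eqxx.
- case/class0P => [->|[a ->]] /class0P[->|[c ->]] //; case: x => [u|i].
  + by rewrite inl_infty.
  + by rewrite inr_hb.
  + by rewrite inl_infty.
  + by rewrite inr_hb.
  + by move=> /hbE-> /hbE.
  + by rewrite inr_hb.
- case: x => [a|i]; last first.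
    by exists (infb i g); [apply/classP; left; exists i | rewrite inr_infb].
  case: (boolP [exists x : 'I_3 * bool, a * g^-1 == y x.1 * j ^+ x.2]).
    case/existsP => -[i b] /eqP /= e; exists (infb i g).
      by apply/classP; left; exists i.
    by apply/inl_infb; exists b; rewrite -e mulgKV.
  rewrite negb_exists => /forallP ny.
  have [|i [l [b e]]] := pt_cov (x := a * g^-1); first by move=> i b; apply: (ny (i, b)).
  exists (blk i (j ^+ b * g)); first by apply/classP; right; exists i, b.
  by apply/inl_blk; exists l; rewrite mulgA e mulgKV.
- case/classP => [[i ->]|[i [e ->]]]; split; rewrite ?subsetT //.
    by exists (inr i); rewrite inr_infb.
  by exists (inl (p i ord0 * (j ^+ e * g))); apply/inl_blk; exists ord0.
- case/classP => [[i ->]|[i [e ->]]] /classP[[i' ->]|[i' [e' ->]]]; case: x => [a|k].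
  + by move=> /inl_infb[c ->] /inl_infb[c' /mulIg /y_inj ->].
  + by rewrite !inr_infb => /eqP<- /eqP<-.
  + by move=> /inl_infb[c ->] /inl_blk[l]; rewrite mulgA => /mulIg/esym/pt_y.
  + by rewrite inr_blk.
  + by move=> /inl_blk[l ->] /inl_infb[c]; rewrite mulgA => /mulIg/pt_y.
  + by rewrite inr_blk.
  + by move=> /inl_blk[l ->] /inl_blk[l']; rewrite !mulgA => /mulIg/pt_inj[-> _ ->].
  + by rewrite inr_blk.
Qed.

Let tr g (x : T) : T := match x with inl a => inl (a * g) | inr i => inr i end.

Let tr_inj g : injective (tr g).
Proof. case=> [a|i] [c|k] H; move: H; rewrite /tr => -[] //; [by move/mulIg->|by move=> ->]. Qed.

Let rho g : {perm T} := perm (@tr_inj g).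

Let rhoM : {morph rho : a c / a * c}.
Proof. by move=> a c; apply/permP => -[u|i]; rewrite permM !permE //= mulgA. Qed.

Let rho_infty g : rho g @: infty = infty.
Proof.
apply/setP => x; apply/imsetP/idP => [[_ /imsetP[i _ ->] ->]|/imsetP[i _ ->]].
  by rewrite permE /=.
by exists (inr i); rewrite ?permE.
Qed.

Let rho_hb g a : rho g @: hb a = hb (a * g).
Proof. by rewrite /hb !imsetU !imset_set1 !permE /= !mulgA. Qed.

Let rho_infb g i a : rho g @: infb i a = infb i (a * g).
Proof. by rewrite /infb !imsetU !imset_set1 !permE /= !mulgA. Qed.

Let rho_blk g i a : rho g @: blk i a = blk i (a * g).
Proof.
by rewrite /blk -imset_comp; apply: eq_imset => l; rewrite /= permE /= mulgA.
Qed.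

Let rho_aut g : is_KTS_aut blocks classes (rho g).
Proof.
split=> [b|P].
  case/blocksP => [->|[a ->]|[i [a ->]]|[i [a ->]]]; apply/blocksP.
  - by constructor 1; rewrite rho_infty.
  - by constructor 2; rewrite rho_hb; eexists.
  - by constructor 3; rewrite rho_infb; eexists; eexists.
  - by constructor 4; rewrite rho_blk; eexists; eexists.
have gV a : a = a * g^-1 * g by rewrite mulgKV.
case/classesP => [->|[a ->]]; apply/classesP; [left|right; exists (a * g)];
    apply/setP => b; apply/imsetP/idP.
- case=> _ /class0P[->|[c ->]] ->; rewrite ?rho_infty ?rho_hb; apply/class0P; first by left.
  by right; eexists.
- case/class0P => [->|[c ->]]; [exists infty | exists (hb (c * g^-1))].
  + by apply/class0P; left.
  + by rewrite rho_infty.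
  + by apply/class0P; right; eexists.
  + by rewrite rho_hb -gV.
- case=> _ /classP[[i ->]|[i [e ->]]] ->; rewrite ?rho_infb ?rho_blk; apply/classP.
    by left; eexists.
  by right; exists i, e; rewrite mulgA.
- case/classP => [[i ->]|[i [e ->]]]; [exists (infb i a) | exists (blk i (j ^+ e * a))].
  + by apply/classP; left; eexists.
  + by rewrite rho_infb.
  + by apply/classP; right; eexists; eexists.
  + by rewrite rho_blk mulgA.
Qed.

Lemma KTS_of_difference_family : exists_3pyramidal_KTS (#|G| + 3).
Proof.
exists T, blocks, classes; split.
- by rewrite card_sum card_ord.
- by split; [exact: blocks_STS | exact: classes_partition | exact: class_partition].
have rho_set : group_set (rho @: setT).
  apply/group_setP; split=> [|_ _ /imsetP[a _ ->] /imsetP[c _ ->]].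
    apply/imsetP; exists 1; rewrite ?inE //.
    by apply/permP => -[u|i]; rewrite !permE //= mulg1.
  by apply/imsetP; exists (a * c); rewrite ?rhoM.
pose R := Group rho_set.
have fixE : 'Fix_('P)(R) = [set inr i | i : 'I_3] :> {set T}.
  apply/setP => -[a|i].
    apply/afixP/imsetP => [fix_a|[k _ //]].
    have := fix_a (rho j); rewrite imset_f // => /(_ isT); rewrite /= apermE permE /=.
    by case=> /eqP; rewrite -[X in _ == X]mulg1 (inj_eq (mulgI _)) (negPf j_neq1).
  rewrite imset_f //; apply/afixP => _ /imsetP[g _ ->].
  by rewrite /= apermE permE.
have inl_fix a : inl a \in ~: 'Fix_('P)(R).
  by rewrite fixE inE; apply/imsetP => -[].
exists R; split.
- by move=> s /imsetP[g _ ->].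
- by rewrite fixE card_imset ?card_ord // => u v [].
split.
  apply/imsetP; exists (inl 1); first exact: inl_fix.
  apply/setP => -[a|i].
    rewrite inl_fix; apply/esym/orbitP; exists (rho a); first exact: imset_f.
    by rewrite /= apermE permE /= mul1g.
  rewrite fixE inE imset_f //=; apply/esym/negP => /orbitP[_ /imsetP[g _ ->]].
  by rewrite /= apermE permE.
move=> [a|i]; last by rewrite fixE inE imset_f.
move=> _; apply/trivgP/subsetP => s /setIP[/imsetP[g _ ->]].
move=> /astab1P; rewrite /= apermE permE /= => -[/eqP].
rewrite -[X in _ == X]mulg1 (inj_eq (mulgI _)) => /eqP->.
by apply/set1P/permP => -[u|i]; rewrite !permE //= mulg1.
Qed.
End Develop.

Import GRing.Theory.

(** * Families of triples and their extension from a subgroup *)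

Section Families.
Variable G : finGroupType.
Implicit Types (t : G * G * G) (F : seq (G * G * G)) (S : {set G}).

Definition diffs t :=
  [:: t.1.1 * t.1.2^-1; t.1.2 * t.1.1^-1; t.1.2 * t.2^-1; t.2 * t.1.2^-1;
      t.1.1 * t.2^-1; t.2 * t.1.1^-1].

Definition pts j t := [:: t.1.1; t.1.2; t.2; t.1.1 * j; t.1.2 * j; t.2 * j].

(* The quotients of the triples cover [S], and so do the points of the triples
   together with their right translates by [j]; the size makes both coverings
   exact. *)
Definition relative_family j S F :=
  (size F * 6 = #|S|)%N /\ forall d, d \in S ->
    (exists2 t, t \in F & d \in diffs t) /\ (exists2 t, t \in F & d \in pts j t).

Definition has_relative_family j S := exists F, relative_family j S F.

(* Besides [F], the blocks come from the subgroup generated by [h] and from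
   [{y i, y i * j}], completed by the i-th added symbol. *)
Definition pyramidal_family j h (y : 'I_3 -> G) F :=
  [/\ (size F * 6 + 6 = #|G|)%N,
      forall d, d \notin [:: 1; h; h * h] -> (forall i, d != y i * j * (y i)^-1) ->
        exists2 t, t \in F & d \in diffs t
    & forall x, (forall i (b : bool), x != y i * j ^+ b) ->
        exists2 t, t \in F & x \in pts j t].

Definition has_pyramidal_family j := exists h (y : 'I_3 -> G) F,
  [/\ j != 1, j * j = 1, h != 1, h * h * h = 1
    & injective (fun i => y i * j * (y i)^-1)] /\ pyramidal_family j h y F.

Lemma diffsP t d : d \in diffs t -> exists l k : 'I_3, l != k /\
  tnth [tuple t.1.1; t.1.2; t.2] l * (tnth [tuple t.1.1; t.1.2; t.2] k)^-1 = d.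
Proof.
pose u i (H : i < 3) := Ordinal H.
rewrite !inE => /or4P[/eqP->|/eqP->|/eqP->|/or3P[/eqP->|/eqP->|/eqP->]].
- by exists (@u 0%N isT), (@u 1%N isT).
- by exists (@u 1%N isT), (@u 0%N isT).
- by exists (@u 1%N isT), (@u 2%N isT).
- by exists (@u 2%N isT), (@u 1%N isT).
- by exists (@u 0%N isT), (@u 2%N isT).
- by exists (@u 2%N isT), (@u 0%N isT).
Qed.

Lemma ptsP j t x : x \in pts j t -> exists (l : 'I_3) (b : bool),
  tnth [tuple t.1.1; t.1.2; t.2] l * j ^+ b = x.
Proof.
pose u i (H : i < 3) := Ordinal H.
rewrite !inE => /or4P[/eqP->|/eqP->|/eqP->|/or3P[/eqP->|/eqP->|/eqP->]].
- by exists (@u 0%N isT), false; rewrite mulg1.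
- by exists (@u 1%N isT), false; rewrite mulg1.
- by exists (@u 2%N isT), false; rewrite mulg1.
- by exists (@u 0%N isT), true.
- by exists (@u 1%N isT), true.
- by exists (@u 2%N isT), true.
Qed.

Lemma pyramidal_family_KTS j : has_pyramidal_family j -> exists_3pyramidal_KTS (#|G| + 3).
Proof.
case=> h [y [F [[j1 j2 h1 h3 jjI] [cF dF pF]]]].
pose T i := tnth (in_tuple F) i.
apply: (@KTS_of_difference_family G 'I_(size F) j h y
  (fun i l => tnth [tuple (T i).1.1; (T i).1.2; (T i).2] l)) => //.
- by rewrite card_ord.
- move=> d dH dJ; have [t tF /diffsP[l [k [lk e]]]] := dF d dH dJ.
  have /tnthP[i ti] : t \in in_tuple F by [].
  by exists i, l, k; rewrite /T -ti.
- move=> x xY; have [t tF /ptsP[l [b e]]] := pF x xY.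
  have /tnthP[i ti] : t \in in_tuple F by [].
  by exists i, l, b; rewrite /T -ti.
Qed.

End Families.

Definition map3 (A B : Type) (f : A -> B) (t : A * A * A) := (f t.1.1, f t.1.2, f t.2).

Section Transport.
Variables (G' G : finGroupType) (f : G' -> G).
Hypotheses (fM : {morph f : x z / x * z}) (f_inj : injective f).

Let f1 : f 1 = 1.
Proof. by apply: (mulgI (f 1)); rewrite -fM !mulg1. Qed.

Let fV x : f x^-1 = (f x)^-1.
Proof. by apply: (mulgI (f x)); rewrite -fM !mulgV. Qed.

Lemma diffs_map t d : d \in diffs t -> f d \in diffs (map3 f t).
Proof. by move/(map_f f); rewrite /= !fM !fV. Qed.

Lemma pts_map j t d : d \in pts j t -> f d \in pts (f j) (map3 f t).
Proof. by move/(map_f f); rewrite /= !fM. Qed.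

Lemma relative_family_transport j S :
  has_relative_family j S -> has_relative_family (f j) (f @: S).
Proof.
case=> F [cF covF]; exists (map (map3 f) F); split.
  by rewrite size_map cF card_imset.
move=> _ /imsetP[x xS ->]; have [[t tF xt] [t' tF' xt']] := covF x xS.
split; [exists (map3 f t) | exists (map3 f t')].
- exact: map_f.
- exact: diffs_map.
- exact: map_f.
- exact: pts_map.
Qed.

(** [h] and the [y i] are taken from the subgroup, so every excluded quotient and point already lies
    in it. Only its complement has to be covered anew. *)
Lemma pyramidal_family_extend j :
  has_pyramidal_family j -> has_relative_family (f j) (~: (f @: setT)) ->
  has_pyramidal_family (f j).
Proof.
case=> h [y [F [[j1 j2 h1 h3 jjI] [cF dF pF]]]] [F' [cF' covF']].
have f_eq1 x : (f x == 1) = (x == 1) by rewrite -f1 (inj_eq f_inj).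
exists (f h), (f \o y), (map (map3 f) F ++ F'); split; split.
- by rewrite f_eq1.
- by rewrite -fM j2.
- by rewrite f_eq1.
- by rewrite -!fM h3.
- by move=> i k /=; rewrite -!fV -!fM => /f_inj/jjI.
- rewrite size_cat mulnDl size_map cF' addnAC cF -[#|G'|]cardsT.
  by rewrite -(card_imset _ f_inj) cardsC.
- move=> d dH dJ; case: (boolP (d \in ~: (f @: setT))) => [/covF'[[t tF td] _]|].
    by exists t; rewrite // mem_cat tF orbT.
  rewrite inE negbK => /imsetP[x _ ed].
  have [||t tF xt] := dF x.
  + by apply: contra dH => /(map_f f); rewrite /= f1 !fM ed.
  + by move=> i; apply: contraNneq (dJ i) => e; rewrite ed e !fM fV.
  by exists (map3 f t); [rewrite mem_cat map_f | rewrite ed diffs_map].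
- move=> d dY; case: (boolP (d \in ~: (f @: setT))) => [/covF'[_ [t tF td]]|].
    by exists t; rewrite // mem_cat tF orbT.
  rewrite inE negbK => /imsetP[x _ ed].
  have [|t tF xt] := pF x.
    move=> i b; apply: contraNneq (dY i b) => e; rewrite ed e fM.
    by case: b {e}; rewrite ?expg1 ?expg0 ?f1.
  by exists (map3 f t); [rewrite mem_cat map_f | rewrite ed pts_map].
Qed.

Lemma pyramidal_family_iso j :
  #|G'| = #|G| -> has_pyramidal_family j -> has_pyramidal_family (f j).
Proof.
move=> cG famj; apply: pyramidal_family_extend famj _.
have -> : f @: setT = setT.
  by apply/eqP; rewrite eqEcard subsetT card_imset // !cardsT cG leqnn.
by exists nil; split; rewrite ?setCT ?cards0 // => d; rewrite inE.
Qed.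

End Transport.

(* [T - 1], [T] and [T + 1] are the rows of a difference matrix over [D], each
   of which is moreover a permutation of [D]. *)
Definition dm_group (D : finZmodType) := exists T : D -> D,
  [/\ {morph T : x z / (x + z)%R}, injective T, injective (fun x => T x + x)%R,
      injective (fun x => T x - x)%R & injective (fun x : D => x + x)%R].

Section DifferenceMatrix.
Variables (G : finGroupType) (D : finZmodType) (j : G) (S : {set G}).

(** The three entries of a triple receive the [D]-coordinates [T x + x], [T x - x], [T x]. Their
    differences are, up to sign, [x + x], [x] and [x], so quotients run over all of [D]; so do the
    coordinates themselves, which serves the points, as [j] acts trivially on [D]. *)
Lemma relative_family_dm : dm_group D -> has_relative_family j S ->
  has_relative_family ((j, 0%R) : G * D) [set x | x.1 \in S].
Proof.
case=> T [TD TI TpI TmI dI] [F [cF covF]].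
have surj (f : D -> D) : injective f -> forall z, exists x, f x = z.
  by move=> fI z; exists (invF fI z); rewrite f_invF.
pose row (t : G * G * G) (x : D) : (G * D) * (G * D) * (G * D) :=
  ((t.1.1, T x + x), (t.1.2, T x - x), (t.2, T x))%R.
exists [seq row t x | t <- F, x <- enum D]; split.
  rewrite size_allpairs -cardE mulnAC cF.
  rewrite (eq_card (B := predX (mem S) (mem D))) ?cardX // => -[a b].
  by rewrite !inE andbT.
have mem t x : t \in F -> row t x \in [seq row t x | t <- F, x <- enum D].
  by move=> tF; apply: allpairs_f; rewrite ?mem_enum.
move=> [g z]; rewrite inE /= => /covF[[t tF gt] [t' tF' gt']].
have oppz : exists w, (w = - z)%R by eexists.
split.
  have pair e x (a b : G * D) : (a * b^-1 = e :> G * D) -> a * b^-1 \in diffs (row t x) ->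
      exists2 t0, t0 \in [seq row t x | t <- F, x <- enum D] & e \in diffs t0.
    by move=> <- ab; exists (row t x); rewrite ?mem.
  have dE (a b : G) (u v : D) : (a, u) * (b, v)^-1 = (a * b^-1, (u - v)%R) :> G * D by [].
  move: gt; rewrite !inE => /or4P[/eqP->|/eqP->|/eqP->|/or3P[/eqP->|/eqP->|/eqP->]].
  - have [x ex] := surj _ dI z.
    apply: (pair _ x (t.1.1, T x + x)%R (t.1.2, T x - x)%R); last by rewrite !inE eqxx ?orbT.
    by rewrite dE -ex opprB addrC addrA subrK.
  - have [x ex] := surj _ dI (- z)%R.
    apply: (pair _ x (t.1.2, T x - x)%R (t.1.1, T x + x)%R); last by rewrite !inE eqxx ?orbT.
    by rewrite dE -[z]opprK -ex opprD addrACA subrr add0r opprD.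
  - apply: (pair _ (- z)%R (t.1.2, T (- z) - (- z))%R (t.2, T (- z))%R); last by rewrite !inE eqxx ?orbT.
    by rewrite dE opprK addrAC subrr add0r.
  - apply: (pair _ z (t.2, T z)%R (t.1.2, T z - z)%R); last by rewrite !inE eqxx ?orbT.
    by rewrite dE opprB addrC subrK.
  - apply: (pair _ z (t.1.1, T z + z)%R (t.2, T z)%R); last by rewrite !inE eqxx ?orbT.
    by rewrite dE addrAC subrr add0r.
  - apply: (pair _ (- z)%R (t.2, T (- z))%R (t.1.1, T (- z) + (- z))%R); last by rewrite !inE eqxx ?orbT.
    by rewrite dE opprD opprK addrA subrr add0r.
have pm (a : G) (u : D) : ((a, u) : G * D) * (j, 0%R) = (a * j, u).
  by rewrite -[u in RHS]addr0.
have pt e x : e \in pts ((j, 0%R) : G * D) (row t' x) ->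
    exists2 t0, t0 \in [seq row t x | t <- F, x <- enum D] & e \in pts ((j, 0%R) : G * D) t0.
  by move=> ab; exists (row t' x); rewrite ?mem.
have [x1 e1] := surj _ TpI z; have [x2 e2] := surj _ TmI z; have [x3 e3] := surj _ TI z.
move: gt'; rewrite !inE => /or4P[/eqP->|/eqP->|/eqP->|/or3P[/eqP->|/eqP->|/eqP->]].
- by apply: (pt _ x1); rewrite !inE -e1 eqxx ?orbT.
- by apply: (pt _ x2); rewrite !inE -e2 eqxx ?orbT.
- by apply: (pt _ x3); rewrite !inE -e3 eqxx ?orbT.
- by apply: (pt _ x1); rewrite !inE !pm -e1 eqxx ?orbT.
- by apply: (pt _ x2); rewrite !inE !pm -e2 eqxx ?orbT.
- by apply: (pt _ x3); rewrite !inE !pm -e3 eqxx ?orbT.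
Qed.

End DifferenceMatrix.

(** * Patterns *)

Lemma orbit_transversal (U : finType) (D : {set U}) (f : U -> U) (d : nat) :
    injective f -> 0 < d -> (forall x, x \in D -> f x \in D) ->
    (forall x, x \in D -> iter d f x = x) ->
    (forall x e, x \in D -> 0 < e < d -> iter e f x <> x) ->
  exists X : {set U}, (#|X| * d = #|D|)%N /\
    forall c, c \in D -> exists2 x, x \in X & exists2 e, e < d & c = iter e f x.
Proof.
move=> fI d0 fD fd free.
have ordD x : x \in D -> fingraph.order f x = d.
  move=> xD; have m0 : 0 < fingraph.order f x by rewrite -fingraph.orderSpred.
  have lt_md : fingraph.order f x <= d.
    rewrite leqNgt; apply/negP => ltd.
    have : nth x (fingraph.orbit f x) d = nth x (fingraph.orbit f x) 0.
      by rewrite /fingraph.orbit !nth_traject //= fd.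
    move/eqP; rewrite nth_uniq ?fingraph.orbit_uniq ?fingraph.size_orbit // => /eqP e.
    by rewrite e in d0.
  move: lt_md; rewrite leq_eqVlt => /orP[/eqP //|lt_md].
  by case: (free x (fingraph.order f x) xD); rewrite ?m0 // iter_order.
have Dcl : fclosed f D.
  apply: (intro_closed (fconnect_sym fI)) => x _ /eqP<-; exact: fD.
exists [set x in D | froots f x]; split.
  rewrite -(fcard_order_set fI (n := d) _ Dcl); last first.
    by apply/subsetP => x /ordD; rewrite inE => ->.
  congr (_ * _)%N; apply: eq_card => x; rewrite !inE andbC //.
move=> c cD; exists (froot f c).
  rewrite inE roots_root ?andbT; last exact: fconnect_sym.
  by rewrite -(closed_connect Dcl (connect_root _ c)).
have con : fconnect f (froot f c) c by rewrite fconnect_sym // connect_root.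
exists (findex f (froot f c) c); last by rewrite iter_findex.
rewrite -(ordD (froot f c)) ?findex_max //.
by rewrite -(closed_connect Dcl (connect_root _ c)).
Qed.

(* A pattern is a list of triples of pairs [(alpha, g)]; [alpha = (a, b)] stands
   for the scalar [a + b * theta].  Letting [x] run over a transversal, the pair
   describes the group element [v alpha x * kappa g]. *)
Definition scalar : Type := int * int.
Definition term (G0 : Type) : Type := scalar * G0.
Definition pattern (G0 : Type) : Type := seq (term G0 * term G0 * term G0).

Section Patterns.
Variables (G0 : finGroupType) (tw : G0 -> scalar -> scalar).

Definition subs (a b : scalar) : scalar := ((a.1 - b.1)%R, (a.2 - b.2)%R).

(** In the quotient of two described elements, [kappa g] has to move past a factor [v]; [tw g]
    records its effect on the scalar. *)
Definition tdiff (s t : term G0) : term G0 :=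
  let g := s.2 * t.2^-1 in (subs s.1 (tw g t.1), g).

Definition pattern_diffs (p : pattern G0) : seq (term G0) :=
  flatten [seq [:: tdiff t.1.1 t.1.2; tdiff t.1.2 t.1.1; tdiff t.1.2 t.2;
                   tdiff t.2 t.1.2; tdiff t.1.1 t.2; tdiff t.2 t.1.1] | t <- p].

Definition tmulj (j : G0) (t : term G0) : term G0 := (t.1, t.2 * j).

Definition pattern_pts j (p : pattern G0) : seq (term G0) :=
  flatten [seq [:: t.1.1; t.1.2; t.2; tmulj j t.1.1; tmulj j t.1.2; tmulj j t.2]
          | t <- p].

(** Group elements of one class [cl] are filled together and with the same list of scalars, which
    the pattern may choose among [scs]. Classes are singletons except where [v] covers only up to a
    translation by [kappa]. *)
Definition fills (cls : seq (seq G0)) (scs : seq (seq scalar)) (l : seq (term G0)) :=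
  all (fun cl =>
    let l' := [seq t <- l | t.2 \in cl] in
    has (fun sc => all (fun g => all (fun a => (a, g) \in l') sc) cl) scs) cls.

Definition pattern_ok j cls scs (p : pattern G0) :=
  fills cls scs (pattern_diffs p) && fills cls scs (pattern_pts j p).

Variables (G : finGroupType) (kappa : G0 -> G) (X : finType) (Xs : {set X}).
Variable v : scalar -> X -> G.
Hypothesis kappaM : {morph kappa : g h / g * h}.
Hypothesis vB : forall a b x, v (subs a b) x = v a x * (v b x)^-1.
Hypothesis vJ : forall g a x, kappa g * v a x = v (tw g a) x * kappa g.

Let el (t : term G0) x := v t.1 x * kappa t.2.

Let tdiffE s t x : el (tdiff s t) x = el s x * (el t x)^-1.
Proof.
rewrite /el /tdiff /=; set g := _ * _^-1.
have -> : kappa s.2 = kappa g * kappa t.2 by rewrite -kappaM mulgKV.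
rewrite vB invMg !mulgA mulgK.
rewrite -(mulgA (v s.1 x)) -(mulgA (v s.1 x)); congr (_ * _).
by apply: (mulIg (v t.1 x)); rewrite mulgKV -mulgA vJ mulKg.
Qed.

Let tmuljE j t x : el (tmulj j t) x = el t x * kappa j.
Proof. by rewrite /el /= kappaM mulgA. Qed.

(** The check concerns finitely many integer scalars over [G0]. The target group enters only through
    [kappa], [v] and [Xs], so one computation serves infinitely many groups. *)
Lemma pattern_family j cls scs p (S : {set G}) :
    pattern_ok j cls scs p ->
    (size p * 6 * #|Xs| = #|S|)%N ->
    (forall d, d \in S -> exists2 cl, cl \in cls & forall sc, sc \in scs ->
       exists g a x, [/\ g \in cl, a \in sc, x \in Xs & d = v a x * kappa g]) ->
  has_relative_family (kappa j) S.
Proof.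
move=> /andP[dp pp] cardS covS.
pose blk t x := (el t.1.1 x, el t.1.2 x, el t.2 x).
exists [seq blk t x | t <- p, x <- enum Xs]; split.
  by rewrite size_allpairs -cardE mulnAC.
have fillsP l d : fills cls scs l -> d \in S ->
    exists t x, [/\ t \in l, x \in Xs & el t x = d].
  move=> /allP fl /covS[cl /fl /= /hasP[sc sc_in /allP ok] /(_ _ sc_in)].
  move=> [g [a [x [gcl asc xX ->]]]]; exists (a, g), x; split=> //.
  by have := allP (ok g gcl) a asc; rewrite mem_filter => /andP[].
move=> d dS; split.
  have [s [x [/flattenP[_ /mapP[t tp ->] st] xX <-]]] := fillsP _ _ dp dS.
  exists (blk t x); first by apply: allpairs_f; rewrite ?mem_enum.
  by have := map_f (fun s => el s x) st; rewrite /= !tdiffE.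
have [s [x [/flattenP[_ /mapP[t tp ->] st] xX <-]]] := fillsP _ _ pp dS.
exists (blk t x); first by apply: allpairs_f; rewrite ?mem_enum.
by have := map_f (fun s => el s x) st; rewrite /= !tmuljE.
Qed.

End Patterns.

Definition has_linear_family (G0 : finGroupType) (j0 : G0) (C : finZmodType) :=
  has_relative_family ((j0, 0%R) : G0 * C) [set x | x.2 != 0%R].

Section Scalars.
Variable C : finZmodType.
Local Open Scope ring_scope.

Definition evals (theta : C -> C) (a : scalar) (x : C) : C := x *~ a.1 + theta x *~ a.2.

Lemma evalsB theta a b x :
  evals theta (subs a b) x = evals theta a x - evals theta b x.
Proof. by rewrite /evals !mulrzBr opprD addrACA. Qed.

(** Every list of [scs] must carry the same [Xs] onto the nonzero elements; a pattern can then use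
    different lists at different group elements. The summand 1 accounts for zero. *)
Definition scale_cover (theta : C -> C) (d : nat) (Xs : {set C}) (scs : seq (seq scalar)) :=
  (#|Xs| * d + 1 = #|C|)%N /\
  forall sc, sc \in scs -> forall c, c != 0 ->
    exists a x, [/\ a \in sc, x \in Xs & c = evals theta a x].

Lemma linear_family_of_pattern (G0 : finGroupType) (j0 : G0) theta d Xs scs
    (elems : seq G0) (p : pattern G0) :
    scale_cover theta d Xs scs -> (forall g, g \in elems) ->
    (size p * 6 = #|G0| * d)%N ->
    pattern_ok (fun _ a => a) j0 [seq [:: g] | g <- elems] scs p ->
  has_linear_family j0 C.
Proof.
move=> [cX covX] elemsP szp okp.
apply: (@pattern_family _ (fun _ a => a) (G0 * C)%type (fun g => (g, 0)) C Xs
  (fun a x => (1%g, evals theta a x)) _ _ _ j0 _ _ _ _ okp).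
- by move=> g h; congr (_, _); rewrite FinRing.zmodMgE addr0.
- by move=> a b x; congr (_, _); [rewrite /= mulgV | exact: evalsB].
- by move=> g a x; congr (_, _); rewrite ?mulg1 ?mul1g // FinRing.zmodMgE addr0 add0r.
- rewrite szp -mulnA [(d * _)%N]mulnC.
  have -> : [set x : G0 * C | x.2 != 0] = setX setT [set~ 0].
    by apply/setP => -[g c]; rewrite !inE.
  by rewrite cardsX cardsT cardsC1 -cX addn1.
move=> [g c]; rewrite inE /= => c0; exists [:: g]; first exact/map_f.
move=> sc /covX/(_ c c0)[a [x [asc xX ->]]]; exists g, a, x; split=> //.
  by rewrite mem_head.
by congr (_, _); rewrite ?mul1g // FinRing.zmodMgE addr0.
Qed.

End Scalars.

(* The nonabelian groups and the patterns over them *)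
Local Close Scope group_scope.
Local Open Scope ring_scope.

(* [eis n] is the semidirect product of [(Z/n)[omega]], where [(a, b)] stands
   for [a + b * omega], by the group of order 3 generated by [omega]. *)
Definition eis (n : nat) : Type := ('Z_n * 'Z_n * 'Z_3)%type.
HB.instance Definition _ n := Finite.on (eis n).

Section Eis.
Variable n : nat.
Implicit Types (u w : 'Z_n * 'Z_n) (s t : 'Z_3) (x y z : eis n).

Definition omega u : 'Z_n * 'Z_n := (- u.2, u.1 - u.2).
Definition rot s u := iter s omega u.

Lemma pairB u w : u - w = (u.1 - w.1, u.2 - w.2).
Proof. by []. Qed.

Lemma omegaB u w : omega (u - w) = omega u - omega w.
Proof. by rewrite !pairB /omega /= !opprD !opprK addrACA. Qed.

Lemma omega3 u : omega (omega (omega u)) = u.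
Proof.
case: u => a b; rewrite /omega /=.
have -> : - b - (a - b) = - a by rewrite opprB addrA addNr add0r.
by rewrite opprB !opprK subrK.
Qed.

Lemma rotB s u w : rot s (u - w) = rot s u - rot s w.
Proof. by rewrite /rot; elim: (nat_of_ord s) => //= m ->; apply: omegaB. Qed.

Lemma rot0 s : rot s 0 = 0.
Proof. by have := rotB s 0 0; rewrite !subrr. Qed.

Lemma rotN s u : rot s (- u) = - rot s u.
Proof. by rewrite -sub0r rotB rot0 sub0r. Qed.

Lemma rotD s u w : rot s (u + w) = rot s u + rot s w.
Proof. by rewrite -[in LHS](opprK w) rotB rotN opprK. Qed.

Lemma rot_add s t u : rot (s + t) u = rot s (rot t u).
Proof.
suff iter_mod m : iter (m %% 3)%N omega u = iter m omega u by rewrite /rot -iterD -[RHS]iter_mod.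
by rewrite [in RHS](divn_eq m 3) addnC iterD; elim: (m %/ 3)%N => //= q IHq; rewrite omega3.
Qed.

Definition eis_mul x y : eis n := (x.1 + rot x.2 y.1, x.2 + y.2).
Definition eis_one : eis n := (0, 0).
Definition eis_inv x : eis n := (- rot (- x.2) x.1, - x.2).

Fact eis_mulA : associative eis_mul.
Proof. by move=> x y z; congr (_, _); rewrite /= ?addrA // rotD rot_add addrA. Qed.

Fact eis_mul1 : left_id eis_one eis_mul.
Proof. by move=> [u s]; congr (_, _); rewrite /= ?add0r. Qed.

Fact eis_mulV : left_inverse eis_one eis_inv eis_mul.
Proof. by move=> [u s]; congr (_, _); rewrite /= ?addNr. Qed.

HB.instance Definition _ := Finite_isGroup.Build (eis n) eis_mulA eis_mul1 eis_mulV.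

Lemma card_eis : (1 < n)%N -> #|{: eis n}| = (n ^ 2 * 3)%N.
Proof. by move=> n1; rewrite !card_prod !card_ord Zp_cast // Zp_cast. Qed.
End Eis.

Definition E (n a b s : nat) : eis n := ((inZp a, inZp b), inZp s).
(** For even [n] the involutions of [eis n] are the three nonzero elements of order 2 of the ring,
    and [omega] permutes them cyclically. *)
Definition invol (n : nat) : eis n := E n n./2 0 0.

Definition all_Z n : seq 'Z_n := [seq inZp i | i <- iota 0 (Zp_trunc n).+2].
Lemma all_ZP n (x : 'Z_n) : x \in all_Z n.
Proof. by apply/mapP; exists (val x); rewrite ?mem_iota ?valZpK //=. Qed.

Definition all_eis n : seq (eis n) :=
  [seq (u, s) | u <- [seq (a, b) | a <- all_Z n, b <- all_Z n], s <- all_Z 3].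
Lemma all_eisP n x : x \in all_eis n.
Proof.
by case: x => [[a b] s]; do 2?apply: allpairs_f; rewrite ?all_ZP.
Qed.

Definition dih3 : Type := ('Z_3 * 'Z_2)%type.
HB.instance Definition _ := Finite.on dih3.
Definition dih3_mul (x y : dih3) : dih3 :=
  (x.1 + (if x.2 == 0 then y.1 else - y.1), x.2 + y.2).
Definition dih3_one : dih3 := (0, 0).
Definition dih3_inv (x : dih3) : dih3 := (if x.2 == 0 then - x.1 else x.1, x.2).

Definition all_dih3 : seq dih3 := [seq (a, s) | a <- all_Z 3, s <- all_Z 2].
Lemma all_dih3P x : x \in all_dih3.
Proof. by case: x => a s; apply: allpairs_f; rewrite ?all_ZP. Qed.

Fact dih3_mulA : associative dih3_mul.
Proof.
have /allP ok : all (fun x => all (fun y => all (fun z =>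
  dih3_mul x (dih3_mul y z) == dih3_mul (dih3_mul x y) z) all_dih3) all_dih3) all_dih3.
  by vm_compute.
move=> x y z; have /allP/(_ y (all_dih3P _))/allP/(_ z (all_dih3P _))/eqP := ok x (all_dih3P x).
by [].
Qed.

Fact dih3_mul1 : left_id dih3_one dih3_mul.
Proof. by move=> [a s]; rewrite /dih3_mul /= !add0r. Qed.

Fact dih3_mulV : left_inverse dih3_one dih3_inv dih3_mul.
Proof.
have /allP ok : all (fun x => dih3_mul (dih3_inv x) x == dih3_one) all_dih3 by vm_compute.
by move=> x; apply/eqP/ok/all_dih3P.
Qed.

HB.instance Definition _ := Finite_isGroup.Build dih3 dih3_mulA dih3_mul1 dih3_mulV.

Definition zprod (A B : finZmodType) : Type := (A * B)%type.
HB.instance Definition _ (A B : finZmodType) := GRing.Zmodule.on (zprod A B).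
HB.instance Definition _ (A B : finZmodType) := Finite.on (zprod A B).

Definition tS (z s : nat) (a b : int) : term dih3 := ((a, b), (inZp z, inZp s)).
Definition t2 (a b s : nat) (c d : int) : term (eis 2) := ((c, d), E 2 a b s).
Definition t4 (a b s : nat) (c d : int) : term (eis 4) := ((c, d), E 4 a b s).
Definition t23 (a b z s : nat) (c d : int) : term (eis 2 * 'Z_3) :=
  ((c, d), (E 2 a b s, inZp z)).
Definition t43 (a b z s : nat) (c d : int) : term (eis 4 * 'Z_3) :=
  ((c, d), (E 4 a b s, inZp z)).
Definition t233 (a b y z s : nat) (c d : int) : term (eis 2 * zprod 'Z_3 'Z_3) :=
  ((c, d), (E 2 a b s, (inZp y, inZp z))).

(* Multiplication by [theta] when [theta ^+ 2 + theta + 1 = 0]. *)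
Definition mulw (a : scalar) : scalar := (- a.2, a.1 - a.2).

(* Closes a pattern under left multiplication by the element [h] of order 3,
   combined with multiplication of the scalars by [theta]. *)
Definition rotate (G : finGroupType) (h : G) (p : pattern G) : pattern G :=
  let r (t : term G) := (mulw t.1, (h * t.2)%g) in
  p ++ map (map3 r) p ++ map (map3 (r \o r)) p.

(* The scalars are grouped by orbits of a root of unity: of [theta] with
   [theta ^+ 2 = - 1] in [gauss_scales], of [- theta] with
   [theta ^+ 2 + theta + 1 = 0] in [eis_orbit].  In [quad_scales] the pairs
   [n, - m] represent both cosets of the squares of ['F_p], p = 11 (mod 12). *)
Definition gauss_scales : seq (seq scalar) :=
  [seq [:: c; (- c.2, c.1); (- c.1, - c.2); (c.2, - c.1)]
  | c <- [:: (1, 0); (1, 1); (2, 0)]].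
Definition eis_orbit (c : scalar) : seq scalar :=
  [:: c; (c.2, c.2 - c.1); (c.2 - c.1, - c.1); (- c.1, - c.2);
      (- c.2, c.1 - c.2); (c.1 - c.2, c.1)].
Definition eis_scales : seq (seq scalar) :=
  map eis_orbit [:: (1, 0); (1, -1); (2, 0)].
(** The scalar 2 of [eis_scales] is left out, since doubling is not injective for an even
    modulus. *)
Definition unit_scales : seq (seq scalar) := map eis_orbit [:: (1, 0); (1, -1)].
Definition quad_scales : seq (seq scalar) :=
  [seq [:: (Posz n, 0); (- Posz m, 0)] | n <- [:: 1; 3; 4; 9; 12]%N, m <- [:: 1; 3; 4; 9; 12]%N] ++
  [seq [:: (Posz n, 0); (- Posz m, 0)] | n <- [:: 2; 6; 8]%N, m <- [:: 2; 6; 8]%N].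

Definition singles (T : Type) (l : seq T) := [seq [:: g] | g <- l].
Definition all_23 : seq (eis 2 * 'Z_3) := [seq (g, z) | g <- all_eis 2, z <- all_Z 3].
Definition all_233 : seq (eis 2 * zprod 'Z_3 'Z_3) :=
  [seq (g, z) | g <- all_eis 2, z <- [seq (y, z) | y <- all_Z 3, z <- all_Z 3]].
Definition notw (G : Type) (g : G) (a : scalar) := a.

Definition S3j : dih3 := (0, 1).
(* These patterns were found by computer search.  In the names, [2] and [4]
   stand for [eis 2] and [eis 4], each [3] after them for a factor ['Z_3], and
   the suffix for the kind of scalars. *)
Definition patS3_gauss : pattern dih3 :=
  [::
    (tS 1 0 0 (-1), tS 1 0 0 1, tS 2 0 1 0);
    (tS 2 0 (-1) 0, tS 2 1 0 1, tS 1 1 1 0);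
    (tS 1 0 (-1) 0, tS 0 1 0 (-1), tS 0 0 0 1);
    (tS 0 0 (-1) 0, tS 2 1 0 (-1), tS 0 0 1 0)].

Definition pat2_gauss : pattern (eis 2) :=
  [::
    (t2 1 1 0 (-1) 0, t2 0 1 2 0 1, t2 0 0 0 1 0);
    (t2 0 0 1 (-1) 0, t2 0 0 2 0 (-1), t2 1 0 1 1 0);
    (t2 1 0 2 0 (-1), t2 0 0 2 0 1, t2 0 0 1 1 0);
    (t2 1 1 2 (-1) 0, t2 0 0 0 0 (-1), t2 0 1 0 0 1);
    (t2 1 1 1 (-1) 0, t2 1 1 0 0 (-1), t2 0 0 0 0 1);
    (t2 0 1 2 (-1) 0, t2 0 1 1 0 (-1), t2 0 1 2 1 0);
    (t2 0 0 0 (-1) 0, t2 0 0 1 0 1, t2 0 1 0 1 0);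
    (t2 1 1 1 0 (-1), t2 1 1 1 0 1, t2 1 1 2 1 0)].

Definition pat2_eis : pattern (eis 2) :=
  [::
    (t2 0 0 0 (-1) (-1), t2 0 1 1 (-1) 0, t2 0 0 1 1 1);
    (t2 0 0 1 (-1) (-1), t2 0 1 0 (-1) 0, t2 1 1 1 1 0);
    (t2 1 0 1 (-1) (-1), t2 1 1 2 (-1) 0, t2 1 1 1 0 1);
    (t2 0 0 2 (-1) (-1), t2 1 0 1 (-1) 0, t2 1 0 1 0 (-1))].

Definition pat23_gauss : pattern (eis 2 * 'Z_3) :=
  [::
    (t23 0 1 2 0 (-1) 0, t23 0 1 2 1 0 1, t23 0 1 1 0 1 0);
    (t23 0 0 1 0 (-1) 0, t23 1 1 2 2 0 (-1), t23 0 0 1 1 1 0);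
    (t23 0 1 1 2 (-1) 0, t23 1 1 2 0 0 1, t23 0 1 1 2 1 0);
    (t23 0 1 2 2 (-1) 0, t23 0 1 2 1 0 (-1), t23 0 0 1 0 1 0);
    (t23 1 0 1 1 (-1) 0, t23 1 1 0 1 0 (-1), t23 0 1 2 0 1 0);
    (t23 1 1 2 1 (-1) 0, t23 0 1 0 0 0 (-1), t23 0 1 2 1 1 0);
    (t23 1 1 1 2 (-1) 0, t23 0 1 2 2 0 (-1), t23 1 0 2 1 0 1);
    (t23 0 1 0 0 (-1) 0, t23 1 0 1 1 0 (-1), t23 1 0 1 1 0 1);
    (t23 0 1 1 2 0 (-1), t23 0 1 0 2 0 1, t23 1 1 2 2 1 0);
    (t23 1 1 0 1 (-1) 0, t23 0 0 2 0 0 (-1), t23 1 1 0 0 1 0);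
    (t23 0 1 0 1 (-1) 0, t23 0 0 0 2 0 1, t23 1 0 0 0 1 0);
    (t23 0 0 2 2 (-1) 0, t23 0 1 0 2 0 (-1), t23 0 1 1 2 0 1);
    (t23 1 1 0 2 0 (-1), t23 1 1 0 0 0 1, t23 0 0 0 2 1 0);
    (t23 0 0 0 0 0 (-1), t23 1 0 0 0 0 1, t23 1 0 1 1 1 0);
    (t23 1 1 0 2 (-1) 0, t23 1 0 0 1 0 1, t23 1 1 1 2 1 0);
    (t23 1 1 1 0 (-1) 0, t23 1 0 2 1 0 (-1), t23 0 0 1 2 0 1);
    (t23 0 1 1 1 (-1) 0, t23 0 0 1 1 0 (-1), t23 1 0 2 0 0 1);
    (t23 0 0 2 1 (-1) 0, t23 0 0 1 2 0 (-1), t23 0 1 2 2 1 0);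
    (t23 0 1 0 1 0 (-1), t23 1 1 1 0 0 1, t23 0 0 0 1 1 0);
    (t23 1 0 1 0 0 (-1), t23 0 1 1 1 0 1, t23 1 0 2 1 1 0);
    (t23 0 0 2 0 (-1) 0, t23 1 0 1 0 0 1, t23 0 1 0 2 1 0);
    (t23 0 1 1 0 0 (-1), t23 0 0 0 1 0 1, t23 1 1 0 1 1 0);
    (t23 0 0 0 0 (-1) 0, t23 1 1 2 0 0 (-1), t23 1 1 2 2 0 1);
    (t23 1 0 0 2 (-1) 0, t23 0 1 2 2 0 1, t23 0 0 2 0 1 0)].

Definition pat23_eis : pattern (eis 2 * 'Z_3) :=
  [::
    (t23 0 1 2 2 (-1) (-1), t23 1 0 0 0 (-1) 0, t23 1 0 1 0 0 1);
    (t23 1 0 0 1 (-1) (-1), t23 0 1 1 2 (-1) 0, t23 1 1 2 2 0 1);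
    (t23 0 0 1 1 (-1) (-1), t23 0 0 1 0 0 (-1), t23 1 0 1 0 1 1);
    (t23 0 0 0 1 (-1) (-1), t23 1 1 2 1 (-1) 0, t23 1 1 0 0 1 1);
    (t23 0 1 0 0 (-1) (-1), t23 0 1 1 0 (-1) 0, t23 0 0 0 0 0 1);
    (t23 0 1 1 0 (-1) (-1), t23 1 1 2 0 (-1) 0, t23 0 1 0 2 0 (-1));
    (t23 0 1 2 0 (-1) (-1), t23 1 1 2 1 0 (-1), t23 0 0 2 1 1 1);
    (t23 0 0 0 0 (-1) (-1), t23 0 0 2 2 (-1) 0, t23 0 1 2 1 1 0);
    (t23 0 1 0 2 (-1) (-1), t23 0 1 1 0 0 (-1), t23 0 1 1 1 0 1);
    (t23 1 0 2 1 (-1) (-1), t23 1 1 0 1 (-1) 0, t23 0 0 2 2 1 1);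
    (t23 0 0 2 0 (-1) (-1), t23 1 0 1 0 (-1) 0, t23 0 1 0 1 0 (-1));
    (t23 0 1 1 2 (-1) (-1), t23 0 1 0 1 (-1) 0, t23 0 1 1 2 0 1)].

Definition pat23_quad : pattern (eis 2 * 'Z_3) :=
  [::
    (t23 1 1 2 0 (-1) 0, t23 1 1 2 1 (-3) 0, t23 0 1 1 2 (-9) 0);
    (t23 1 0 2 0 (-1) 0, t23 1 1 0 2 (-3) 0, t23 1 0 2 2 (-4) 0);
    (t23 1 0 0 0 (-1) 0, t23 1 1 1 1 (-3) 0, t23 1 0 1 0 (-9) 0);
    (t23 0 1 0 1 (-3) 0, t23 1 1 0 1 (-4) 0, t23 0 0 1 1 (-12) 0);
    (t23 0 0 2 1 (-1) 0, t23 1 0 1 0 3 0, t23 0 1 1 0 (-9) 0);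
    (t23 0 1 0 0 (-1) 0, t23 1 0 0 2 1 0, t23 1 0 0 2 (-3) 0);
    (t23 1 0 0 1 1 0, t23 1 0 2 0 3 0, t23 1 0 1 1 9 0);
    (t23 1 1 1 2 (-1) 0, t23 0 1 0 1 1 0, t23 0 1 2 2 3 0);
    (t23 1 1 2 1 3 0, t23 1 1 0 2 4 0, t23 0 1 1 1 12 0);
    (t23 1 1 2 2 1 0, t23 0 0 0 0 3 0, t23 1 1 1 0 9 0);
    (t23 0 1 2 1 1 0, t23 0 0 2 2 (-3) 0, t23 0 1 2 0 3 0);
    (t23 0 1 0 0 1 0, t23 0 0 1 2 3 0, t23 0 1 1 2 9 0)].

Definition pat233_quad : pattern (eis 2 * zprod 'Z_3 'Z_3) :=
  [::
    (t233 1 1 0 0 1 1 0, t233 1 1 1 2 0 3 0, t233 0 0 2 1 1 4 0);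
    (t233 1 0 1 2 1 1 0, t233 1 0 1 0 2 3 0, t233 1 1 0 1 1 4 0);
    (t233 0 1 2 2 2 3 0, t233 1 1 2 2 1 4 0, t233 0 0 1 0 0 12 0);
    (t233 1 0 2 1 2 1 0, t233 0 0 0 2 2 3 0, t233 0 0 0 1 0 4 0);
    (t233 1 0 1 1 0 3 0, t233 1 0 0 0 0 4 0, t233 0 0 2 2 2 12 0);
    (t233 1 1 2 1 1 1 0, t233 0 1 1 1 1 3 0, t233 1 0 0 1 2 9 0);
    (t233 0 1 1 1 2 1 0, t233 0 1 2 2 0 3 0, t233 1 0 1 0 1 9 0);
    (t233 1 0 0 2 1 3 0, t233 1 1 2 1 2 4 0, t233 1 1 0 0 0 12 0);
    (t233 0 1 0 2 0 1 0, t233 0 1 0 1 1 3 0, t233 1 1 1 0 2 4 0);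
    (t233 1 1 2 0 1 3 0, t233 0 0 2 0 1 4 0, t233 1 0 1 1 1 12 0);
    (t233 1 0 2 0 1 (-1) 0, t233 0 1 2 1 0 1 0, t233 0 0 0 1 2 3 0);
    (t233 0 0 2 2 2 (-1) 0, t233 0 1 2 0 2 1 0, t233 0 0 0 0 2 3 0);
    (t233 0 0 2 0 0 (-1) 0, t233 0 0 1 2 1 1 0, t233 0 0 2 2 0 3 0);
    (t233 0 0 2 0 2 1 0, t233 1 1 1 1 0 (-3) 0, t233 0 1 2 2 1 3 0);
    (t233 0 1 0 0 2 1 0, t233 0 1 0 2 2 (-3) 0, t233 1 1 1 2 2 3 0);
    (t233 0 1 1 2 2 1 0, t233 0 1 0 2 0 (-3) 0, t233 0 1 0 2 2 3 0);
    (t233 1 0 1 2 0 (-1) 0, t233 0 1 0 1 0 1 0, t233 1 0 1 2 0 3 0);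
    (t233 1 1 2 2 1 (-1) 0, t233 1 0 2 1 0 1 0, t233 1 1 1 1 2 3 0);
    (t233 0 0 1 0 1 1 0, t233 0 0 0 1 1 (-3) 0, t233 0 1 1 1 0 3 0);
    (t233 1 0 1 1 0 (-1) 0, t233 0 1 2 2 1 (-3) 0, t233 0 1 2 0 0 3 0);
    (t233 0 1 0 0 2 (-1) 0, t233 0 0 0 2 0 1 0, t233 1 1 0 0 0 (-3) 0);
    (t233 0 1 0 1 2 (-1) 0, t233 1 0 0 1 0 (-3) 0, t233 0 0 2 0 0 3 0);
    (t233 0 0 2 1 1 (-1) 0, t233 0 0 0 0 0 (-3) 0, t233 0 1 0 2 1 3 0);
    (t233 1 1 2 1 1 (-1) 0, t233 1 1 1 1 1 (-3) 0, t233 1 1 1 0 0 3 0);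
    (t233 0 0 0 0 2 (-1) 0, t233 1 1 0 2 1 (-3) 0, t233 1 0 0 0 1 (-9) 0);
    (t233 0 0 2 2 0 (-3) 0, t233 1 1 0 2 2 (-4) 0, t233 0 1 1 0 0 (-12) 0);
    (t233 1 0 0 1 1 (-1) 0, t233 0 0 1 0 2 (-3) 0, t233 1 0 1 1 2 (-9) 0);
    (t233 0 0 0 0 1 (-1) 0, t233 0 0 1 0 0 (-3) 0, t233 0 1 1 0 2 (-4) 0);
    (t233 0 1 0 2 1 (-1) 0, t233 1 1 2 0 0 (-3) 0, t233 1 0 1 2 1 (-9) 0);
    (t233 0 0 1 1 1 (-1) 0, t233 0 1 2 1 0 (-3) 0, t233 1 0 2 1 2 (-9) 0);
    (t233 0 0 0 2 0 (-1) 0, t233 0 0 2 1 2 (-3) 0, t233 0 0 2 0 1 (-9) 0);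
    (t233 0 0 2 1 0 (-1) 0, t233 0 1 0 1 0 (-3) 0, t233 0 1 1 0 1 (-4) 0);
    (t233 1 1 1 1 2 (-1) 0, t233 1 1 1 0 1 (-3) 0, t233 0 0 0 1 2 (-9) 0);
    (t233 0 1 1 2 1 (-1) 0, t233 0 1 1 2 0 (-3) 0, t233 0 1 0 0 1 3 0);
    (t233 0 1 2 0 2 (-3) 0, t233 0 0 2 0 2 (-4) 0, t233 1 0 2 2 2 (-12) 0);
    (t233 1 1 2 2 0 (-1) 0, t233 1 0 1 2 2 (-3) 0, t233 0 0 1 2 2 (-9) 0)].

Definition pat4_quad : pattern (eis 4) :=
  [::
    (t4 2 0 0 (-1) 0, t4 3 2 1 (-3) 0, t4 2 2 1 (-4) 0);
    (t4 1 2 1 (-3) 0, t4 3 1 0 (-4) 0, t4 2 3 2 (-12) 0);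
    (t4 0 3 2 (-1) 0, t4 3 3 0 (-3) 0, t4 3 2 2 (-9) 0);
    (t4 3 0 2 (-1) 0, t4 1 1 2 (-3) 0, t4 0 2 2 (-9) 0);
    (t4 1 3 2 (-1) 0, t4 1 0 0 (-3) 0, t4 2 2 2 (-9) 0);
    (t4 3 1 1 (-1) 0, t4 1 3 0 3 0, t4 1 3 1 (-9) 0);
    (t4 2 3 0 (-1) 0, t4 0 1 1 1 0, t4 0 1 1 (-3) 0);
    (t4 1 0 1 1 0, t4 1 2 0 (-3) 0, t4 0 1 0 3 0);
    (t4 1 0 2 1 0, t4 1 1 2 3 0, t4 1 1 0 9 0);
    (t4 0 2 0 (-1) 0, t4 0 0 0 1 0, t4 0 3 2 3 0);
    (t4 0 0 1 3 0, t4 1 0 0 4 0, t4 0 0 2 12 0);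
    (t4 3 0 2 1 0, t4 2 1 1 (-3) 0, t4 0 2 2 3 0);
    (t4 0 1 0 (-1) 0, t4 0 1 2 1 0, t4 0 2 1 (-3) 0);
    (t4 0 2 0 3 0, t4 3 2 0 4 0, t4 2 3 1 12 0);
    (t4 2 3 0 1 0, t4 2 2 1 3 0, t4 1 3 2 9 0);
    (t4 1 3 1 1 0, t4 3 0 1 3 0, t4 3 3 1 9 0)].

Definition pat2_unit : pattern (eis 2) :=
  [::
    (t2 0 1 0 0 (-1), t2 0 0 0 (-1) 0, t2 0 1 0 1 1);
    (t2 0 0 0 0 (-1), t2 0 1 1 (-1) 0, t2 1 0 2 1 1);
    (t2 0 0 0 1 0, t2 0 1 1 (-1) (-1), t2 0 0 2 0 1);
    (t2 0 1 0 1 0, t2 0 1 2 0 1, t2 1 1 0 0 1)].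

Definition pat23_unit : pattern (eis 2 * 'Z_3) :=
  [::
    (t23 0 1 0 0 1 0, t23 0 0 0 1 (-1) (-1), t23 1 0 1 1 1 0);
    (t23 0 0 0 0 1 0, t23 1 0 0 1 (-1) (-1), t23 1 1 2 0 (-1) (-1));
    (t23 0 1 2 0 1 0, t23 0 0 2 0 0 1, t23 0 0 2 1 1 0);
    (t23 0 0 2 0 1 0, t23 0 0 1 1 (-1) (-1), t23 1 0 0 2 0 1);
    (t23 0 0 1 0 1 0, t23 0 0 0 1 1 0, t23 0 1 2 2 1 0);
    (t23 0 1 1 0 0 (-1), t23 0 1 2 1 0 (-1), t23 0 1 0 0 1 1);
    (t23 0 0 1 0 0 (-1), t23 0 0 0 0 (-1) 0, t23 0 1 1 0 1 1);
    (t23 0 1 2 0 0 (-1), t23 0 0 2 1 (-1) 0, t23 1 1 0 1 0 (-1));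
    (t23 0 0 2 0 0 (-1), t23 0 1 0 1 (-1) 0, t23 1 1 1 1 0 (-1));
    (t23 0 0 0 0 0 (-1), t23 0 1 2 0 (-1) 0, t23 1 0 2 2 0 (-1));
    (t23 0 1 0 0 0 (-1), t23 0 0 1 1 (-1) 0, t23 0 0 1 1 0 (-1));
    (t23 0 1 1 0 1 0, t23 0 0 1 0 (-1) (-1), t23 1 0 1 1 (-1) (-1))].

Definition base2 : pattern (eis 2) :=
  [::
    (t2 0 1 0 0 0, t2 0 1 1 0 0, t2 0 0 2 0 0)].

Definition base23 : pattern (eis 2 * 'Z_3) :=
  [::
    (t23 0 1 1 0 0 0, t23 0 0 1 1 0 0, t23 1 0 2 1 0 0);
    (t23 0 1 0 0 0 0, t23 1 0 1 2 0 0, t23 1 1 2 2 0 0);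
    (t23 0 0 1 0 0 0, t23 1 1 2 0 0 0, t23 0 0 0 2 0 0);
    (t23 0 0 2 0 0 0, t23 1 0 1 1 0 0, t23 1 1 1 2 0 0);
    (t23 0 0 0 1 0 0, t23 0 0 2 1 0 0, t23 0 1 2 2 0 0)].

Definition pat4_hole : pattern (eis 4) :=
  [::
    (t4 0 3 0 0 0, t4 1 1 2 0 0, t4 2 3 2 0 0);
    (t4 0 1 0 0 0, t4 1 2 0 0 0, t4 2 1 2 0 0)].

Definition pat43_hole : pattern (eis 4 * 'Z_3) :=
  [::
    (t43 0 3 0 0 0 0, t43 1 0 2 0 0 0, t43 1 1 1 0 0 0);
    (t43 0 3 2 0 0 0, t43 2 1 0 2 0 0, t43 3 0 0 0 0 0);
    (t43 0 1 0 0 0 0, t43 1 2 0 1 0 0, t43 1 3 2 2 0 0);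
    (t43 0 3 1 0 0 0, t43 1 0 2 1 0 0, t43 1 3 0 2 0 0);
    (t43 0 1 1 0 0 0, t43 1 0 1 0 0 0, t43 2 3 1 2 0 0);
    (t43 0 1 2 0 0 0, t43 2 1 1 1 0 0, t43 3 1 2 0 0 0)].

Definition twist2 (g : eis 2) (a : scalar) := iter g.2 mulw a.
Definition twist23 (g : eis 2 * 'Z_3) (a : scalar) := iter g.1.2 mulw a.
(** [eis 2] will sit in a larger [eis] with its ring part as the 2-torsion, and scalar multiples
    will be known only up to that torsion. Hence the four elements with a common rotation form one
    class. *)
Definition layers2 : seq (seq (eis 2)) :=
  [seq [seq (u, s) | u <- [seq (a, b) | a <- all_Z 2, b <- all_Z 2]] | s <- all_Z 3].
Definition layers23 : seq (seq (eis 2 * 'Z_3)) :=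
  [seq [seq (g, z) | g <- l] | l <- layers2, z <- all_Z 3].
Definition even_eis n (g : eis n) := ~~ odd g.1.1 && ~~ odd g.1.2.

(** * Transversals for scalars *)

Lemma surj_of_inj (C : finType) (f : C -> C) : injective f -> forall z, exists x, f x = z.
Proof. by move=> fI z; exists (invF fI z); rewrite f_invF. Qed.

Section Additive.
Variables (C C' : zmodType) (f : C -> C').
Hypothesis fD : {morph f : x y / x + y}.

Lemma morph_add0 : f 0 = 0.
Proof. by apply: (addrI (f 0)); rewrite -fD !addr0. Qed.

Lemma morph_addN x : f (- x) = - f x.
Proof. by apply: (addrI (f x)); rewrite -fD !subrr morph_add0. Qed.

Lemma morph_addB x y : f (x - y) = f x - f y.
Proof. by rewrite fD morph_addN. Qed.

Lemma morph_add_inj : (forall x, f x = 0 -> x = 0) -> injective f.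
Proof.
by move=> f0 x y e; apply/subr0_eq/f0; rewrite morph_addB e subrr.
Qed.
End Additive.

Lemma card_nonzero (C : finZmodType) : (#|[set~ (0%R : C)]| + 1 = #|C|)%N.
Proof. by rewrite cardsC1 addn1 prednK //; apply/card_gt0P; exists 0. Qed.

(** A finite module of odd order over the Gaussian integers. The next definition is its analogue
    over the Eisenstein integers, with order prime to 6. *)
Definition gauss_group (C : finZmodType) := exists theta : C -> C,
  [/\ {morph theta : x y / x + y}, forall x, theta (theta x) = - x
    & injective (fun x : C => x + x)].

Definition eis_group (C : finZmodType) := exists theta : C -> C,
  [/\ {morph theta : x y / x + y}, forall x, theta (theta x) = - x - theta x,
      injective (fun x : C => x + x) & injective (fun x : C => x + x + x)].

Section Covers.
Variable C : finZmodType.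

Lemma double_eq0 : injective (fun x : C => x + x) -> forall x : C, x = - x -> x = 0.
Proof. by move=> dI x e; apply: dI; rewrite {1}e addNr addr0. Qed.

Lemma evals_morph (theta : C -> C) a : {morph theta : x y / x + y} ->
  {morph evals theta a : x y / x + y}.
Proof. by move=> tD x y; rewrite /evals tD !mulrzDl addrACA. Qed.

(** Each list consists of one invertible scalar [a] times the powers of [f]. Writing [c] as [a]
    times [c'] and [c'] as a power of [f] applied to a representative expresses [c] by a member of
    the list. *)
Lemma orbit_cover (theta f : C -> C) (D : {set C}) d (scs : seq (seq scalar)) :
    injective f -> (0 < d)%N -> (forall x, x \in D -> f x \in D) ->
    (forall x, iter d f x = x) ->
    (forall (x : C) e, x \in D -> (0 < e < d)%N -> iter e f x <> x) ->
    (forall sc, sc \in scs -> exists a, [/\ injective (evals theta a),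
         forall x, evals theta a x \in D -> x \in D
       & forall e x, (e < d)%N ->
           exists2 b, b \in sc & evals theta b x = evals theta a (iter e f x)]) ->
  exists Xs : {set C}, (#|Xs| * d = #|D|)%N /\
    forall sc, sc \in scs -> forall c, c \in D ->
      exists a x, [/\ a \in sc, x \in Xs & c = evals theta a x].
Proof.
move=> fI d0 fD fd free cov.
have [Xs [cX covX]] := orbit_transversal fI d0 fD (fun x _ => fd x) free.
exists Xs; split=> // sc /cov[a [aI aD asc]] c cD; have [c' ec] := surj_of_inj aI c.
have [|x xX [e lt_ed ec']] := covX c'; first by rewrite aD ?ec.
have [b bsc eb] := asc e x lt_ed.
by exists b, x; split=> //; rewrite eb -ec' ec.
Qed.

Lemma orbit_scale_cover (theta : C -> C) d (Xs : {set C}) (scs : seq (seq scalar)) :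
    (#|Xs| * d = #|[set~ (0%R : C)]|)%N ->
    (forall sc, sc \in scs -> forall c, c \in [set~ (0 : C)] ->
      exists a x, [/\ a \in sc, x \in Xs & c = evals theta a x]) ->
  scale_cover theta d Xs scs.
Proof.
move=> cX covX; split=> [|sc /covX cov c c0]; first by rewrite cX card_nonzero.
by apply: cov; rewrite !inE.
Qed.

(** The scalars 1, [1 + theta] and 2 have norms 1, 2 and 4, so they are injective in odd order;
    [theta] acts freely with order 4 on nonzero elements. *)
Lemma gauss_cover : gauss_group C ->
  exists theta Xs, scale_cover (theta : C -> C) 4 Xs gauss_scales.
Proof.
case=> t [tD tt dI]; have d0 := double_eq0 dI; exists t.
have t0 := morph_add0 tD; have tN := morph_addN tD.
have tI : injective t.
  apply: morph_add_inj => // x e; have := tt x; rewrite e t0 => /esym/eqP.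
  by rewrite oppr_eq0 => /eqP.
have tx x : t x = - x -> x = 0.
  by move=> e; apply: d0; rewrite -tt e tN e opprK.
have tx' x : - t x = x -> x = 0 by move=> e; apply: tx; rewrite -[in RHS]e opprK.
have zn x : x \in [set~ (0 : C)] -> t x \in [set~ (0 : C)].
  by rewrite !inE; apply: contraNneq => e; apply/eqP/tI; rewrite e t0.
have [x|x e|sc scs|Xs [cX covX]] :=
    @orbit_cover t t [set~ 0] 4 gauss_scales tI isT zn; last first.
- by exists Xs; apply: orbit_scale_cover.
- case/mapP: scs => -[m n] mn ->; exists (m, n); split.
  + apply: (morph_add_inj (evals_morph _ tD)) => x; rewrite /evals /=.
    move: mn; rewrite !inE => /or3P[] /eqP[-> ->]; rewrite ?mulr1z ?mulr0z ?addr0 //.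
      by move=> e; apply: tx; apply/eqP; rewrite -addr_eq0 addrC e.
    by move=> e; apply: dI; rewrite addr0.
  + move=> x; rewrite !inE; apply: contraNneq => ->.
    by rewrite /evals /= t0 !mul0rz addr0.
  + move=> e x; rewrite /evals /=.
    case: e => [|[|[|[|e]]]] //= _.
    * by exists (m, n); rewrite ?mem_head.
    * by exists (- n, m); rewrite ?inE ?eqxx ?orbT //= tt mulrNz mulNrz addrC.
    * by exists (- m, - n); rewrite ?inE ?eqxx ?orbT //= tt tN !mulrNz !mulNrz.
    * exists (n, - m); rewrite ?inE ?eqxx ?orbT //=.
      by rewrite [t (t (t x))]tt tN tt opprK mulrNz mulNrz addrC.
- rewrite inE => x0; have {x0}nx : x <> - x by move/d0 => e0; rewrite e0 inE eqxx in x0.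
  case: e => [|[|[|[|e]]]] //= _; rewrite ?tt => ex; apply: nx.
  + by rewrite -tt !ex.
  + by rewrite ex.
  + by rewrite (tx' x ex) oppr0.
- by rewrite /= !tt opprK.
Qed.

Section EisOrbits.
Variable t : C -> C.
Hypotheses (tD : {morph t : x y / x + y}) (tt : forall x, t (t x) = - x - t x).
Let t0 := morph_add0 tD.
Let tN := morph_addN tD.

Lemma eis_cube x : t (t (t x)) = x.
Proof. by rewrite !tt opprD !opprK addrC addrK. Qed.

Lemma eis_fixed x : t x = x -> x + x + x = 0.
Proof.
move=> e; have := tt x; rewrite !e => ex.
by rewrite -addrA; apply/eqP; rewrite addr_eq0 opprD -ex.
Qed.

(** [- theta] has order 6. Freeness of its proper powers reduces to the absence in [D] of points
    with [x = - x] or [t x = x]; stating it for a subset [D] lets it apply to rings of even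
    order. *)
Lemma eis_orbit_cover (D : {set C}) (rs : seq scalar) :
    (forall x, x \in D -> t x \in D) -> (forall x, x \in D -> - x \in D) ->
    (forall x, x \in D -> x <> - x) -> (forall x, x \in D -> t x <> x) ->
    (forall r, r \in rs -> injective (evals t r) /\
       forall x, evals t r x \in D -> x \in D) ->
  exists Xs : {set C}, (#|Xs| * 6 = #|D|)%N /\
    forall sc, sc \in map eis_orbit rs -> forall c, c \in D ->
      exists a x, [/\ a \in sc, x \in Xs & c = evals t a x].
Proof.
move=> tDD nDD nx nt rsP; pose f x := - t x.
have tI : injective t by move=> x y e; rewrite -(eis_cube x) e eis_cube.
have f2 x : f (f x) = t (t x) by rewrite /f tN opprK.
have f3 x : f (f (f x)) = - x by rewrite f2 /f !tN eis_cube.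
apply: (@orbit_cover t f) => //.
- by move=> x y /oppr_inj/tI.
- by move=> x xD; apply/nDD/tDD.
- by move=> x; rewrite /= f3 f3 opprK.
- move=> x e xD; case: e => [|[|[|[|[|[|e]]]]]] //= _ ex.
  + by apply: (nx x xD); rewrite -f3 !ex.
  + by apply: (nt x xD); rewrite -{1}ex f2 eis_cube.
  + by apply: (nx x xD); rewrite -f3 ex.
  + by apply: (nt x xD); move: ex; rewrite f3 /f opprK.
  + apply: (nx x xD); move: ex; rewrite f3 f2 => ex.
    have /esym/eqP := tt x; rewrite -[t (t x)]opprK ex -subr_eq0 opprK addrAC addNr.
    by rewrite sub0r oppr_eq0 => /eqP tx0; rewrite -(eis_cube x) tx0 !t0 oppr0.
move=> sc /mapP[[m n] /rsP[rI rD] ->]; exists (m, n); split=> // e x.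
rewrite /evals /=.
have step (p q : int) (y : C) : f y *~ p + t (f y) *~ q = y *~ q + t y *~ (q - p).
  by rewrite /f tN tt opprD !opprK mulrzBr mulrzDl mulNrz addrC -addrA.
have h1 : n - m - n = - m by rewrite addrAC subrr sub0r.
have h2 : - m - (n - m) = - n by rewrite opprB addKr.
have h3 : - n - - m = m - n by rewrite opprK addrC.
have h4 : m - n - - n = m by rewrite opprK subrK.
case: e => [|[|[|[|[|[|e]]]]]] //= _; rewrite ?step ?h1 ?h2 ?h3 ?h4.
- by exists (m, n); rewrite ?mem_head.
- by exists (n, n - m); rewrite ?inE ?eqxx ?orbT.
- by exists (n - m, - m); rewrite ?inE ?eqxx ?orbT.
- by exists (- m, - n); rewrite ?inE ?eqxx ?orbT.
- by exists (- n, m - n); rewrite ?inE ?eqxx ?orbT.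
- by exists (m - n, m); rewrite ?inE ?eqxx ?orbT.
Qed.

Lemma evals_one_inj : injective (evals t (1, 0)).
Proof. by move=> x y; rewrite /evals /= !mulr1z !mulr0z !addr0. Qed.

(** [1 - theta] has norm 3: an element it kills is fixed by [theta], hence killed by 3. *)
Lemma evals_lambda_inj : injective (fun x : C => x + x + x) -> injective (evals t (1, -1)).
Proof.
move=> cI; apply: (morph_add_inj (evals_morph _ tD)) => x; rewrite /evals /= mulr1z.
move/eqP; rewrite mulrN1z subr_eq0 eq_sym => /eqP/eis_fixed e.
by apply: cI; rewrite e !addr0.
Qed.

Lemma evals_reflect0 r x : evals t r x != 0 -> x != 0.
Proof. by apply: contraNneq => ->; rewrite /evals t0 !mul0rz addr0. Qed.
End EisOrbits.

Lemma eis_cover : eis_group C ->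
  exists theta Xs, scale_cover (theta : C -> C) 6 Xs eis_scales.
Proof.
case=> t [tD tt dI cI]; have d0 := double_eq0 dI; exists t.
have t0 := morph_add0 tD.
have [x|x|x|x|r rs|Xs [cX covX]] :=
    @eis_orbit_cover t tD tt [set~ 0] [:: (1, 0); (1, -1); (2, 0)]; last first.
- by exists Xs; apply: orbit_scale_cover.
- split; last by move=> x; rewrite !inE; apply: evals_reflect0.
  move: rs; rewrite !inE => /or3P[] /eqP->.
  + exact: evals_one_inj.
  + exact: evals_lambda_inj.
  + by move=> x y; rewrite /evals /= !mulr0z !addr0 => /dI.
- rewrite !inE => x0 /(eis_fixed tt) e; move/eqP: x0; apply.
  by apply: cI; rewrite e !addr0.
- by rewrite !inE => /eqP x0 /d0.
- by rewrite !inE oppr_eq0.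
- by rewrite !inE; apply: contraNneq => e; rewrite -(eis_cube tt x) e !t0.
Qed.
End Covers.

Lemma natr_Fp_neq0 (p n : nat) : prime p -> (0 < n < p)%N -> n%:R != 0 :> 'F_p.
Proof.
move=> p_pr /andP[n0 np]; rewrite -(dvdn_pcharf (pchar_Fp p_pr)).
by apply/negP => /dvdn_leq-/(_ n0); rewrite leqNgt np.
Qed.

Lemma Fp_expf_pred (p : nat) (x : 'F_p) : prime p -> x != 0 -> x ^+ p.-1 = 1.
Proof.
move=> p_pr x0; apply: (mulfI x0); rewrite -exprS mulr1 prednK ?prime_gt0 //.
by have := expf_card x; rewrite card_Fp.
Qed.

(* When p = 11 (mod 12), -1 is a nonresidue and 3 a residue, so translating by
   the powers of -1 and 3 permutes the cosets of the squares in a known way. *)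
Lemma quad_cover (p : nat) : prime p -> (p %% 12 = 11)%N ->
  exists theta Xs, scale_cover (theta : 'F_p -> 'F_p) 2 Xs quad_scales.
Proof.
move=> p_pr p11; pose h := (p %/ 12 * 6 + 5)%N.
have pE : p = (h * 2).+1 by lia.
have h_odd : h = (p %/ 12 * 3 + 2).*2.+1 by lia.
have expN (x : 'F_p) : (- x) ^+ h = - x ^+ h.
  by rewrite -mulN1r exprMn -signr_odd h_odd oddS odd_double mulN1r.
have exp_pm (x : 'F_p) : x != 0 -> x ^+ h = 1 \/ x ^+ h = - 1.
  move=> /(Fp_expf_pred p_pr); rewrite [p in _ ^+ p.-1]pE exprM => /eqP.
  by rewrite sqrf_eq1 => /orP[] /eqP; [left | right].
have nz n : (0 < n < 11)%N -> n%:R != 0 :> 'F_p.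
  by move=> /andP[n0 n11]; apply: natr_Fp_neq0; rewrite // n0 (leq_trans n11) //; lia.
have neg1 : -1 != 1 :> 'F_p.
  rewrite -subr_eq0 -opprD oppr_eq0 -[1 + 1]/(2%:R); exact: nz.
have e3 : 3%:R ^+ h = 1 :> 'F_p.
  case: (exp_pm 3%:R); rewrite ?nz // => e.
  have {}e : (- 3%:R) ^+ h = 1 :> 'F_p by rewrite expN e opprK.
  (* If 3 were a nonresidue, -3 would be a square, here with root [y], and [(y - 1) / 2] a cube root
     of unity. As p - 1 is 1 modulo 3 that root is 1, so y = 3 and 12 = 0, which is impossible. *)
  pose y : 'F_p := (- 3%:R) ^+ (p %/ 12 * 3 + 3).
  have y2 : y ^+ 2 = - 3%:R.
    rewrite -exprM (_ : (_ * 2)%N = h.+1); last by lia.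
    by rewrite exprS e mulr1.
  pose w : 'F_p := (y - 1) / 2%:R.
  have w3 : w ^+ 3 = 1.
    have y3 : (y - 1) ^+ 3 = 8%:R.
      have -> : (y - 1) ^+ 3 = y ^+ 2 * (y - 3%:R) + 3%:R * y - 1 by ring.
      by rewrite y2; ring.
    rewrite expr_div_n y3 -natrX divff //; exact: nz.
  have w0 : w != 0.
    by apply/eqP => ew; move/eqP: w3; rewrite ew expr0n eq_sym oner_eq0.
  have w1 : w = 1.
    have := Fp_expf_pred p_pr w0.
    by rewrite (_ : p.-1 = (3 * (p %/ 12 * 4 + 3)).+1)%N; [rewrite exprS exprM w3 expr1n mulr1 | lia].
  have yw : y = 3%:R.
    have : y = w * 2%:R + 1 by rewrite /w mulfVK ?nz // subrK.
    by rewrite w1 => ->; ring.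
  have /eqP : 12%:R = 0 :> 'F_p.
    have : y ^+ 2 + 3%:R = 0 by rewrite y2 addNr.
    by rewrite yw -natrX -natrD.
  by rewrite (_ : 12 = 3 * 4)%N // natrM mulf_eq0 !(negPf (nz _ _)).
have zero_exp : 0 ^+ h = 0 :> 'F_p by rewrite expr0n h_odd.
(* The nonzero squares, by Euler's criterion. *)
pose Xs : {set 'F_p} := [set x | x ^+ h == 1].
have cX : #|~: Xs| = (#|Xs|.+1)%N.
  have -> : ~: Xs = 0 |: [set - x | x in Xs].
    apply/setP => x; rewrite !inE; have [->|x0] := eqVneq x 0.
      by rewrite zero_exp eq_sym oner_eq0.
    apply/idP/imsetP => [xh|[z]]; last first.
      by rewrite inE => /eqP zh ->; rewrite expN zh.
    exists (- x); rewrite ?opprK // inE expN.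
    by case: (exp_pm _ x0) xh => ->; rewrite ?eqxx // opprK.
  rewrite cardsU1 card_imset; last exact: oppr_inj.
  case: imsetP => // -[z]; rewrite inE => /eqP zh /esym/eqP; rewrite oppr_eq0 => /eqP z0.
  by move: zh; rewrite z0 zero_exp => /eqP; rewrite eq_sym oner_eq0.
exists (fun _ => 0), Xs; split.
  by rewrite -(cardsC Xs) cX muln2 -addnn addn1 addnS.
have sqr_num n : n \in [:: 1; 3; 4; 9; 12]%N -> n%:R != 0 :> 'F_p /\ n%:R ^+ h = 1 :> 'F_p.
  have e1 : 1%:R != 0 :> 'F_p /\ 1%:R ^+ h = 1 :> 'F_p by rewrite oner_neq0 expr1n.
  have e3' : 3%:R != 0 :> 'F_p /\ 3%:R ^+ h = 1 :> 'F_p by rewrite nz.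
  have e4 : 4%:R != 0 :> 'F_p /\ 4%:R ^+ h = 1 :> 'F_p.
    split; first exact: nz.
    rewrite (_ : 4 = 2 ^ 2)%N // natrX -exprM mulnC (_ : (h * 2)%N = p.-1); last by rewrite [in RHS]pE.
    by apply: Fp_expf_pred => //; apply: nz.
  have eM a b : a%:R != 0 :> 'F_p /\ a%:R ^+ h = 1 :> 'F_p ->
      b%:R != 0 :> 'F_p /\ b%:R ^+ h = 1 :> 'F_p ->
      (a * b)%:R != 0 :> 'F_p /\ (a * b)%:R ^+ h = 1 :> 'F_p.
    by move=> [a0 ah] [b0 bh]; rewrite natrM mulf_neq0 // exprMn ah bh mulr1.
  rewrite !inE => /or4P[/eqP->|/eqP->|/eqP->|/orP[]/eqP->] //.
    exact: (eM 3 3).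
  exact: (eM 3 4).
have cov (r c : 'F_p) n m : r != 0 -> c != 0 -> n \in [:: 1; 3; 4; 9; 12]%N ->
    m \in [:: 1; 3; 4; 9; 12]%N ->
    exists2 x, x \in Xs & c = r * n%:R * x \/ c = - (r * m%:R) * x.
  move=> r0 c0 /sqr_num[n0 nh] /sqr_num[m0 mh].
  have cr : c / r != 0 by rewrite mulf_neq0 ?invr_eq0.
  case: (exp_pm _ cr) => e.
    exists (c / r / n%:R); first by rewrite inE expr_div_n e nh divr1.
    by left; field; rewrite r0 n0.
  exists (- (c / r) / m%:R); first by rewrite inE expr_div_n expN e opprK mh divr1.
  by right; field; rewrite r0 m0.
move=> sc; rewrite mem_cat => scs c c0.
case/orP: scs => /allpairsP[[n m] /= [nin min ->]].
  have [x xX cx] := cov 1 c n m (oner_neq0 _) c0 nin min.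
  case: cx => ->; [exists (Posz n, 0), x | exists (- Posz m, 0), x]; split=> //;
    rewrite ?mem_head ?inE ?eqxx ?orbT // /evals /= addr0 mul1r ?mulNr ?mulrNz -pmulrn mulr_natl //.
have [x xX cx] : exists2 x, x \in Xs & c = n%:R * x \/ c = - m%:R * x.
  (* The numbers 2, 6, 8 are twice the squares 1, 3, 4, so they share a coset of the squares whether
     or not 2 is a square. *)
  have half k : k \in [:: 2; 6; 8]%N -> exists2 k', k' \in [:: 1; 3; 4; 9; 12]%N & k%:R = 2%:R * k'%:R :> 'F_p.
    rewrite !inE => /or3P[] /eqP->; [exists 1%N|exists 3%N|exists 4%N]; by rewrite -?natrM.
  have [n' n'in ->] := half n nin; have [m' m'in ->] := half m min.
  by apply: cov => //; apply: nz.
case: cx => ->; [exists (Posz n, 0), x | exists (- Posz m, 0), x]; split=> //;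
  rewrite ?mem_head ?inE ?eqxx ?orbT // /evals /= addr0 ?mulNr ?mulrNz -pmulrn mulr_natl //.
Qed.

(** * Adjoining an abelian factor *)

(** Take [T] to be [theta]: both [theta + 1] and [theta - 1] have norm 2. *)
Lemma dm_gauss C : gauss_group C -> dm_group C.
Proof.
case=> t [tD tt dI]; have d0 := double_eq0 dI; exists t.
have t0 := morph_add0 tD; have tN := morph_addN tD.
have pm x : t x = x \/ t x = - x -> x = 0.
  by case=> e; apply: d0; rewrite -tt !e // tN e opprK.
split=> //.
- apply: morph_add_inj => // x e; have := tt x; rewrite e t0 => /esym/eqP.
  by rewrite oppr_eq0 => /eqP.
- apply: morph_add_inj => [x y|x /eqP]; first by rewrite tD addrACA.
  by rewrite addr_eq0 => /eqP e; apply: pm; right.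
- apply: morph_add_inj => [x y|x /eqP]; first by rewrite tD opprD addrACA.
  by rewrite subr_eq0 => /eqP e; apply: pm; left.
Qed.

(** With [T] equal to doubling, [T + 1] is tripling and [T - 1] the identity. *)
Lemma dm_double (C : finZmodType) : injective (fun x : C => x + x) ->
  injective (fun x : C => x + x + x) -> dm_group C.
Proof.
move=> dI cI; exists (fun x => x + x); split=> //.
  by move=> x y; rewrite addrACA.
by move=> x y; rewrite !addrK.
Qed.

Lemma dm_zprod C D : dm_group C -> dm_group D -> dm_group (zprod C D).
Proof.
have pairI (f : C -> C) (g : D -> D) : injective f -> injective g ->
    injective (fun x : C * D => (f x.1, g x.2)).
  by move=> fI gI [a b] [c d] [] /fI-> /gI->.
move=> [s [sD sI spI smI dI]] [t [tD tI tpI tmI eI]].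
exists (fun x : C * D => (s x.1, t x.2)); split.
- by move=> [a b] [c d]; congr (_, _); rewrite /= ?sD ?tD.
- exact: pairI.
- exact: (pairI _ _ spI tpI).
- exact: (pairI _ _ smI tmI).
- exact: (pairI _ _ dI eI).
Qed.

(** Two copies of [C] form its extension by a square root of -1. This makes the square of every odd
    prime available as a factor, 9 included. *)
Lemma gauss_zprod (C : finZmodType) : injective (fun x : C => x + x) ->
  gauss_group (zprod C C).
Proof.
move=> dI; exists (fun x : C * C => (- x.2, x.1)); split.
- by move=> [a b] [c d]; congr (_, _); rewrite /= opprD.
- by move=> [a b].
- by move=> [a b] [c d] [] /dI-> /dI->.
Qed.

Lemma dm_trivial : dm_group 'I_1.
Proof. by exists id; split=> // x y _; rewrite !ord1. Qed.

Section Steps.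
Variables (G0 : finGroupType) (j : G0).
Local Open Scope group_scope.

(** The difference matrix over [D] is kept because adjoining a further [C] spreads a family for
    [G0 * C] over [D]. *)
Definition adm (D : finZmodType) :=
  dm_group D /\ has_pyramidal_family ((j, 0%R) : G0 * D).

Lemma linear_family_dm (D C : finZmodType) : dm_group D ->
  has_linear_family j C -> has_linear_family ((j, 0%R) : G0 * D) C.
Proof.
move=> dmD /(relative_family_dm dmD) fam.
pose f (x : G0 * C * D) : G0 * D * C := (x.1.1, x.2, x.1.2).
have := relative_family_transport (f := f) _ _ fam.
case=> [//|[[a b] c] [[a' b'] c'] [-> -> ->] //|F].
rewrite (_ : f @: _ = [set x | x.2 != 0%R]); first by exists F.
apply/setP => -[[a c] b]; rewrite inE /=; apply/imsetP/idP => [[[[a' b'] c']]|nz].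
  by rewrite !inE /= => nz [_ _ ->].
by exists (a, b, c); rewrite ?inE.
Qed.

Lemma adm_step (D C : finZmodType) : adm D -> dm_group C ->
  has_linear_family j C -> adm (zprod D C).
Proof.
move=> [dmD famD] dmC linC; split; first exact: dm_zprod.
pose f (x : G0 * D * C) : G0 * zprod D C := (x.1.1, (x.1.2, x.2)).
apply: (@pyramidal_family_extend _ _ (fun x : G0 * D => (x.1, (x.2, 0%R)) : G0 * zprod D C)) famD _.
- by move=> [a b] [c d]; congr (_, (_, _)); rewrite /= FinRing.zmodMgE addr0.
- by move=> [a b] [c d] [-> ->].
have := relative_family_transport (f := f) _ _ (linear_family_dm dmD linC).
case=> [//|[[a b] c] [[a' b'] c'] [-> -> ->] //|F].
rewrite (_ : f @: _ = ~: ((fun x : G0 * D => (x.1, (x.2, 0%R)) : G0 * zprod D C) @: setT)).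
  by exists F.
apply/setP => -[a [b c]]; rewrite !inE; apply/imsetP/idP => [[[[a' b'] c']]|nz].
  rewrite !inE /= => nz [-> -> ->]; apply: contra nz => /imsetP[[u w] _ [_ _ ->]] //.
exists (a, b, c); rewrite ?inE //=; apply: contraNneq nz => ->.
by apply/imsetP; exists (a, b).
Qed.

End Steps.

Lemma adm_extend (G' G : finGroupType) (f : G' -> G) (j : G') (C : finZmodType) :
    {morph f : x y / (x * y)%g} -> injective f ->
    has_relative_family (f j) (~: (f @: setT)) ->
  adm j C -> adm (f j) C.
Proof.
move=> fM fI fam [dmC famC]; split=> //.
apply: (@pyramidal_family_extend _ _ (fun x : G' * C => (f x.1, x.2) : G * C)) famC _.
- by move=> [a b] [c d]; congr (_, _); apply: fM.
- by move=> [a b] [c d] [/fI-> ->].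
have := relative_family_dm dmC fam.
rewrite (_ : [set x : G * C | _] = ~: ((fun x : G' * C => (f x.1, x.2) : G * C) @: setT)) //.
apply/setP => -[a b]; rewrite !inE /=; congr (~~ _).
apply/imsetP/imsetP => [[x _ ->]|[[x y] _ [-> _]]]; first by exists (x, b).
by exists x.
Qed.

Lemma all_23P x : x \in all_23.
Proof. by case: x => g z; apply: allpairs_f; rewrite ?all_eisP ?all_ZP. Qed.

Lemma all_233P x : x \in all_233.
Proof.
by case: x => g [y z]; do 2?apply: allpairs_f; rewrite ?all_eisP ?all_ZP.
Qed.

Lemma card_23 : #|{: eis 2 * 'Z_3}| = 36%N.
Proof. by rewrite card_prod card_eis // card_ord. Qed.

Lemma card_233 : #|{: eis 2 * zprod 'Z_3 'Z_3}| = 108%N.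
Proof. by rewrite card_prod card_eis // !card_prod !card_ord. Qed.

Lemma linear_dih3_gauss C : gauss_group C -> has_linear_family S3j C.
Proof.
case/gauss_cover => t [Xs cov].
apply: (linear_family_of_pattern (p := patS3_gauss) cov all_dih3P); last by vm_compute.
by rewrite card_prod !card_ord.
Qed.

Lemma linear_2_gauss C : gauss_group C -> has_linear_family (invol 2) C.
Proof.
case/gauss_cover => t [Xs cov].
apply: (linear_family_of_pattern (p := pat2_gauss) cov (@all_eisP 2)); last by vm_compute.
by rewrite card_eis.
Qed.

Lemma linear_2_eis C : eis_group C -> has_linear_family (invol 2) C.
Proof.
case/eis_cover => t [Xs cov].
apply: (linear_family_of_pattern (p := rotate (E 2 0 0 2) pat2_eis) cov (@all_eisP 2)).
  by rewrite card_eis.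
by vm_compute.
Qed.

Lemma linear_23_gauss C : gauss_group C ->
  has_linear_family ((invol 2, 0) : eis 2 * 'Z_3) C.
Proof.
case/gauss_cover => t [Xs cov].
apply: (linear_family_of_pattern (p := pat23_gauss) cov all_23P); last by vm_compute.
by rewrite card_23.
Qed.

Lemma linear_23_eis C : eis_group C ->
  has_linear_family ((invol 2, 0) : eis 2 * 'Z_3) C.
Proof.
case/eis_cover => t [Xs cov].
apply: (linear_family_of_pattern
  (p := rotate ((E 2 0 0 2, 0) : eis 2 * 'Z_3)%type pat23_eis) cov all_23P).
  by rewrite card_23.
by vm_compute.
Qed.

Lemma linear_23_quad p : prime p -> (p %% 12 = 11)%N ->
  has_linear_family ((invol 2, 0) : eis 2 * 'Z_3) 'F_p.
Proof.
move=> p_pr p11; have [t [Xs cov]] := quad_cover p_pr p11.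
apply: (linear_family_of_pattern (p := pat23_quad) cov all_23P); last by vm_compute.
by rewrite card_23.
Qed.

Lemma linear_233_quad p : prime p -> (p %% 12 = 11)%N ->
  has_linear_family ((invol 2, 0) : eis 2 * zprod 'Z_3 'Z_3) 'F_p.
Proof.
move=> p_pr p11; have [t [Xs cov]] := quad_cover p_pr p11.
apply: (linear_family_of_pattern (p := pat233_quad) cov all_233P); last by vm_compute.
by rewrite card_233.
Qed.

Lemma linear_4_quad p : prime p -> (p %% 12 = 11)%N ->
  has_linear_family (invol 4) 'F_p.
Proof.
move=> p_pr p11; have [t [Xs cov]] := quad_cover p_pr p11.
apply: (linear_family_of_pattern (p := pat4_quad) cov (@all_eisP 4)); last by vm_compute.
by rewrite card_eis.
Qed.

Section BaseFamily.
Variables (G : finGroupType) (j h : G) (ys : seq G) (elems : seq G) (p : pattern G).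
Local Open Scope group_scope.

Definition base_check :=
  let J := [seq y * j * y^-1 | y <- ys] in
  let F := [seq map3 snd t | t <- p] in
  let D := [:: 1; h; h * h] ++ J ++ flatten (map (@diffs G) F) in
  let P := ys ++ [seq y * j | y <- ys] ++ flatten (map (pts j) F) in
  [&& j != 1, j * j == 1, h != 1, h * h * h == 1, size ys == 3, uniq J,
      all (mem D) elems & all (mem P) elems].

Lemma base_family : (forall x, x \in elems) -> (size p * 6 + 6 = #|G|)%N ->
  base_check -> has_pyramidal_family j.
Proof.
move=> elemsP sz /and5P[j1 /eqP j2 h1 /eqP h3].
case/and4P=> /eqP sy uJ /allP dD /allP pP.
exists h, (fun i : 'I_3 => nth 1 ys i), [seq map3 snd t | t <- p].
have nthJ (i : 'I_3) : nth 1 ys i * j * (nth 1 ys i)^-1 = nth 1 [seq y * j * y^-1 | y <- ys] i.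
  by rewrite (nth_map 1) // sy.
split; split=> //.
- move=> i k; rewrite !nthJ => /eqP.
  by rewrite nth_uniq ?size_map ?sy // => /eqP/val_inj.
- by rewrite size_map.
- move=> d dH dJ; have : d \in _ ++ (_ ++ _) := dD d (elemsP d).
  rewrite 2!mem_cat => /or3P[].
  + by rewrite (negPf dH).
  + case/(nthP 1) => i; rewrite size_map sy => i3 e.
    by have := dJ (Ordinal i3); rewrite nthJ /= e eqxx.
  + by case/flattenP => _ /mapP[t tF ->] dt; exists t.
- move=> x xY; have : x \in _ ++ (_ ++ _) := pP x (elemsP x).
  rewrite 2!mem_cat => /or3P[].
  + case/(nthP 1) => i; rewrite sy => i3 e.
    by have := xY (Ordinal i3) false; rewrite /= e mulg1 eqxx.
  + case/(nthP 1) => i; rewrite size_map sy => i3; rewrite (nth_map 1) ?sy // => e.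
    by have := xY (Ordinal i3) true; rewrite /= expg1 e eqxx.
  + by case/flattenP => _ /mapP[t tF ->] xt; exists t.
Qed.
End BaseFamily.

Lemma adm_trivial (G : finGroupType) (j : G) : has_pyramidal_family j -> adm j 'I_1.
Proof.
move=> fam; split; first exact: dm_trivial.
apply: (pyramidal_family_iso (f := fun g => (g, 0) : G * 'I_1)) fam.
- by move=> x y; congr (_, _); apply: (@ord_inj 1); case: (_ * _)%g => -[].
- by move=> x y [].
- by rewrite card_prod card_ord muln1.
Qed.

Lemma adm_2 : adm (invol 2) 'I_1.
Proof.
apply/adm_trivial/(base_family (h := E 2 0 0 1) (p := base2)
  (ys := [:: E 2 0 0 0; E 2 1 0 1; E 2 1 0 2]) (@all_eisP 2)).
  by rewrite card_eis.
by vm_compute.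
Qed.

Lemma adm_23 : adm ((invol 2, 0) : eis 2 * 'Z_3) 'I_1.
Proof.
pose e a s : eis 2 * 'Z_3 := (E 2 a 0 s, 0).
apply/adm_trivial/(base_family (h := e 0 1) (p := base23)
  (ys := [:: e 0 0; e 1 1; e 1 2]) all_23P).
  by rewrite card_23.
by vm_compute.
Qed.

(** Two copies of ['Z_3] form a Gauss group, so the base family comes from [eis 2] by one
    adjunction; only the trivial factor has to be dropped. *)
Lemma adm_233 : adm ((invol 2, 0) : eis 2 * zprod 'Z_3 'Z_3) 'I_1.
Proof.
have dI : injective (fun x : 'Z_3 => x + x).
  have /allP ok : all (fun x : 'Z_3 => all (fun y => (x + x == y + y) ==> (x == y))
    (all_Z 3)) (all_Z 3) by vm_compute.
  move=> x y /eqP e; apply/eqP; move: e; apply/implyP.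
  exact: (allP (ok x (all_ZP x)) y (all_ZP y)).
have g9 := gauss_zprod dI.
have [_ fam] := adm_step adm_2 (dm_gauss g9) (linear_2_gauss g9).
pose f (x : eis 2 * zprod 'I_1 (zprod 'Z_3 'Z_3)) : eis 2 * zprod 'Z_3 'Z_3 :=
  (x.1, x.2.2).
apply: adm_trivial; apply: (pyramidal_family_iso (f := f)) fam.
- by move=> [a [b c]] [a' [b' c']].
- by move=> [a [b c]] [a' [b' c']] [-> ->]; rewrite (ord1 b) (ord1 b').
- by rewrite card_233 card_prod card_eis // !card_prod !card_ord.
Qed.

(** * Doubling the modulus *)

Section Scale.
Variables (n N d : nat).

(** One formula for two maps: the embedding onto the multiples of [d] when [N.+2] is [d * n.+2], and
    reduction modulo [N.+2] when [d] is 1 and [N.+2] divides [n.+2]. *)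
Definition upZ (a : 'Z_n.+2) : 'Z_N.+2 := inZp (d * a).
Definition upR (u : 'Z_n.+2 * 'Z_n.+2) : 'Z_N.+2 * 'Z_N.+2 := (upZ u.1, upZ u.2).
Definition upE (x : eis n.+2) : eis N.+2 := (upR x.1, x.2).

Hypothesis dvd_up : (N.+2 %| d * n.+2)%N.

Lemma upZD : {morph upZ : a b / a + b}.
Proof.
move=> a b; apply: val_inj; rewrite /= modnDm -mulnDr muln_modr.
by rewrite modn_dvdm.
Qed.

Lemma upZN a : upZ (- a) = - upZ a.
Proof. exact: morph_addN upZD a. Qed.

Lemma upRD : {morph upR : u w / u + w}.
Proof. by move=> u w; congr (_, _); apply: upZD. Qed.

Lemma upR_omega u : upR (omega u) = omega (upR u).
Proof. by rewrite /omega /upR /= upZN (morph_addB upZD). Qed.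

Lemma upR_rot s u : upR (rot s u) = rot s (upR u).
Proof. by rewrite /rot; elim: (nat_of_ord s) => //= m <-; apply: upR_omega. Qed.

Lemma upEM : {morph upE : x y / (x * y)%g}.
Proof. by move=> x y; congr (_, _); rewrite /= upRD upR_rot. Qed.
End Scale.

Section ScaleInj.
Variables (n N d : nat).
Hypothesis NE : N.+2 = (d * n.+2)%N.

Lemma upZ_val (a : 'Z_n.+2) : upZ N d a = (d * a)%N :> nat.
Proof.
by rewrite /upZ /= modn_small // NE ltn_pmul2l // lt0n; apply/eqP => d0; move: NE; rewrite d0.
Qed.

Lemma upZ_inj : injective (@upZ n N d).
Proof.
move=> a b /(congr1 (@nat_of_ord _)); rewrite !upZ_val => /eqP.
rewrite eqn_pmul2l => [/eqP/val_inj //|].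
by rewrite lt0n; apply/eqP => d0; move: NE; rewrite d0.
Qed.

Lemma upR_inj : injective (@upR n N d).
Proof.
move=> [a b] [a' b'] e; congr (_, _); apply: upZ_inj.
  exact: (congr1 fst e).
exact: (congr1 snd e).
Qed.

Lemma upE_inj : injective (@upE n N d).
Proof.
move=> [u s] [u' s'] e; congr (_, _); last exact: (congr1 snd e).
by apply: upR_inj; exact: (congr1 fst e).
Qed.
End ScaleInj.

Lemma upE_invol m M d : M.+2 = (d * m.+2)%N -> ~~ odd m -> upE M d (invol m.+2) = invol M.+2.
Proof.
move=> ME em; congr (_, _); congr (_, _); apply: val_inj; last first.
  by rewrite /= !mod0n muln0.
have e : (d * (m.+2./2 %% m.+2))%N = M.+2./2.
  have [k mk] : exists k, m = k.*2 by exists m./2; rewrite even_halfK.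
  rewrite ME mk -doubleS doubleK -doubleMr doubleK modn_small //; lia.
exact: (congr1 (fun z => (z %% M.+2)%N) e).
Qed.

Definition nxt (n : nat) := n.*2.+2.
Lemma nxtE n : (nxt n).+2 = (2 * n.+2)%N. Proof. by rewrite /nxt; lia. Qed.
Lemma nxt_even n : ~~ odd (nxt n). Proof. by rewrite /nxt /= negbK odd_double. Qed.

Section Parity.
Variable n : nat.
Hypothesis n_even : ~~ odd n.
Local Notation R := (zprod 'Z_n.+2 'Z_n.+2).

(** Reduction modulo 2, whose values form the field of four elements. It is nonzero exactly off the
    doubles, which is the part to be covered when the modulus doubles. *)
Definition parity (x : R) : zprod 'Z_2 'Z_2 := upR 0 1 x.

Let dvd2 : (2 %| 1 * n.+2)%N.
Proof. by rewrite mul1n dvdn2 /= negbK. Qed.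

Lemma parityD : {morph parity : x y / x + y}.
Proof. exact: upRD. Qed.

Lemma parity_omega (x : R) : parity (omega x) = omega (parity x).
Proof. exact: upR_omega. Qed.

Lemma parity_eq0 (x : R) : (parity x == 0) = ~~ odd x.1 && ~~ odd x.2.
Proof.
have e (a : 'Z_n.+2) : (upZ 0 1 a == 0) = ~~ odd a.
  by rewrite -val_eqE /= mul1n modn2 eqb0.
by rewrite -!e.
Qed.
End Parity.

Lemma morph_addMz (C C' : zmodType) (f : C -> C') : {morph f : x y / x + y} ->
  forall x z, f (x *~ z) = f x *~ z.
Proof.
move=> fD x; have fn k : f (x *+ k) = f x *+ k.
  by elim: k => [|k IHk]; rewrite ?mulr0n ?(morph_add0 fD) // !mulrS fD IHk.
by case=> k; rewrite -?pmulrn ?NegzE ?mulrNz -?pmulrn ?(morph_addN fD) fn.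
Qed.

Local Notation R n := (zprod 'Z_n.+2 'Z_n.+2).

Section OmegaRing.
Variable n : nat.
Implicit Types x y : R n.

Lemma omegaD : {morph (@omega n.+2 : R n -> R n) : x y / x + y}.
Proof. by move=> x y; have := @rotD n.+2 1 x y. Qed.

Lemma omega_sq x : omega (omega x) = - x - omega x :> R n.
Proof.
case: x => a b; rewrite /omega /=.
have -> : - (a, b) - (- b, a - b) = (- a - - b, - b - (a - b)) :> R n by [].
by rewrite opprB opprK addrC.
Qed.
End OmegaRing.

Lemma odd_upZ n (a : 'Z_n.+2) : odd (upZ (nxt n) 2 a) = false.
Proof. by rewrite (upZ_val (nxtE n)) oddM. Qed.

Lemma upZ_half n (a : 'Z_(nxt n).+2) : ~~ odd a -> upZ (nxt n) 2 (inZp a./2 : 'Z_n.+2) = a.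
Proof.
move=> ea; apply: ord_inj; rewrite (upZ_val (nxtE n)) /= modn_small.
  by rewrite mul2n even_halfK.
have : (a < 2 * n.+2)%N by rewrite -nxtE; apply: ltn_ord.
by change (a < 2 * n.+2 -> a./2 < n.+2)%N; lia.
Qed.

Lemma parity_dbl n (x : R (nxt n)) :
  reflect (exists u : R n, x = upR (nxt n) 2 u) (parity x == 0).
Proof.
rewrite parity_eq0; apply: (iffP andP) => [[e1 e2]|[u ->]].
  exists (inZp x.1./2, inZp x.2./2); rewrite [LHS]surjective_pairing.
  by congr (_, _); rewrite upZ_half.
by split; [rewrite -[odd _]/(odd (upZ _ _ u.1)) odd_upZ
          | rewrite -[odd _]/(odd (upZ _ _ u.2)) odd_upZ].
Qed.

Lemma parity_card n : #|[set x : R (nxt n) | parity x != 0]| = (3 * n.+2 ^ 2)%N.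
Proof.
have -> : [set x : R (nxt n) | parity x != 0] =
    ~: [set (upR (nxt n) 2 u : R (nxt n)) | u : R n].
  apply/setP => x; rewrite !inE; congr (~~ _).
  by apply/parity_dbl/imsetP => [[u ->]|[u _ ->]]; exists u.
have := cardsC [set (upR (nxt n) 2 u : R (nxt n)) | u : R n].
rewrite card_imset; last exact: upR_inj (nxtE n).
rewrite !card_prod !card_ord => h; apply/eqP; rewrite -(eqn_add2l (n.+2 * n.+2)%N) h.
by apply/eqP; rewrite -[(Zp_trunc _).+2]/(nxt n).+2 nxtE; ring.
Qed.

Section UnitCover.
Variable n : nat.
Hypotheses (n_even : ~~ odd n) (n3 : coprime 3 n.+2).
Local Notation n1 := (nxt n).
Local Notation n2 := (nxt n1).
Local Notation D1 := [set x : R n1 | parity x != 0].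

Let n3' : coprime 3 n1.+2.
Proof. by rewrite nxtE coprimeMr n3. Qed.

Let triple_inj : injective (fun x : R n1 => x + x + x).
Proof.
have addA : {morph (fun x : R n1 => x + x + x) : x y / x + y}.
  by move=> x y; rewrite (addrACA x) (addrACA (x + x)).
apply: (morph_add_inj addA) => -[a b] e.
have coord (c : 'Z_n1.+2) : c + c + c = 0 -> c = 0.
  move/(congr1 (@nat_of_ord _)); rewrite /= modnDml => /eqP.
  have -> : (c + c + c = 3 * c)%N by lia.
  rewrite -[_ == _]/(n1.+2 %| 3 * c)%N Gauss_dvdr 1?coprime_sym //.
  case: (posnP c) => [c0 _|c0 /(dvdn_leq c0)]; first exact: val_inj.
  by rewrite leqNgt ltn_ord.
by congr (_, _); apply: coord; [exact: (congr1 fst e) | exact: (congr1 snd e)].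
Qed.

(** The modulus is [2 * n.+2] with [n] even, so a coordinate killed by 2 is a multiple of the even
    number [n.+2]. Modulo 2 negation is trivial, so this argument does not reach the doubling from 2
    to 4. *)
Let double_free (x : R n1) : x \in D1 -> x <> - x.
Proof.
rewrite inE parity_eq0 ?nxt_even // => xodd /eqP; rewrite -addr_eq0 => /eqP xx.
case/negP: xodd; case: x xx => a b xx.
have coord (c : 'Z_n1.+2) : c + c = 0 -> ~~ odd c.
  move=> e; have {e} : ((c + c) %% n1.+2)%N = 0%N := congr1 (@nat_of_ord _) e.
  move: (nat_of_ord c) => k /eqP; rewrite -[_ == _]/(n1.+2 %| _)%N nxtE addnn -mul2n.
  by rewrite dvdn_pmul2l // => /dvdnP[q ->]; rewrite oddM /= negbK (negPf n_even) andbF.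
by rewrite /= !coord //; [exact: (congr1 snd xx) | exact: (congr1 fst xx)].
Qed.

(** Orbits of [- omega] are chosen modulo half of the modulus and then lifted. The kernel of that
    reduction is the 2-torsion, with four elements, whence 24 = 6 * 4 and the correction [tau]. *)
Lemma unit_cover : exists Xs : {set R n2},
  (#|Xs| * 24)%N = #|[set x : R n2 | parity x != 0]| /\
  forall sc, sc \in unit_scales -> forall r : R n2, parity r != 0 ->
    exists a x (tau : R 0), [/\ a \in sc, x \in Xs &
      r = evals (@omega n2.+2 : R n2 -> R n2) a x + upR n2 n1.+2 tau].
Proof.
have dvd1 : (n1.+2 %| 1 * n2.+2)%N by rewrite mul1n (nxtE n1) dvdn_mull.
pose red (x : R n2) : R n1 := upR n1 1 x.
have redD : {morph red : x y / x + y} := upRD dvd1.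
have red_eval a x : red (evals (@omega n2.+2 : R n2 -> R n2) a x) =
    evals (@omega n1.+2 : R n1 -> R n1) a (red x).
  rewrite /evals redD !(morph_addMz redD); congr (_ + _ *~ _).
  exact: upR_omega dvd1 _.
have parD := parityD (nxt_even n).
have par0 : parity (0 : R n1) = 0 by apply/eqP; rewrite parity_eq0.
have parN (x : R n1) : parity (- x) = - parity x := morph_addN parD x.
have om_nz (u : R 0) : (omega u == 0 :> R 0) = (u == 0).
  apply/eqP/eqP => [e|->]; last by apply/eqP.
  by rewrite -(@omega3 2 u) e; apply/eqP.
have [x|x|x|x|r rs|X1 [cX1 covX1]] := @eis_orbit_cover (R n1) (@omega n1.+2)
    (@omegaD n1) (@omega_sq n1) D1 [:: (1, 0); (1, -1)].
- by rewrite !inE (parity_omega (nxt_even n)) om_nz.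
- by rewrite !inE parN oppr_eq0.
- exact: double_free.
- rewrite !inE => x0 /(eis_fixed (@omega_sq n1)) e; move/eqP: x0; apply.
  by rewrite -par0; congr parity; apply: triple_inj; rewrite e !addr0.
- split.
    move: rs; rewrite !inE => /orP[] /eqP->; first exact: evals_one_inj.
    exact: evals_lambda_inj (@omegaD n1) (@omega_sq n1) triple_inj.
  move=> x; rewrite !inE; apply: contraNneq => e.
  rewrite /evals parD !(morph_addMz parD) (parity_omega (nxt_even n)) e.
  by rewrite (_ : omega 0 = 0) ?mul0rz ?addr0 //; apply/eqP; rewrite om_nz.
pose lift (x : R n1) : R n2 := (inZp x.1, inZp x.2).
have lt12 : (n1.+2 < n2.+2)%N by rewrite (nxtE n1); lia.
have redK x : red (lift x) = x.
  case: x => a b; congr (_, _); apply: val_inj; rewrite /= mul1n.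
    by rewrite (@modn_small a) ?modn_small // (ltn_trans _ lt12).
  by rewrite (@modn_small b) ?modn_small // (ltn_trans _ lt12).
have ker (x : R n2) : red x = 0 -> exists tau : R 0, x = upR n2 n1.+2 tau.
  have coord (a : 'Z_n2.+2) : upZ n1 1 a = 0 -> exists t : 'Z_2, a = upZ n2 n1.+2 t.
    move/(congr1 (@nat_of_ord _)); rewrite /= mul1n => /eqP /dvdnP[q aq].
    exists (inZp q); apply: ord_inj; rewrite (upZ_val (n := 0)); last by rewrite (nxtE n1) mulnC.
    rewrite /= modn_small 1?mulnC //.
    have : (a < 2 * n1.+2)%N by rewrite -nxtE; apply: ltn_ord.
    by rewrite aq ltn_pmul2r.
  move=> e; have [t1 e1] := coord x.1 (congr1 fst e); have [t2 e2] := coord x.2 (congr1 snd e).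
  by exists (t1, t2); rewrite [LHS]surjective_pairing e1 e2.
exists (lift @: X1); split.
  rewrite card_imset; last exact: can_inj redK.
  rewrite (_ : 24 = 6 * 4)%N // mulnA cX1 !parity_card (nxtE n); ring.
move=> sc scs r r0.
have rD : red r \in D1.
  have oddE (a : 'Z_n2.+2) : odd (upZ n1 1 a) = odd a.
    change (odd ((1 * a) %% n1.+2) = odd a); rewrite mul1n [in RHS](divn_eq a n1.+2).
    by rewrite oddD oddM /= negbK odd_double andbF.
  move: r0; rewrite inE !parity_eq0.
  by rewrite -[odd (red r).1]/(odd (upZ n1 1 r.1)) -[odd (red r).2]/(odd (upZ n1 1 r.2)) !oddE.
have [a [x [asc xX e]]] := covX1 sc scs _ rD.
have [|tau et] := ker (r - evals (@omega n2.+2 : R n2 -> R n2) a (lift x)).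
  by rewrite (morph_addB redD) red_eval redK -e subrr.
exists a, (lift x), tau; split=> //; first exact: imset_f.
by rewrite -et addrC subrK.
Qed.

End UnitCover.

Lemma dbl_image n : ~: ((@upE n (nxt n) 2) @: setT) =
  [set x : eis (nxt n).+2 | parity (x.1 : R (nxt n)) != 0].
Proof.
apply/setP => -[r s]; rewrite !inE /=; congr (~~ _).
apply/imsetP/parity_dbl => [[[u t] _ e]|[u ->]]; last by exists (u, s).
by exists u; apply: (congr1 fst e).
Qed.

Lemma dbl_image_card n (E : finGroupType) :
  #|~: ((fun x : eis n.+2 * E => (upE (nxt n) 2 x.1, x.2) : eis (nxt n).+2 * E) @: setT)| =
  (#|[set x : R (nxt n) | parity x != 0%R]| * 3 * #|E|)%N.
Proof.
rewrite cardsCs setCK card_imset; last first.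
  move=> [x e] [x' e'] ee; congr (_, _); last exact: (congr1 snd ee).
  by apply: (upE_inj (nxtE n)); exact: (congr1 fst ee).
rewrite cardsT card_prod card_eis // [#|{: eis n.+2 * E}|]card_prod card_eis // parity_card nxtE.
by rewrite -mulnBl; congr (_ * _)%N; rewrite -mulnBl; congr (_ * _)%N; lia.
Qed.

Section Unit.
Variable n : nat.
Hypotheses (n_even : ~~ odd n) (n3 : coprime 3 n.+2).
Local Notation n1 := (nxt n).
Local Notation n2 := (nxt n1).
Local Notation om := (@omega n2.+2 : R n2 -> R n2).

Let k (x : eis 2) : eis n2.+2 := @upE 0 n2 n1.+2 x.
Let kM : {morph k : x y / (x * y)%g}.
Proof. by apply: upEM; rewrite (nxtE n1) mulnC. Qed.

Let v (a : scalar) (x : R n2) : eis n2.+2 := (evals om a x, 0).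

Let vB a b x : v (subs a b) x = (v a x * (v b x)^-1)%g.
Proof.
by congr (_, _); [rewrite evalsB | apply: val_inj].
Qed.

Let vJ (g : eis 2) a x : (k g * v a x)%g = (v (twist2 g a) x * k g)%g.
Proof.
congr (_, _); last by rewrite /= addr0 add0r.
have step b : evals om (mulw b) x = omega (evals om b x).
  rewrite /evals (omegaD (x *~ b.1)) !(morph_addMz (@omegaD n2)) omega_sq /=.
  by rewrite mulrNz mulrzBr mulrzBl mulNrz addrCA.
have rotE : rot g.2 (evals om a x) = evals om (twist2 g a) x.
  by rewrite /twist2 /rot; elim: (nat_of_ord g.2) => //= m ->.
by rewrite /= addrC; congr (_ + _); apply: rotE.
Qed.

(** [k] maps the ring part of [eis 2] onto the 2-torsion, so that the involution of [eis 2] becomes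
    the wanted one; the correction left by [unit_cover] is then absorbed into the group element.
    Rotations multiply scalars by powers of [omega], which is [twist2]. *)
Lemma unit_family : has_relative_family (invol n2.+2) (~: ((@upE n1 n2 2) @: setT)).
Proof.
have [Xs [cX covX]] := unit_cover n_even n3.
have <- : k (invol 2) = invol n2.+2.
  by apply: (@upE_invol 0); rewrite // (nxtE n1) mulnC.
apply: (@pattern_family _ twist2 _ k _ Xs v kM vB vJ _ layers2 unit_scales
  (rotate (E 2 0 0 1) pat2_unit)).
- by vm_compute.
- rewrite dbl_image (_ : size _ = 12%N) //.
  rewrite (_ : [set x | _] = setX [set x : R n2 | parity x != 0] [set: 'Z_3]).
    by rewrite cardsX -cX cardsT card_ord -[RHS]mulnA mulnC.
  by apply/setP => -[r s]; rewrite !inE andbT.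
rewrite dbl_image => -[r s]; rewrite inE /= => r0.
exists [seq (u, s) | u <- [seq (a, b) | a <- all_Z 2, b <- all_Z 2]].
  by apply/mapP; exists s; rewrite ?all_ZP.
move=> sc scs; have [a [x [tau [asc xX ->]]]] := covX sc scs r r0.
exists (tau, s), a, x; split=> //; last by congr (_, _); rewrite /= add0r.
by apply: map_f; case: tau => b c; apply: allpairs_f; apply: all_ZP.
Qed.


Local Open Scope group_scope.

Lemma unit_family_Z3 : has_relative_family ((invol n2.+2, 0%R) : eis n2.+2 * 'Z_3)
  (~: ((fun x : eis n1.+2 * 'Z_3 => (upE n2 2 x.1, x.2) : eis n2.+2 * 'Z_3) @: setT)).
Proof.
have [Xs [cX covX]] := unit_cover n_even n3.
pose k3 (x : eis 2 * 'Z_3) : eis n2.+2 * 'Z_3 := (k x.1, x.2).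
have <- : k3 (invol 2, 0%R) = (invol n2.+2, 0%R).
  by congr (_, _); apply: (@upE_invol 0); rewrite // (nxtE n1) mulnC.
have imE : ~: ((fun x : eis n1.+2 * 'Z_3 => (upE n2 2 x.1, x.2) : eis n2.+2 * 'Z_3) @: setT) =
    [set x : eis n2.+2 * 'Z_3 | parity (x.1.1 : R n2) != 0%R].
  apply/setP => -[[r s] z]; rewrite !inE /=; congr (~~ _).
  apply/imsetP/parity_dbl => [[[[u t] w] _ e]|[u ->]]; last by exists (u, s, z).
  by exists u; apply: (congr1 (fun x => x.1.1) e).
apply: (@pattern_family _ twist23 _ k3 _ Xs (fun a x => (v a x, 0%R) : eis n2.+2 * 'Z_3)
  _ _ _ _ layers23 unit_scales
  (rotate ((E 2 0 0 1, 0%R) : eis 2 * 'Z_3)%type pat23_unit)).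
- by move=> x y; congr (_, _); apply: kM.
- by move=> a b x; congr (_, _); [apply: vB | apply: val_inj].
- move=> g a x; congr (_, _); first exact: vJ.
  by rewrite !FinRing.zmodMgE addr0 add0r.
- by vm_compute.
- rewrite dbl_image_card -cX card_ord (_ : size _ = 36%N) // -[in RHS]mulnA -[RHS]mulnA mulnC //.
rewrite imE => -[[r s] z]; rewrite inE /= => r0.
exists [seq (g, z) | g <- [seq (u, s) | u <- [seq (a, b) | a <- all_Z 2, b <- all_Z 2]]].
  apply/allpairsP; exists ([seq (u, s) | u <- [seq (a, b) | a <- all_Z 2, b <- all_Z 2]], z).
  by split; rewrite ?all_ZP //; apply/mapP; exists s; rewrite ?all_ZP.
move=> sc scs; have [a [x [tau [asc xX ->]]]] := covX sc scs r r0.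
exists (tau, s, z), a, x; split=> //.
  apply/mapP; exists (tau, s) => //; apply/mapP; exists tau => //.
  by case: (tau) => b c; apply: allpairs_f; apply: all_ZP.
by congr (_, _); [congr (_, _) | rewrite FinRing.zmodMgE]; rewrite /= add0r.
Qed.

End Unit.

(* The first doubling, and the tower of moduli *)
Local Close Scope ring_scope.
Local Open Scope group_scope.

(** A list of explicit triples is read as a pattern with trivial [v] and a single parameter, so the
    same computed check applies. *)
Lemma explicit_family (G : finGroupType) (j : G) (elems : seq G) (P : pred G)
    (p : pattern G) (S : {set G}) :
    (forall x, x \in elems) -> S = [set x | P x] -> (size p * 6)%N = #|S| ->
    pattern_ok (@notw _) j (singles (filter P elems)) [:: [:: (0%R, 0%R)]] p ->
  has_relative_family j S.
Proof.
move=> elemsP SE szp okp.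
apply: (@pattern_family _ (@notw _) G id unit setT (fun _ _ => 1) _ _ _ j _ _ _ _ okp).
- by [].
- by move=> *; rewrite mulgV.
- by move=> *; rewrite mulg1 mul1g.
- by rewrite cardsT card_unit muln1.
move=> d; rewrite SE inE => Pd; exists [:: d].
  by apply: map_f; rewrite mem_filter Pd elemsP.
move=> sc; rewrite inE => /eqP->; exists d, (0%R, 0%R), tt.
by rewrite !mem_head inE mul1g.
Qed.

(** The doubling from 2 to 4 lies outside [unit_family], whose smallest target modulus is 8, and is
    settled by explicit triples. *)
Lemma hole_family : has_relative_family (invol 4) (~: ((@upE 0 2 2) @: setT)).
Proof.
apply: (explicit_family (p := rotate (E 4 0 0 1) pat4_hole)
  (P := fun x => ~~ even_eis x) (@all_eisP 4)); last by vm_compute.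
- by rewrite (dbl_image 0); apply/setP => x; rewrite !inE parity_eq0.
- by rewrite cardsCs setCK card_imset ?cardsT ?card_eis //; apply: (upE_inj (nxtE 0)).
Qed.

Lemma hole_family_Z3 : has_relative_family ((invol 4, 0%R) : eis 4 * 'Z_3)
  (~: ((fun x : eis 2 * 'Z_3 => (@upE 0 2 2 x.1, x.2) : eis 4 * 'Z_3) @: setT)).
Proof.
apply: (explicit_family (p := rotate ((E 4 0 0 1, 0%R) : eis 4 * 'Z_3)%type pat43_hole)
  (P := fun x => ~~ even_eis x.1) (elems := [seq (g, z) | g <- all_eis 4, z <- all_Z 3])).
- by move=> [g z]; apply: allpairs_f; rewrite ?all_eisP ?all_ZP.
- apply/setP => -[[r s] z]; rewrite !inE; congr (~~ _).
  apply/imsetP/idP => [[[[u t] w] _ e]|].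
    rewrite (_ : r = upR 2 2 u); last exact: (congr1 (fun x => x.1.1) e).
    by have := introT (parity_dbl (upR (nxt 0) 2 u)) (ex_intro _ u erefl); rewrite parity_eq0.
  move=> ev; have /parity_dbl[u ->] : parity (r : zprod 'Z_(nxt 0).+2 'Z_(nxt 0).+2) == 0%R.
    by rewrite parity_eq0.
  by exists (u, s, z).
- rewrite cardsCs setCK card_imset; last first.
    move=> [x e] [x' e'] ee; congr (_, _); last exact: (congr1 snd ee).
    by apply: (upE_inj (nxtE 0)); exact: (congr1 fst ee).
  by rewrite cardsT card_prod card_eis // card_23 card_ord.
- by vm_compute.
Qed.

Section Tower.
Variable C : finZmodType.

Let coprime3 n k : n.+2 = (2 ^ k.+1)%N -> coprime 3 n.+2.
Proof. by move->; rewrite coprimeXr. Qed.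
Let even_pow n k : n.+2 = (2 ^ k.+1)%N -> ~~ odd n.
Proof. by move=> e; rewrite -[n]/(n.+2.-2) e expnS mul2n; case: (2 ^ k)%N => //= m; rewrite odd_double. Qed.

Lemma tower : adm (invol 4) C -> forall k, exists2 n, n.+2 = (2 ^ k.+1)%N &
  adm (invol (nxt n).+2) C.
Proof.
move=> adm4; elim=> [|k [n nE admn]]; first by exists 0%N.
exists (nxt n); first by rewrite nxtE nE -expnS.
have <- : upE (nxt (nxt n)) 2 (invol (nxt n).+2) = invol (nxt (nxt n)).+2.
  by apply: upE_invol; rewrite ?nxtE ?nxt_even.
apply: adm_extend admn; [apply: upEM; rewrite nxtE // | apply: upE_inj; exact: nxtE |].
rewrite upE_invol ?nxt_even ?(nxtE (nxt n)) //; apply: unit_family.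
  exact: even_pow nE.
exact: coprime3 nE.
Qed.

Lemma tower_Z3 : adm ((invol 4, 0%R) : eis 4 * 'Z_3) C ->
  forall k, exists2 n, n.+2 = (2 ^ k.+1)%N &
  adm ((invol (nxt n).+2, 0%R) : eis (nxt n).+2 * 'Z_3) C.
Proof.
move=> adm4; elim=> [|k [n nE admn]]; first by exists 0%N.
exists (nxt n); first by rewrite nxtE nE -expnS.
pose f (x : eis (nxt n).+2 * 'Z_3) : eis (nxt (nxt n)).+2 * 'Z_3 := (upE _ 2 x.1, x.2).
have fE : f (invol (nxt n).+2, 0%R) = (invol (nxt (nxt n)).+2, 0%R).
  by congr (_, _); apply: upE_invol; rewrite ?nxtE ?nxt_even.
rewrite -fE; apply: adm_extend admn.
- by move=> x y; congr (_, _); apply: upEM; rewrite nxtE.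
- move=> [x e] [x' e'] ee; congr (_, _); last exact: (congr1 snd ee).
  by apply: (upE_inj (nxtE _)); exact: (congr1 fst ee).
rewrite fE; apply: unit_family_Z3; first exact: even_pow nE.
exact: coprime3 nE.
Qed.

End Tower.

Lemma adm_4 (C : finZmodType) : adm (invol 2) C -> adm (invol 4) C.
Proof.
rewrite -(@upE_invol 0 2 2) //; apply: adm_extend.
- exact: upEM.
- exact: (upE_inj (nxtE 0)).
- by rewrite upE_invol //; apply: hole_family.
Qed.

Lemma adm_43 (C : finZmodType) : adm ((invol 2, 0%R) : eis 2 * 'Z_3) C ->
  adm ((invol 4, 0%R) : eis 4 * 'Z_3) C.
Proof.
pose f (x : eis 2 * 'Z_3) : eis 4 * 'Z_3 := (@upE 0 2 2 x.1, x.2).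
have fE : f (invol 2, 0%R) = (invol 4, 0%R) by congr (_, _); apply: (@upE_invol 0 2 2).
rewrite -fE; apply: adm_extend.
- by move=> x y; congr (_, _); apply: upEM.
- move=> [x e] [x' e'] ee; congr (_, _); last exact: (congr1 snd ee).
  by apply: (upE_inj (nxtE 0)); exact: (congr1 fst ee).
by rewrite fE; apply: hole_family_Z3.
Qed.

Lemma adm_KTS (G : finGroupType) (j : G) (C : finZmodType) :
  adm j C -> exists_3pyramidal_KTS (#|G| * #|C| + 3).
Proof. by case=> _ /pyramidal_family_KTS; rewrite card_prod. Qed.

Local Close Scope group_scope.

(** * Orders *)

(** A prime that divides twice is removed as a square, which [S1] accepts, so only primes of odd
    exponent have to be classified. [S1] collects factors adjoined before a change of the nonabelian
    group, [S2] those adjoined after it. *)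
Lemma split_factor (S1 S2 : nat -> Prop) (m : nat) :
    S1 1 -> S2 1 -> (forall a b, S1 a -> S1 b -> S1 (a * b)) ->
    (forall a b, S2 a -> S2 b -> S2 (a * b)) ->
    (forall p, prime p -> odd p -> S1 (p * p)) -> odd m ->
    (forall p, prime p -> odd p -> odd (logn p m) -> S1 p \/ S2 p) ->
  exists m1 m2, [/\ m = m1 * m2, S1 m1 & S2 m2].
Proof.
move=> S11 S21 S1M S2M sqS; elim/ltn_ind: m => m IHm om primS.
have m0 : 0 < m by case: m om {IHm primS}.
have [m1|m_gt1] := leqP m 1; first by exists 1, 1; split=> //; lia.
pose p := pdiv m; have p_pr : prime p := pdiv_prime m_gt1.
have [m' mE] : exists m', m = p * m'.
  by have /dvdnP[q ->] := pdiv_dvd m; exists q; rewrite mulnC.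
have p_gt1 := prime_gt1 p_pr.
have [op om'] : odd p /\ odd m' by apply/andP; rewrite -oddM -mE.
have m'0 : 0 < m' by case: m' om' {mE}.
have [/dvdnP[q m'E]|p_m'] := boolP (p %| m').
  have mq : m = p * p * q by rewrite mE m'E; lia.
  have q0 : 0 < q by move: m'0; rewrite m'E muln_gt0 => /andP[].
  have oq : odd q by move: om'; rewrite m'E oddM => /andP[].
  have [|//|r r_pr o_r o_log|m1 [m2 [qE s1 s2]]] := IHm q.
  - by rewrite mq -[X in X < _]mul1n ltn_pmul2r // (ltn_mul p_gt1 p_gt1).
  - apply: primS => //; have p0 := prime_gt0 p_pr.
    rewrite mq !lognM ?muln_gt0 ?p0 //.
    by rewrite addnn oddD odd_double.
  by exists (p * p * m1), m2; split; [rewrite mq qE mulnA | apply: S1M => //; apply: sqS |].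
have [|//|r r_pr o_r o_log|m1 [m2 [m'E s1 s2]]] := IHm m'.
- by rewrite mE -[X in X < _]mul1n ltn_pmul2r.
- apply: primS => //; rewrite mE lognM ?(prime_gt0 p_pr) //.
  have [rp|rp] := eqVneq r p; last by rewrite logn_prime // (negPf rp).
  by move: o_log; rewrite rp lognE (negPf p_m') !andbF.
case: (primS p p_pr op) => [|s|s].
- by rewrite mE lognM ?(prime_gt0 p_pr) // logn_prime // eqxx lognE (negPf p_m') !andbF.
- by exists (p * m1), m2; split; [rewrite mE m'E mulnA | apply: S1M |].
- by exists m1, (p * m2); split; [rewrite mE m'E; lia | | apply: S2M].
Qed.

(** * Prime fields as factors, and the attainable sizes *)

Local Open Scope ring_scope.

Section Fp.
Variable p : nat.
Hypotheses (p_pr : prime p).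

Lemma Fp_muln_inj k : (0 < k < p)%N -> injective (fun x : 'F_p => x *+ k).
Proof.
move=> kp; apply: morph_add_inj => [x y|x /eqP]; first by rewrite mulrnDl.
by rewrite -mulr_natr mulf_eq0 (negPf (natr_Fp_neq0 p_pr kp)) orbF => /eqP.
Qed.

Lemma Fp_double_inj : (2 < p)%N -> injective (fun x : 'F_p => x + x).
Proof.
move=> p2 x y e; apply: (@Fp_muln_inj 2); first by rewrite p2.
by rewrite /= !mulr2n.
Qed.

Lemma Fp_triple_inj : (3 < p)%N -> injective (fun x : 'F_p => x + x + x).
Proof.
move=> p3 x y e; apply: (@Fp_muln_inj 3); first by rewrite p3.
by rewrite /= !mulrS !mulr0n !addr0 !addrA.
Qed.

Lemma Fp_prim_root d : (d %| p.-1)%N -> (0 < d)%N ->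
  exists z : 'F_p, d.-primitive_root z.
Proof.
move=> d_dv d0; have p1 : (0 < p.-1)%N by rewrite -subn1 subn_gt0 prime_gt1.
have /hasP[z _ zP] : has p.-1.-primitive_root (enum [set~ (0 : 'F_p)]).
  apply: has_prim_root => //.
  - apply/allP => x; rewrite mem_enum !inE => x0.
    by rewrite unity_rootE Fp_expf_pred.
  - exact: enum_uniq.
  - by rewrite -cardE cardsC1 card_Fp.
by exists (z ^+ (p.-1 %/ d)); apply: dvdn_prim_root.
Qed.

Lemma Fp_gauss : (p %% 4 = 1)%N -> gauss_group 'F_p.
Proof.
move=> p4; have [|//|z zP] := @Fp_prim_root 4.
  by apply/dvdnP; exists (p %/ 4)%N; lia.
have p2 : (2 < p)%N by have := prime_gt1 p_pr; lia.
have z2 : z ^+ 2 = -1.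
  have : (z ^+ 2) ^+ 2 == 1 by rewrite -exprM (prim_expr_order zP).
  rewrite sqrf_eq1 => /orP[/eqP e|/eqP //].
  by have := eq_prim_root_expr zP 2 0; rewrite e expr0 eqxx.
exists (fun x => z * x); split.
- by move=> x y; rewrite mulrDr.
- by move=> x; rewrite mulrA -expr2 z2 mulN1r.
- exact: Fp_double_inj.
Qed.

Lemma Fp_eis : (p %% 3 = 1)%N -> (3 < p)%N -> eis_group 'F_p.
Proof.
move=> p3 p_gt3; have [|//|z zP] := @Fp_prim_root 3.
  by apply/dvdnP; exists (p %/ 3)%N; lia.
have z2 : z ^+ 2 = - 1 - z.
  have z1 : z - 1 != 0.
    rewrite subr_eq0; apply/eqP => e.
    by have := eq_prim_root_expr zP 1 0; rewrite expr0 expr1 e eqxx.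
  apply: (mulfI z1); have := prim_expr_order zP; rewrite exprS expr2 => e.
  have -> : (z - 1) * z ^+ 2 = z * (z * z) - z ^+ 2 by ring.
  by rewrite e; ring.
exists (fun x => z * x); split.
- by move=> x y; rewrite mulrDr.
- by move=> x; rewrite mulrA -expr2 z2 mulrBl mulN1r.
- by apply: Fp_double_inj; lia.
- exact: Fp_triple_inj.
Qed.

Lemma Fp_dm : (3 < p)%N -> dm_group 'F_p.
Proof. by move=> p3; apply: dm_double; [apply: Fp_double_inj; lia | apply: Fp_triple_inj]. Qed.

End Fp.

Section AdmSizes.
Variables (G0 : finGroupType) (j : G0).

Definition adm_size (n : nat) := exists2 D : finZmodType, #|D| = n & adm j D.

Definition adm_factor (q : nat) := forall n, adm_size n -> adm_size (n * q).

Lemma adm_factor1 : adm_factor 1.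
Proof. by move=> n; rewrite muln1. Qed.

Lemma adm_factorM a b : adm_factor a -> adm_factor b -> adm_factor (a * b).
Proof. by move=> fa fb n /fa/fb; rewrite mulnA. Qed.

Lemma adm_factor_linear (C : finZmodType) :
  dm_group C -> has_linear_family j C -> adm_factor #|C|.
Proof.
move=> dmC linC n [D cD admD]; exists (zprod D C); last exact: adm_step.
by rewrite card_prod cD.
Qed.

Hypothesis gauss_lin : forall C, gauss_group C -> has_linear_family j C.

Lemma adm_factor_square p : prime p -> odd p -> adm_factor (p * p).
Proof.
move=> p_pr op; have p2 : (2 < p)%N.
  by have := prime_gt1 p_pr; rewrite leq_eqVlt => /orP[/eqP e|//]; rewrite -e in op.
have g := gauss_zprod (Fp_double_inj p_pr p2).
have := adm_factor_linear (dm_gauss g) (gauss_lin g).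
by rewrite card_prod card_Fp.
Qed.

Lemma adm_factor_gauss p : prime p -> (p %% 4 = 1)%N -> adm_factor p.
Proof.
move=> p_pr p4; have g := Fp_gauss p_pr p4.
by have := adm_factor_linear (dm_gauss g) (gauss_lin g); rewrite card_Fp.
Qed.

Lemma adm_factor_eis p : (forall C, eis_group C -> has_linear_family j C) ->
  prime p -> (p %% 3 = 1)%N -> adm_factor p.
Proof.
move=> eis_lin p_pr p3; have p_gt3 : (3 < p)%N.
  have := prime_gt1 p_pr; case: (p) p_pr p3 => [|[|[|[|q]]]] //.
have := adm_factor_linear (Fp_dm p_pr p_gt3) (eis_lin _ (Fp_eis p_pr p3 p_gt3)).
by rewrite card_Fp.
Qed.

End AdmSizes.

Lemma adm_factor_quad (G0 : finGroupType) (j : G0) p :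
  has_linear_family j 'F_p -> prime p -> (p %% 12 = 11)%N -> adm_factor j p.
Proof.
move=> lin p_pr p11; have p3 : (3 < p)%N by lia.
by have := adm_factor_linear (Fp_dm p_pr p3) lin; rewrite card_Fp.
Qed.

Lemma prime_mod12 p : prime p -> odd p -> p <> 3%N ->
  [\/ p %% 4 = 1, p %% 3 = 1 | p %% 12 = 11]%N.
Proof.
move=> p_pr op p3.
have n3 : (p %% 3 != 0)%N.
  by apply: contra_not_neq p3 => /eqP; rewrite -/(3 %| p)%N dvdn_prime2 // => /eqP.
have : (p %% 2 = 1)%N by rewrite modn2 op.
move=> p2.
have [h|[h|h]] : (p %% 4 = 1 \/ (p %% 3 = 1 \/ p %% 12 = 11))%N by lia.
- by constructor 1.
- by constructor 2.
- by constructor 3.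
Qed.

Local Notation j2 := (invol 2).
Local Notation j23 := ((invol 2, 0) : eis 2 * 'Z_3).
Local Notation j233 := ((invol 2, 0) : eis 2 * zprod 'Z_3 'Z_3).

Lemma adm_size_factor (G0 : finGroupType) (j : G0) m :
    adm j 'I_1 -> odd m ->
    (forall p, prime p -> odd p -> adm_factor j (p * p)) ->
    (forall p, prime p -> odd p -> odd (logn p m) -> adm_factor j p) ->
  adm_size j m.
Proof.
move=> adm1 om sq mP.
have [||||p p_pr op|//|p p_pr op /(mP p p_pr op)|m1 [m2 [-> fm1 <-]]] :=
    @split_factor (adm_factor j) (eq 1%N) m.
- exact: adm_factor1.
- by [].
- exact: adm_factorM.
- by move=> a b <- <-.
- exact: sq.
- by left.
by rewrite muln1 -[m1]mul1n; apply: fm1; exists 'I_1; first exact: card_ord.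
Qed.

Lemma adm_2_size m : odd m ->
  (forall p, prime p -> odd (logn p m) -> p <> 3%N /\ (p %% 12 <> 11)%N) ->
  adm_size j2 m.
Proof.
move=> om mP; apply: (adm_size_factor adm_2 om) => p p_pr op.
  exact: (adm_factor_square linear_2_gauss).
move=> /(mP p p_pr)[p3 p11]; case: (prime_mod12 p_pr op p3) => // h.
  exact: (adm_factor_gauss linear_2_gauss).
exact: (adm_factor_eis linear_2_eis).
Qed.

Lemma adm_23_size m : odd m -> ~~ odd (logn 3 m) -> adm_size j23 m.
Proof.
move=> om ev3; apply: (adm_size_factor adm_23 om) => p p_pr op.
  exact: (adm_factor_square linear_23_gauss).
move=> olog; have p3 : p <> 3%N by move=> e; rewrite e in olog; rewrite olog in ev3.
case: (prime_mod12 p_pr op p3) => h.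
- exact: (adm_factor_gauss linear_23_gauss).
- exact: (adm_factor_eis linear_23_eis).
- by apply: adm_factor_quad => //; apply: linear_23_quad.
Qed.

Lemma Z3_gauss : gauss_group (zprod 'Z_3 'Z_3).
Proof. exact: gauss_zprod (@Fp_double_inj 3 isT isT). Qed.

(** The factor [zprod 'Z_3 'Z_3] has a difference matrix, so the Gauss and Eisenstein families over
    [eis 2] spread over it; only primes equal to 11 modulo 12 use a separate pattern. *)
Lemma adm_233_size m : odd m -> ~~ odd (logn 3 m) -> adm_size j233 m.
Proof.
have dm9 : dm_group (zprod 'Z_3 'Z_3) := dm_gauss Z3_gauss.
have lin_g C : gauss_group C -> has_linear_family j233 C.
  by move=> g; apply: linear_family_dm dm9 (linear_2_gauss g).
have lin_e C : eis_group C -> has_linear_family j233 C.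
  by move=> g; apply: linear_family_dm dm9 (linear_2_eis g).
move=> om ev3; apply: (adm_size_factor adm_233 om) => p p_pr op.
  exact: (adm_factor_square lin_g).
move=> olog; have p3 : p <> 3%N by move=> e; rewrite e in olog; rewrite olog in ev3.
case: (prime_mod12 p_pr op p3) => h.
- exact: (adm_factor_gauss lin_g).
- exact: (adm_factor_eis lin_e).
- by apply: adm_factor_quad => //; apply: linear_233_quad.
Qed.

(** Primes equal to 11 modulo 12 are adjoined over [eis 4]; all other factors are adjoined over
    [eis 2] and carried along by the doubling. *)
Lemma adm_4_size m : odd m -> ~~ odd (logn 3 m) -> adm_size (invol 4) m.
Proof.
move=> om ev3.
have [||||p p_pr op|//|p p_pr op olog|m1 [m2 [-> fm1 fm2]]] :=
    @split_factor (adm_factor j2) (adm_factor (invol 4)) m.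
- exact: adm_factor1.
- exact: adm_factor1.
- exact: adm_factorM.
- exact: adm_factorM.
- exact: (adm_factor_square linear_2_gauss).
- have p3 : p <> 3%N by move=> e; rewrite e in olog; rewrite olog in ev3.
  case: (prime_mod12 p_pr op p3) => h.
  + by left; apply: (adm_factor_gauss linear_2_gauss).
  + by left; apply: (adm_factor_eis linear_2_eis).
  + by right; apply: adm_factor_quad => //; apply: linear_4_quad.
apply: fm2; rewrite -[m1]mul1n.
have [|D cD admD] := fm1 1%N; first by exists 'I_1; [apply: card_ord | apply: adm_2].
by exists D => //; apply: adm_4.
Qed.

Lemma logn3_half m : (3 %| m)%N -> odd m ->
  exists m', [/\ m = (3 * m')%N, odd m' & odd (logn 3 m') = ~~ odd (logn 3 m)].
Proof.
move=> /dvdnP[m' mE] om; exists m'; have om' : odd m' by move: om; rewrite mE oddM => /andP[].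
split=> //; first by rewrite mulnC.
have m'0 : (0 < m')%N by case: m' om' {mE}.
by rewrite mE lognM // lognE /= addn1 /= negbK.
Qed.

(** The abelian steps adjoin 3 only in squares. Placing one or two factors ['Z_3] beside [eis 2]
    leaves an even exponent of 3. *)
Lemma KTS_eis_odd m : odd m -> (3 %| m)%N -> exists_3pyramidal_KTS (12 * m + 3).
Proof.
move=> om m3; have [m1 [mE om1 l1]] := logn3_half m3 om.
have [ol|el] := boolP (odd (logn 3 m1)); last first.
  have [D cD admD] := adm_23_size om1 el.
  by have := adm_KTS admD; rewrite card_23 cD mE; congr exists_3pyramidal_KTS; lia.
have m13 : (3 %| m1)%N by move: ol; rewrite lognE; case: ifP => // /and3P[].
have [m2 [m1E om2 l2]] := logn3_half m13 om1.
have [|D cD admD] := @adm_233_size m2 om2; first by rewrite l2 ol.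
by have := adm_KTS admD; rewrite card_233 cD mE m1E; congr exists_3pyramidal_KTS; lia.
Qed.

Lemma KTS_eis_residues m : odd m ->
  (forall p, prime p -> odd (logn p m) -> p <> 3%N /\ (p %% 12 <> 11)%N) ->
  exists_3pyramidal_KTS (12 * m + 3).
Proof.
move=> om mP; have [D cD admD] := adm_2_size om mP.
by have := adm_KTS admD; rewrite card_eis // cD.
Qed.

Lemma KTS_tower m e : odd m -> exists_3pyramidal_KTS (48 * (4 ^ e * m) + 3).
Proof.
(* The modulus is [2 ^ e.+2], reached by [e] steps of the tower from 4. *)
move=> om; have pow N : N = (2 ^ e.+2)%N -> (N ^ 2 * 3 = 48 * 4 ^ e)%N.
  by move->; rewrite (_ : 4 = 2 * 2)%N // expnMn !expnS; ring.
have [ol|el] := boolP (odd (logn 3 m)); last first.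
  have [D cD admD] := adm_4_size om el.
  have [n nE admn] := tower admD e.
  have := adm_KTS admn; rewrite card_eis // cD pow ?mulnA //.
  by rewrite nxtE nE -expnS.
have m3 : (3 %| m)%N by move: ol; rewrite lognE; case: ifP => // /and3P[].
have [m1 [mE om1 l1]] := logn3_half m3 om.
have [|D cD admD] := @adm_23_size m1 om1; first by rewrite l1 ol.
have [n nE admn] := tower_Z3 (adm_43 admD) e.
have := adm_KTS admn; rewrite card_prod card_eis // cD (card_ord 3) pow.
  by rewrite mE; congr exists_3pyramidal_KTS; ring.
by rewrite nxtE nE -expnS.
Qed.

(** * Gauss groups whose order is a sum of two squares *)

Lemma gauss_cyclic N c : (N.+1 %| c ^ 2 + 1)%N -> odd N.+1 -> gauss_group 'I_N.+1.
Proof.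
move=> dvdc oN; have mul0 (x : 'I_N.+1) k : (N.+1 %| k)%N -> x *+ k = 0.
  by move=> /dvdnP[q ->]; apply: val_inj; rewrite Zp_mulrn /= mulnA modnMl.
exists (fun x => x *+ c); split.
- by move=> x y; rewrite mulrnDl.
- move=> x; rewrite -mulrnA; apply/eqP; rewrite -addr_eq0 -mulrSr; apply/eqP/mul0.
  by rewrite mulnn -[(c ^ 2).+1]addn1.
(* [(N.+2)./2] inverts 2 modulo the odd number [N.+1]. *)
- move=> x y; rewrite -!mulr2n => /(congr1 (fun z => z *+ (N.+2)./2)).
  have e (z : 'I_N.+1) : z *+ 2 *+ (N.+2)./2 = z.
    rewrite -mulrnA mul2n even_halfK; last by rewrite /= negbK in oN *.
    by rewrite mulrS mul0 ?addr0.
  by rewrite !e.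
Qed.

Lemma gauss_zprod2 C D : gauss_group C -> gauss_group D -> gauss_group (zprod C D).
Proof.
move=> [s [sD ss sI]] [t [tD tt tI]]; exists (fun x : C * D => (s x.1, t x.2)); split.
- by move=> [a b] [c d]; congr (_, _); rewrite /= ?sD ?tD.
- by move=> [a b]; congr (_, _); rewrite /= ?ss ?tt.
- by move=> [a b] [c d] [] /sI-> /tI->.
Qed.

(** Modulo the sum of squares [b] is invertible, and the square of a/b is -1; [u] below is the
    inverse of [b]. *)
Lemma gauss_coprime_squares a b : coprime a b -> odd (a ^ 2 + b ^ 2) ->
  exists2 C : finZmodType, #|C| = (a ^ 2 + b ^ 2)%N & gauss_group C.
Proof.
move=> cab oab; case NE: (a ^ 2 + b ^ 2)%N oab => [|N] // oN.
exists 'I_N.+1; first exact: card_ord.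
have [b0|b0] := posnP b.
  apply: (@gauss_cyclic _ 0) => //.
  by move: cab NE; rewrite b0 /coprime gcdn0 => /eqP-> [<-].
have cb : coprime b N.+1.
  rewrite -NE /coprime addnC -[(b ^ 2)%N]mulnn gcdnMDl -/(coprime _ _).
  by rewrite coprimeXr // coprime_sym.
have [[u w] /= uw] := coprimeP _ b0 cb.
have ub : (u * b = w * N.+1 + 1)%N by lia.
apply: (@gauss_cyclic _ (a * u)) => //.
rewrite -(@Gauss_dvdr _ (b ^ 2)); last by rewrite coprimeXr // coprime_sym.
have -> : (b ^ 2 * ((a * u) ^ 2 + 1) = a ^ 2 * (u * b) ^ 2 + b ^ 2)%N by nia.
have -> : (a ^ 2 * (u * b) ^ 2 + b ^ 2 = a ^ 2 * (w * (w * N.+1 + 2)) * N.+1 + N.+1)%N.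
  by rewrite ub -NE; nia.
by rewrite dvdn_addl ?dvdn_mull.
Qed.

(** With d the greatest common divisor, two copies of the integers modulo d carry the factor
    [d * d], and the coprime quotients carry the rest. *)
Lemma gauss_squares a b : odd (a ^ 2 + b ^ 2) ->
  exists2 C : finZmodType, #|C| = (a ^ 2 + b ^ 2)%N & gauss_group C.
Proof.
move=> oab; have g0 : (0 < gcdn a b)%N.
  by rewrite gcdn_gt0; move: oab; case: a b => [|a] [|b].
pose d := gcdn a b; have [a' aE] : exists a', a = (a' * d)%N by apply/dvdnP/dvdn_gcdl.
have [b' bE] : exists b', b = (b' * d)%N by apply/dvdnP/dvdn_gcdr.
have cab : coprime a' b'.
  by rewrite /coprime -(eqn_pmul2r g0) -/d muln_gcdl -aE -bE mul1n.
have sE : (a ^ 2 + b ^ 2 = d * d * (a' ^ 2 + b' ^ 2))%N by rewrite aE bE; nia.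
have [od os] : odd d /\ odd (a' ^ 2 + b' ^ 2).
  by move: oab; rewrite sE !oddM => /andP[/andP[]].
have [C cC gC] := gauss_coprime_squares cab os.
case dE: d od g0 => [|d'] // od _.
exists (zprod (zprod 'I_d'.+1 'I_d'.+1) C).
  by rewrite !card_prod !card_ord cC sE dE.
apply: gauss_zprod2 gC; apply: gauss_zprod => x y.
rewrite -!mulr2n => /(congr1 (fun z => z *+ (d'.+2)./2)).
have e (z : 'I_d'.+1) : z *+ 2 *+ (d'.+2)./2 = z.
  rewrite -mulrnA mul2n even_halfK; last by rewrite /= negbK in od *.
  rewrite mulrS -[RHS]addr0; congr (_ + _); apply: val_inj.
  by rewrite Zp_mulrn /= modnMl.
by rewrite !e.
Qed.

Lemma adm_dih3 : adm S3j 'I_1.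
Proof.
pose r a : dih3 := (inZp a, 0).
apply/adm_trivial/(base_family (h := r 1%N) (p := [::]) (ys := [:: r 0%N; r 1%N; r 2%N]) all_dih3P).
  by rewrite card_prod !card_ord.
by vm_compute.
Qed.

Lemma KTS_dih3 a b : odd (a ^ 2 + b ^ 2) -> exists_3pyramidal_KTS (6 * (a ^ 2 + b ^ 2) + 3).
Proof.
move=> oab; have [C cC gC] := gauss_squares oab.
have := adm_KTS (adm_step adm_dih3 (dm_gauss gC) (linear_dih3_gauss gC)).
by rewrite !card_prod !card_ord cC mul1n.
Qed.

Local Close Scope ring_scope.

Lemma dvdn_squarefree_part p m : prime p -> odd (logn p m) -> p %| squarefree_part m.
Proof.
move=> pp op; have pm : p \in primes m.
  by rewrite -logn_gt0; case: logn op.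
by rewrite /squarefree_part (big_rem p) //= op dvdn_mulr.
Qed.

Theorem theorem1p1 (v : nat) (hv : 0 < v) :
  (exists_3pyramidal_KTS v ->
     [\/ exists n : nat, v = 24 * n + 9,
         exists n : nat, v = 24 * n + 15
       | exists n e m : nat,
           [/\ 0 < n, n = 4 ^ e * m, odd m & v = 48 * n + 3]])
  /\
  [/\ forall n : nat, v = 24 * n + 9 ->
        (exists a b : nat, 4 * n + 1 = a ^ 2 + b ^ 2) ->
        exists_3pyramidal_KTS v,
      forall n : nat, v = 24 * n + 15 ->
        (2 * n + 1 = 0 %[mod 3] \/
         (forall p : nat, prime p -> p %| squarefree_part (2 * n + 1) ->
            p <> 11 %[mod 12])) ->
        exists_3pyramidal_KTS v
    & forall n e m : nat, v = 48 * n + 3 -> n = 4 ^ e * m -> 0 < m -> odd m ->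
        exists_3pyramidal_KTS v].
Proof.
split; first exact: necessary_orders.
split=> [n vE [a [b abE]] | n vE res | n e m -> -> _ om].
- have -> : v = 6 * (a ^ 2 + b ^ 2) + 3 by rewrite -abE vE; lia.
  by apply: KTS_dih3; rewrite -abE; lia.
- have -> : v = 12 * (2 * n + 1) + 3 by rewrite vE; lia.
  have om : odd (2 * n + 1) by lia.
  have [d3|nd3] := boolP (3 %| 2 * n + 1); first exact: KTS_eis_odd.
  case: res => [m0|res]; first by rewrite /dvdn m0 in nd3.
  apply: KTS_eis_residues => // p pp op; have sp := dvdn_squarefree_part pp op.
  split=> [p3|]; last exact: res p pp sp.
  case/negP: nd3; rewrite -p3; suff: p \in primes (2 * n + 1) by rewrite mem_primes => /and3P[].
  by rewrite -logn_gt0; case: logn op.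
exact: KTS_tower.
Qed.
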